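(* Let $\mathfrak{n}\in A_+$. For a family $\underline{r}=(r_{\mathfrak{a}})$ of integers indexed by the monic divisors $\mathfrak{a}$ of $\mathfrak{n}$, let $$g_{\underline{r}}(z):=\prod_{\substack{\mathfrak{a}\mid\mathfrak{n}\\ \mathfrak{a}\in A_+}}\Delta_{\mathfrak{a}}(z)^{r_{\mathfrak{a}}},\qquad \Delta_{\mathfrak{a}}(z):=\Delta(\mathfrak{a}z).$$ Then $g_{\underline{r}}$ has a $(q-1)(q^2-1)$-th root which is a modular function on $X_0(\mathfrak{n})$ (i.e. there is a meromorphic function $f$ on $\Omega\cup\mathbb{P}^1(K)$, invariant under $\Gamma_0(\mathfrak{n})$, with $f^{(q-1)(q^2-1)}=g_{\underline{r}}$) if and only if all of the following hold: (1) $\sum_{\mathfrak{a}\mid\mathfrak{n},\,\mathfrak{a}\in A_+} r_{\mathfrak{a}}\,|\mathfrak{a}|\equiv 0 \pmod{(q-1)(q^2-1)}$; (2) $\sum_{\mathfrak{a}\mid\mathfrak{n},\,\mathfrak{a}\in A_+} r_{\mathfrak{a}}\,|\mathfrak{n}/\mathfrak{a}|\equiv 0 \pmod{(q-1)(q^2-1)}$; (3) $\sum_{\mathfrak{a}\mid\mathfrak{n},\,\mathfrak{a}\in A_+} r_{\mathfrak{a}}=0$; (4) $\prod_{\mathfrak{a}\mid\mathfrak{n},\,\mathfrak{a}\in A_+}\mathfrak{a}^{r_{\mathfrak{a}}}\in (K^\ast)^{q-1}$.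
   Context: $\mathbb{F}_q$ is a finite field with $q$ elements, $A=\mathbb{F}_q[T]$, $K=\mathbb{F}_q(T)$, $A_+$ is the set of monic polynomials in $A$, and a prime means a monic irreducible polynomial. $K_\infty=\mathbb{F}_q((1/T))$, $|\cdot|$ is the absolute value on $K_\infty$ with $|T|=q$ (so $|\mathfrak{a}|=q^{\deg\mathfrak{a}}$ for $\mathfrak{a}\in A_+$), $\mathbb{C}_\infty$ is the completion of an algebraic closure of $K_\infty$, and $\Omega=\mathbb{C}_\infty-K_\infty$ is the Drinfeld upper half plane. $\Gamma_0(\mathfrak{n})$ is the group of matrices $\begin{pmatrix}a&b\\c&d\end{pmatrix}\in\operatorname{GL}_2(A)$ with $c\equiv 0\bmod\mathfrak{n}$, acting on $\Omega\cup\mathbb{P}^1(K)$ by linear fractional transformations; $X_0(\mathfrak{n})$ is the Drinfeld modular curve of level $\mathfrak{n}$, whose $\mathbb{C}_\infty$-points are $\Gamma_0(\mathfrak{n})\backslash(\Omega\cup\mathbb{P}^1(K))$. A modular function on $X_0(\mathfrak{n})$ is a rigid-analytic meromorphic function on $\Omega$ (meromorphic at the cusps) invariant under $\Gamma_0(\mathfrak{n})$. $\Delta$ is the Drinfeld discriminant function (as normalized by Gekeler), a nowhere-vanishing holomorphic rigid-analytic Drinfeld modular form on $\Omega$ of weight $q^2-1$ and type $0$ for $\operatorname{GL}_2(A)$. *)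

(* Defs.v *)
From HB Require Import structures.
From mathcomp Require Import all_boot all_order all_algebra.
From mathcomp Require Import all_classical all_reals.

Set Implicit Arguments.
Unset Strict Implicit.
Unset Printing Implicit Defensive.
Import Order.TTheory GRing.Theory Num.Theory.
Local Open Scope classical_set_scope.
Local Open Scope ring_scope.

Notation ratfun F := {fraction {poly F}}.
Notation "x %:F" := (tofrac x) : ring_scope.

Section FiniteField.
Variable F : finFieldType.

(* The absolute value q ^ deg a of a nonzero polynomial a. *)
Definition pnorm (a : {poly F}) : nat := (#|F| ^ (size a).-1)%N.

(* rVpoly maps 'rV_d bijectively onto the polynomials of degree < d. *)
Definition monic_divisors (n : {poly F}) : seq {poly F} :=
  [seq a <- [seq rVpoly u | u : 'rV[F]_(size n)] | (a \is monic) && (a %| n)].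

Lemma monic_divisors_uniq n : uniq (monic_divisors n).
Proof.
apply: filter_uniq; rewrite map_inj_uniq ?enum_uniq //.
exact: can_inj rVpolyK.
Qed.

Lemma mem_monic_divisors n a :
  n != 0 -> (a \in monic_divisors n) = (a \is monic) && (a %| n).
Proof.
move=> n0; rewrite mem_filter.
have [|//] := boolP ((a \is monic) && (a %| n)).
move=> /andP[_ an] /=; apply/mapP.
exists (poly_rV a); first by rewrite mem_enum.
by rewrite poly_rV_K // dvdp_leq.
Qed.

Definition GL2A (g : 'M[{poly F}]_2) : Prop := g \in unitmx.

Definition Gamma0 (n : {poly F}) (g : 'M[{poly F}]_2) : Prop :=
  GL2A g /\ n %| g 1 0.

Definition is_power (m : nat) (x : ratfun F) : Prop :=
  exists y : ratfun F, y != 0 /\ x = y ^+ m.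

End FiniteField.

(* K_oo is realised as the topological closure of K inside the ambient field,
   which is complete. *)
Definition closure_of_K (F : finFieldType) (R : realType) (C : fieldType)
    (iota : ratfun F -> C) (v : C -> R) : set C :=
  [set x | forall e : R, 0 < e -> exists k : ratfun F, v (x - iota k) < e].

(* The completion of an algebraic closure of K_oo = F_q((1/T)), specified
   up to isometric isomorphism: an algebraically closed field containing K,
   complete for an ultrametric absolute value extending the one of K with
   |T| = q, and in which the elements algebraic over K_oo (which form an
   algebraic closure of K_oo) are dense. *)
Record Cinfty (F : finFieldType) (R : realType) := MkCinfty {
  Cinf :> closedFieldType;
  Kemb : {rmorphism ratfun F -> Cinf};
  absv : Cinf -> R;
  absv_ge0 : forall x, 0 <= absv x;
  absv_eq0 : forall x, absv x = 0 <-> x = 0;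
  absvM : forall x y, absv (x * y) = absv x * absv y;
  absvD : forall x y, absv (x + y) <= Num.max (absv x) (absv y);
  absv_poly : forall a : {poly F}, a != 0 -> absv (Kemb a%:F) = (pnorm a)%:R;
  absv_complete : forall u : nat -> Cinf,
    (forall e, 0 < e -> exists N, forall i j,
       (N <= i)%N -> (N <= j)%N -> absv (u i - u j) < e) ->
    exists l, forall e, 0 < e -> exists N, forall i,
       (N <= i)%N -> absv (u i - l) < e;
  alg_dense : forall x e, 0 < e -> exists y, absv (x - y) < e /\
    exists p : {poly Cinf},
      [/\ p != 0, root p y & forall i, closure_of_K Kemb absv p`_i] }.

Section Drinfeld.
Variables (F : finFieldType) (R : realType) (C : Cinfty F R).
Local Notation q := #|F|.
Local Notation "`| x |" := (absv (x : C)) : ring_scope.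

Definition Kinf : set C := closure_of_K (Kemb C) (@absv F R C).

Definition Omega : set C := ~` Kinf.

Definition Aemb (a : {poly F}) : C := Kemb C a%:F.

Definition cvg_seq (u : nat -> C) (l : C) : Prop :=
  forall e : R, 0 < e -> exists N, forall i, (N <= i)%N -> `|u i - l| < e.

Definition lim_seq (u : nat -> C) : C := xget 0 [set l | cvg_seq u l].

(* x \prod_(0 != l in L) (1 - x / l), for a discrete subgroup L whose
   intersection with every disc is finite. *)
Definition lattice_exp (L : set C) (x : C) : C :=
  lim_seq (fun m =>
    x * \big[*%R/1]_(l \in [set l | [/\ L l, l != 0 & `|l| <= m%:R]])
          (1 - x / l)).

(* phi_T for the Drinfeld module attached to L, i.e. the polynomial with
   exp_L (T x) = phi_T (exp_L x) for all x. *)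
Definition drinfeld_T (L : set C) : {poly C} :=
  xget 0 [set p | forall x, lattice_exp L (Aemb 'X * x) = p.[lattice_exp L x]].

Definition lattice2 (z : C) : set C :=
  [set l | exists a b, l = Aemb a * z + Aemb b].

Definition lattice1 (n : {poly F}) : set C :=
  [set l | exists a, l = Aemb (n * a)].

(* phi_T = T X + g(z) X^q + Delta(z) X^(q^2) for the lattice A z + A. *)
Definition Delta (z : C) : C := (drinfeld_T (lattice2 z))`_(q ^ 2).

Definition Delta_quotient (n : {poly F}) (r : {poly F} -> int) (z : C) : C :=
  \prod_(a <- monic_divisors n) Delta (Aemb a * z) ^ r a.

Definition moebius (g : 'M[{poly F}]_2) (z : C) : C :=
  (Aemb (g 0 0) * z + Aemb (g 0 1)) / (Aemb (g 1 0) * z + Aemb (g 1 1)).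

(* The usual exhaustion of Omega by connected affinoids, |z| <= q^m and
   |z|_i >= q^-m, where |z|_i is the distance from z to K_oo; these form an
   admissible covering of Omega. *)
Definition Omega_aff (m : nat) : set C :=
  [set z | `|z| <= (q ^ m)%:R /\
           forall x, Kinf x -> (q ^ m)%:R^-1 <= `|z - x|].

(* Sections of the structure sheaf on an affinoid X of the projective line:
   uniform limits of rational functions without poles on X. *)
Definition holomorphic_on (X : set C) (f : C -> C) : Prop :=
  forall e : R, 0 < e -> exists p s : {poly C}, forall z, X z ->
    s.[z] != 0 /\ `|f z - p.[z] / s.[z]| < e.

(* Functions to the projective line have type C -> option C, with None the
   point at infinity. As X is a connected affinoid of the projective line,
   O(X) is a principal ideal domain, so that a meromorphic function is a
   quotient without common zeros. *)
Definition meromorphic_on (X : set C) (f : C -> option C) : Prop :=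
  exists g h : C -> C,
    [/\ holomorphic_on X g, holomorphic_on X h,
        exists2 z, X z & h z != 0
      & forall z, X z -> (g z != 0 \/ h z != 0) /\
          f z = if h z == 0 then None else Some (g z / h z)].

Definition meromorphic_Omega (f : C -> option C) : Prop :=
  forall m, meromorphic_on (Omega_aff m) f.

(* A parameter at the cusp oo for the translations by n A; these belong to
   every GL_2(A)-conjugate of Gamma_0(n). *)
Definition cusp_param (n : {poly F}) (z : C) : C :=
  (lattice_exp (lattice1 n) z)^-1.

(* f o g has, for |z|_i large, an expansion in the parameter with finitely
   many negative exponents. *)
Definition meromorphic_at_cusp (n : {poly F}) (g : 'M[{poly F}]_2)
    (f : C -> option C) : Prop :=
  exists (c : R) (k : nat) (a : nat -> C), 0 < c /\
    forall z, (forall x, Kinf x -> c <= `|z - x|) ->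
      exists w, f (moebius g z) = Some w /\
        cvg_seq (fun m => \sum_(i < m) a i * cusp_param n z ^+ i)
                (w * cusp_param n z ^+ k).

(* The cusps, i.e. the points of P^1(K), are the images of oo under GL_2(A),
   as A is a principal ideal domain. *)
Definition modular_function (n : {poly F}) (f : C -> option C) : Prop :=
  [/\ meromorphic_Omega f,
      forall g, Gamma0 n g -> forall z, Omega z -> f (moebius g z) = f z
    & forall g, GL2A g -> meromorphic_at_cusp n g f].

Definition has_modular_root (n : {poly F}) (N : nat) (u : C -> C) : Prop :=
  exists f : C -> option C, modular_function n f /\
    forall z, Omega z -> omap (fun w => w ^+ N) (f z) = Some (u z).

End Drinfeld.

(* Main.v *)
From HB Require Import structures.
Require Import Defs.
From mathcomp Require Import all_boot all_order all_algebra all_field.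
From mathcomp Require Import finmap.
From mathcomp Require Import all_classical all_reals.
From mathcomp Require Import ring lra zify.

Set Implicit Arguments.
Unset Strict Implicit.
Unset Printing Implicit Defensive.
Import Order.TTheory GRing.Theory Num.Theory.
Local Open Scope classical_set_scope.
Local Open Scope ring_scope.

(** Write [L_z = A z + A] and [e_z] for its exponential. Comparing leading coefficients along
    the isogeny from [L_z] to [A z + m^-1 A] gives
      [Delta (m z) = m ^ (1 - q^2) * Delta z ^ |m| * E_m z ^ N],
    where [N = (q - 1) (q^2 - 1)] and [E_m z] is the product of the [e_z (b / m)] over the monic
    [b] of degree [< deg m]. Hence, when (1) holds, [Delta ^ (s / N) * \prod_m E_m ^ r_m] with
    [s = \sum_m r_m |m|] is up to a constant an N-th root of the quotient, and under [Gamma0 n]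
    it is multiplied by a power of the automorphy factor, trivial by (3), and by the
    product of the power residue symbols [(d / m) ^ r_m], which is trivial for all [d] prime
    to [n] exactly when (4) holds.

    Conversely, weights give (3). A root [f] has an order [j] at the cusp oo, divisible by
    [q - 1] as [f (c z) = f z] for constants [c]; along [z = T^i w] with [w] in [F_(q^2)] outside
    [F] one has [|E_m z|] constant and [|Delta z| = const * |t z| ^ ((q - 1) |n|)] in the cusp
    parameter [t], whence [N j = (q - 1) |n| s] and (1). Then [f] and the root above differ by
    a locally constant N-th root of unity; it is constant because the rings of holomorphic
    functions on the affinoids of [Omega] have no zero divisors, checked here only between the
    points [w] and [g w] of the same quadratic extension. So the residue symbols are trivial and
    (4) follows. Finally (1) and (4) imply (2) as [q ^ (2 d) = 1 + (q^2 - 1) d] modulo [N]. *)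

(** The two factors of N have different origins: q^2 - 1 is the power to which the leading
    coefficient of the isogeny enters the comparison, and q - 1 is the number of nonzero constants,
    which merge the torsion values on one F-line into a power. The constant of F left over by this
    merging is killed by the power q^2 - 1. The analysis rests on one ultrametric fact about the
    product of the 1 - x / l. A factor with |l| > |x| has absolute value 1, and one with |l| > M
    lies within |x| / M of 1. A finite product over a set containing the disc of radius |x| thus has
    the exact absolute value already, and its relative error is uniform in z on an affinoid. For (4)
    the obstacle is that w and g w are far apart. Nonvanishing is carried up the tree from both
    vertices until the two paths meet. It takes the form of a lower bound at all but finitely many
    elements algebraic over F, so that two such bounds hold at a common point. A quadratic w is
    chosen because g w then lies in K + K w, hence again over a vertex. *)

Section AbsoluteValue.
Variables (F : finFieldType) (R : realType) (C : Cinfty F R).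
Local Notation q := #|F|.
Local Notation "`| x |" := (absv x) : ring_scope.
Implicit Types (x y z : C) (e : R).

(** * Ultrametric absolute value *)

Lemma abs0 : `|0 : C| = 0. Proof. exact/absv_eq0. Qed.

Lemma abs_eq0 x : (`|x| == 0) = (x == 0).
Proof. by apply/eqP/eqP => /absv_eq0. Qed.

Lemma abs_gt0 x : (0 < `|x|) = (x != 0).
Proof. by rewrite lt_def absv_ge0 andbT abs_eq0. Qed.

Lemma abs1 : `|1 : C| = 1.
Proof.
have /eqP := absvM (1 : C) 1; rewrite mulr1 -subr_eq0 -{1}[ `|1|]mulr1 -mulrBr.
by rewrite mulf_eq0 abs_eq0 oner_eq0 /= subr_eq0 => /eqP.
Qed.

Lemma absX x n : `|x ^+ n| = `|x| ^+ n.
Proof. by elim: n => [|n IH]; rewrite ?abs1 // !exprS absvM IH. Qed.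

Lemma absN x : `|- x| = `|x|.
Proof.
have: `|(-1 : C)| ^+ 2 == 1 by rewrite -absX sqrrN expr1n abs1.
rewrite sqrf_eq1 => /orP[] /eqP h; first by rewrite -mulN1r absvM h mul1r.
by have := absv_ge0 (-1 : C); rewrite h oppr_ge0 ler10.
Qed.

Lemma absV x : `|x^-1| = `|x|^-1.
Proof.
have [->|x0] := eqVneq x 0; first by rewrite invr0 abs0 invr0.
apply: (mulfI (x := `|x|)); first by rewrite abs_eq0.
by rewrite -absvM !divff ?abs_eq0 // abs1.
Qed.

Lemma absXz x (k : int) : `|x ^ k| = `|x| ^ k.
Proof. by case: k => k /=; rewrite ?NegzE -?exprnN ?absV absX. Qed.

Lemma absB x y : `|x - y| = `|y - x|.
Proof. by rewrite -absN opprB. Qed.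

Lemma absDle x y e : `|x| <= e -> `|y| <= e -> `|x + y| <= e.
Proof. by move=> xe ye; rewrite (le_trans (absvD _ _)) // ge_max xe. Qed.

Lemma absDlt x y e : `|x| < e -> `|y| < e -> `|x + y| < e.
Proof. by move=> xe ye; rewrite (le_lt_trans (absvD _ _)) // gt_max xe. Qed.

Lemma absBle x y e : `|x| <= e -> `|y| <= e -> `|x - y| <= e.
Proof. by move=> xe ye; rewrite absDle // absN. Qed.

Lemma absBlt x y e : `|x| < e -> `|y| < e -> `|x - y| < e.
Proof. by move=> xe ye; rewrite absDlt // absN. Qed.

Lemma absD_dom x y : `|y| < `|x| -> `|x + y| = `|x|.
Proof.
move=> yx; apply/eqP; rewrite eq_le absDle ?(ltW yx) //=.
rewrite leNgt; apply/negP => h.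
by have := absBlt h yx; rewrite addrK ltxx.
Qed.

Lemma absB_dom x y : `|y| < `|x| -> `|x - y| = `|x|.
Proof. by move=> yx; rewrite absD_dom // absN. Qed.

Lemma abs_near x y : `|x - y| < `|x| -> `|y| = `|x|.
Proof. by move=> h; rewrite -[y in LHS](subKr x) absB_dom. Qed.

Lemma abs_near2 x y e : `|x - y| < e -> e <= `|x| -> `|y| = `|x|.
Proof. by move=> h1 h2; apply: abs_near; apply: lt_le_trans h2. Qed.

Lemma abs_sum (I : Type) (r : seq I) (P : pred I) (f : I -> C) e :
  0 <= e -> (forall i, P i -> `|f i| <= e) -> `|\sum_(i <- r | P i) f i| <= e.
Proof.
move=> e0 h; apply: (big_ind (fun x => `|x| <= e)) => //; first by rewrite abs0.
by move=> x y; apply: absDle.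
Qed.

Lemma abs_sum_lt (I : Type) (r : seq I) (P : pred I) (f : I -> C) e :
  0 < e -> (forall i, P i -> `|f i| < e) -> `|\sum_(i <- r | P i) f i| < e.
Proof.
move=> e0 h; apply: (big_ind (fun x => `|x| < e)) => //; first by rewrite abs0.
by move=> x y; apply: absDlt.
Qed.

Lemma abs_prod (I : Type) (r : seq I) (P : pred I) (f : I -> C) :
  `|\prod_(i <- r | P i) f i| = \prod_(i <- r | P i) `|f i|.
Proof. by apply: (big_morph (@absv F R C) (@absvM F R C) abs1). Qed.

(** The ball of radius e <= 1 around 1 is closed under products, so the number of factors costs
    nothing; this controls the tails of infinite products. *)
Lemma abs_prod1 (I : Type) (r : seq I) (P : pred I) (f : I -> C) e :
  0 <= e -> e <= 1 -> (forall i, P i -> `|f i - 1| <= e) ->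
  `|\prod_(i <- r | P i) f i - 1| <= e.
Proof.
move=> e0 e1 h; apply: (big_ind (fun x => `|x - 1| <= e)) => //.
  by rewrite subrr abs0.
move=> x y hx hy.
have -> : x * y - 1 = (x - 1) * (y - 1) + ((x - 1) + (y - 1)) by ring.
apply: absDle; last exact: absDle.
rewrite absvM (le_trans (ler_pM _ _ hx hy)) ?absv_ge0 //.
by rewrite ler_piMr.
Qed.

Lemma abs_small0 x : (forall e, 0 < e -> `|x| < e) -> x = 0.
Proof.
move=> h; apply/eqP; rewrite -abs_eq0 eq_le absv_ge0 andbT leNgt.
by apply/negP => /h; rewrite ltxx.
Qed.

(** * The embeddings of A and of its constants into C *)

Lemma AembD a b : Aemb C (a + b) = Aemb C a + Aemb C b.
Proof. by rewrite /Aemb !rmorphD. Qed.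
Lemma AembM a b : Aemb C (a * b) = Aemb C a * Aemb C b.
Proof. by rewrite /Aemb !rmorphM. Qed.
Lemma AembN a : Aemb C (- a) = - Aemb C a.
Proof. by rewrite /Aemb !rmorphN. Qed.
Lemma AembB a b : Aemb C (a - b) = Aemb C a - Aemb C b.
Proof. by rewrite AembD AembN. Qed.
Lemma Aemb1 : Aemb C 1 = 1.
Proof. by rewrite /Aemb !rmorph1. Qed.
Lemma Aemb0 : Aemb C 0 = 0.
Proof. by rewrite /Aemb !rmorph0. Qed.
Lemma AembX a k : Aemb C (a ^+ k) = Aemb C a ^+ k.
Proof. by rewrite /Aemb !rmorphXn. Qed.

HB.instance Definition _ := GRing.isZmodMorphism.Build _ _ (Aemb C) AembB.
HB.instance Definition _ := GRing.isMonoidMorphism.Build _ _ (Aemb C)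
  (conj Aemb1 AembM).

Lemma Aemb_eq0 a : (Aemb C a == 0) = (a == 0).
Proof. by rewrite /Aemb fmorph_eq0 tofrac_eq0. Qed.

Lemma Aemb_inj : injective (Aemb C).
Proof. by move=> a b /eqP; rewrite -subr_eq0 -AembB Aemb_eq0 subr_eq0 => /eqP. Qed.

Definition sc (c : F) : C := Aemb C c%:P.

HB.instance Definition _ := GRing.RMorphism.copy sc (Aemb C \o polyC).

Lemma q_gt1 : (1 < q)%N. Proof. exact: finNzRing_gt1. Qed.

Lemma q_gt0 : (0 < q)%N. Proof. exact: ltnW q_gt1. Qed.

Lemma qR_gt1 : 1 < q%:R :> R. Proof. by rewrite ltr1n q_gt1. Qed.

Lemma qR_gt0 : 0 < q%:R :> R. Proof. by rewrite ltr0n q_gt0. Qed.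

Lemma abs_Aemb a : a != 0 -> `|Aemb C a| = q%:R ^+ (size a).-1.
Proof. by move=> a0; rewrite absv_poly // /pnorm natrX. Qed.

Lemma abs_Aemb_ge1 a : a != 0 -> 1 <= `|Aemb C a|.
Proof. by move=> a0; rewrite abs_Aemb // exprn_ege1 // ltW // qR_gt1. Qed.

Lemma abs_sc c : c != 0 -> `|sc c| = 1.
Proof. by move=> c0; rewrite abs_Aemb ?polyC_eq0 // size_polyC c0. Qed.

Lemma abs_T : `|Aemb C 'X| = q%:R.
Proof. by rewrite abs_Aemb ?polyX_eq0 // size_polyX. Qed.

Lemma T_neq0 : Aemb C 'X != 0. Proof. by rewrite Aemb_eq0 polyX_eq0. Qed.

Lemma qX_gt (M : R) : exists d, M < q%:R ^+ d.
Proof.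
have [[|d] hd] : exists d : nat, M < d%:R.
- by exists (Num.truncn M).+1; apply: truncnS_gt.
- by exists 0%N; rewrite expr0 (lt_trans hd).
- exists d.+1; rewrite (lt_le_trans hd) // -natrX ler_nat.
  by rewrite ltnW // ltn_expl // q_gt1.
Qed.

Lemma qXV_lt e : 0 < e -> exists d, (q%:R ^+ d)^-1 < e.
Proof.
move=> e0; have [d hd] := qX_gt e^-1; exists d.
by rewrite invf_plt ?posrE // exprn_gt0 // qR_gt0.
Qed.

(** * Limits of sequences in C *)

Lemma cvg_cst x : cvg_seq (fun=> x) x.
Proof. by move=> e e0; exists 0%N => i _; rewrite subrr abs0. Qed.

Lemma cvg_eqN (N : nat) (u v : nat -> C) x :
  (forall i, (N <= i)%N -> u i = v i) -> cvg_seq v x -> cvg_seq u x.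
Proof.
move=> uv vx e e0; have [M hM] := vx e e0; exists (maxn N M) => i.
by rewrite geq_max => /andP[h1 h2]; rewrite uv // hM.
Qed.

Lemma cvg_eq (u v : nat -> C) x : u =1 v -> cvg_seq v x -> cvg_seq u x.
Proof. by move=> uv; apply: (@cvg_eqN 0%N). Qed.

Lemma cvg_unique (u : nat -> C) x y : cvg_seq u x -> cvg_seq u y -> x = y.
Proof.
move=> ux uy; apply/eqP; rewrite -subr_eq0; apply/eqP/abs_small0 => e e0.
have [M hM] := ux e e0; have [M' hM'] := uy e e0.
have -> : x - y = (u (maxn M M') - y) - (u (maxn M M') - x) by ring.
by rewrite absBlt ?hM ?hM' ?leq_max ?leqnn ?orbT.
Qed.

Lemma lim_seqE (u : nat -> C) x : cvg_seq u x -> lim_seq u = x.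
Proof.
move=> ux; rewrite /lim_seq; case: xgetP => [y _ uy|/(_ x)//].
exact: cvg_unique uy ux.
Qed.

Lemma cvgD (u v : nat -> C) x y :
  cvg_seq u x -> cvg_seq v y -> cvg_seq (fun i => u i + v i) (x + y).
Proof.
move=> ux vy e e0; have [M hM] := ux e e0; have [M' hM'] := vy e e0.
exists (maxn M M') => i; rewrite geq_max => /andP[h1 h2].
by rewrite opprD addrACA absDlt ?hM ?hM'.
Qed.

Lemma cvg_bounded (u : nat -> C) x : cvg_seq u x ->
  exists N, forall i, (N <= i)%N -> `|u i| <= `|x| + 1.
Proof.
move=> /(_ 1 ltr01)[N hN]; exists N => i /hN h.
rewrite -(subrK x (u i)) absDle //; last by rewrite lerDl.
by rewrite (le_trans (ltW h)) // lerDr absv_ge0.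
Qed.

Lemma cvg0M (u v : nat -> C) y :
  cvg_seq u 0 -> cvg_seq v y -> cvg_seq (fun i => u i * v i) 0.
Proof.
move=> u0 vy e e0; have [M hM] := cvg_bounded vy.
have p : 0 < `|y| + 1 by rewrite ltr_wpDl ?absv_ge0.
have [M' hM'] := u0 (e / (`|y| + 1)) (divr_gt0 e0 p).
exists (maxn M M') => i; rewrite geq_max => /andP[/hM h1 /hM' h2].
rewrite subr0 in h2; rewrite subr0 absvM.
rewrite -(divfK (lt0r_neq0 p) e) (le_lt_trans (ler_wpM2l _ h1)) ?absv_ge0 //.
by rewrite ltr_pM2r.
Qed.

Lemma cvg_sub0 (u : nat -> C) x :
  cvg_seq u x <-> cvg_seq (fun i => u i - x) 0.
Proof.
split=> h e /h[N hN]; exists N => i /hN; by rewrite ?subr0.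
Qed.

Lemma cvgM (u v : nat -> C) x y :
  cvg_seq u x -> cvg_seq v y -> cvg_seq (fun i => u i * v i) (x * y).
Proof.
move=> ux vy; apply/cvg_sub0; rewrite -[0]addr0.
apply: (@cvg_eq _ (fun i => (u i - x) * v i + (v i - y) * x)).
  by move=> i; ring.
apply: cvgD; first exact: cvg0M (proj1 (cvg_sub0 _ _) ux) vy.
by apply: cvg0M (proj1 (cvg_sub0 _ _) vy) (@cvg_cst x).
Qed.

Lemma cvgN (u : nat -> C) x : cvg_seq u x -> cvg_seq (fun i => - u i) (- x).
Proof.
move=> ux; rewrite -mulN1r; apply: (@cvg_eq _ (fun i => -1 * u i)).
  by move=> i; rewrite mulN1r.
by apply: cvgM => //; apply: cvg_cst.
Qed.

Lemma cvgB (u v : nat -> C) x y :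
  cvg_seq u x -> cvg_seq v y -> cvg_seq (fun i => u i - v i) (x - y).
Proof. by move=> ux vy; apply: cvgD => //; apply: cvgN. Qed.

Lemma cvg_abs (u : nat -> C) x : cvg_seq u x -> x != 0 ->
  exists N, forall i, (N <= i)%N -> `|u i| = `|x|.
Proof.
move=> ux x0; have [|N hN] := ux `|x|; first by rewrite abs_gt0.
by exists N => i /hN h; apply: abs_near; rewrite absB.
Qed.

Lemma cvgV (u : nat -> C) x : cvg_seq u x -> x != 0 ->
  cvg_seq (fun i => (u i)^-1) x^-1.
Proof.
move=> ux x0 e e0; have [N hN] := cvg_abs ux x0.
have x0' : 0 < `|x| by rewrite abs_gt0.
have [|M hM] := ux (e * `|x| ^+ 2); first by rewrite mulr_gt0 ?exprn_gt0.
exists (maxn N M) => i; rewrite geq_max => /andP[/hN h1 /hM h2].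
have u0 : u i != 0 by rewrite -abs_gt0 h1.
have -> : (u i)^-1 - x^-1 = - (u i - x) / (x * u i) by field; rewrite u0.
by rewrite absvM absV absN absvM h1 -expr2 ltr_pdivrMr ?exprn_gt0.
Qed.

Lemma cvg_prod (I : Type) (r : seq I) (P : pred I) (u : I -> nat -> C) (l : I -> C) :
  (forall i, P i -> cvg_seq (u i) (l i)) ->
  cvg_seq (fun m => \prod_(i <- r | P i) u i m) (\prod_(i <- r | P i) l i).
Proof.
move=> h; elim: r => [|i r IH].
  rewrite big_nil; apply: cvg_eq (@cvg_cst 1) => m; by rewrite big_nil.
rewrite big_cons; case: ifP => Pi; last first.
  by apply: cvg_eq IH => m; rewrite big_cons Pi.
apply: (@cvg_eq _ (fun m => u i m * \prod_(j <- r | P j) u j m)).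
  by move=> m; rewrite big_cons Pi.
by apply: cvgM => //; apply: h.
Qed.

Lemma cvg_absle (u : nat -> C) x (b : R) : cvg_seq u x -> 
  (exists N, forall i, (N <= i)%N -> `|u i| <= b) -> `|x| <= b.
Proof.
move=> ux [N hN]; have b0 : 0 <= b by apply: le_trans (absv_ge0 _) (hN N (leqnn N)).
have [->|x0] := eqVneq x 0; first by rewrite abs0.
have [M hM] := cvg_abs ux x0.
by rewrite -(hM (maxn N M)) ?leq_maxr // hN // leq_maxl.
Qed.

Lemma cvg_shift (u : nat -> C) x k : cvg_seq u x -> cvg_seq (fun i => u (i + k)%N) x.
Proof.
move=> ux e /ux[N hN]; exists N => i hi; apply: hN.
exact: leq_trans hi (leq_addr _ _).
Qed.

End AbsoluteValue.

(** * Exponentials of finite F-subspaces and of discrete F-lattices *)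

Section LatticeExp.
Variables (F : finFieldType) (R : realType) (C : Cinfty F R).
Local Notation q := #|F|.
Local Notation "`| x |" := (absv x) : ring_scope.
Local Notation sc := (sc C).
Implicit Types (x y z : C) (e : R) (V : seq C) (L : set C).

Definition finite_subspace V :=
  [/\ uniq V, 0 \in V, {in V &, forall x y, x - y \in V}
    & forall c, {in V, forall x, sc c * x \in V}].

Definition fexp V x : C := x * \prod_(l <- V | l != 0) (1 - x / l).

Lemma fexpE V x : uniq V -> 0 \in V ->
  fexp V x = (\prod_(l <- V | l != 0) (- l)^-1) * \prod_(l <- V) (x - l).
Proof.
move=> uV V0; rewrite [in RHS](bigD1_seq 0) //= subr0 mulrCA -big_split /=.
congr (_ * _); apply: eq_bigr => l l0.
by rewrite invrN mulNr mulrBr mulVf // opprB mulrC.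
Qed.

Lemma fexp_eq0 V x : uniq V -> 0 \in V -> (fexp V x == 0) = (x \in V).
Proof.
move=> uV V0; rewrite fexpE // mulf_eq0 prodf_seq_eq0 prodf_seq_eq0.
rewrite (_ : has _ _ = false) /=; last first.
  by apply/hasPn => l _ /=; rewrite invr_eq0 oppr_eq0; case: eqP.
apply/hasP/idP => [[l lV]/=|xV]; first by rewrite subr_eq0 => /eqP ->.
by exists x; rewrite //= subrr.
Qed.

Lemma map_perm_eq (E : eqType) (V : seq E) (f g : E -> E) : uniq V ->
  cancel f g -> cancel g f ->
  {in V, forall v, f v \in V} -> {in V, forall v, g v \in V} ->
  perm_eq [seq f v | v <- V] V.
Proof.
move=> uV fK gK Vf Vg; apply: uniq_perm => //.
  by rewrite map_inj_uniq //; apply: can_inj fK.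
move=> v; apply/mapP/idP => [[w wV ->]|vV]; first exact: Vf.
by exists (g v); rewrite ?gK // Vg.
Qed.

Lemma subspaceN V : finite_subspace V -> {in V, forall x, - x \in V}.
Proof. by case=> _ V0 VB _ x xV; rewrite -sub0r VB. Qed.

Lemma subspaceD V : finite_subspace V -> {in V &, forall x y, x + y \in V}.
Proof.
move=> sV x y xV yV; rewrite -[y]opprK.
by have [_ _ VB _] := sV; rewrite VB // subspaceN.
Qed.

Lemma size_monicB (p s : {poly C}) k : p \is monic -> s \is monic ->
  size p = k.+1 -> size s = k.+1 -> (size (p - s)%R <= k)%N.
Proof.
move=> /monicP pm /monicP sm sp ss; apply/leq_sizeP => j; rewrite leq_eqVlt coefB.
move: pm sm; rewrite !lead_coefE sp ss /= => pm sm.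
case/orP => [/eqP <-|kj]; first by rewrite pm sm subrr.
by rewrite !nth_default ?subrr ?sp ?ss.
Qed.

(** Let P be the monic polynomial with root set V. Both P(t + y) and P(t) are monic of degree |V|,
    so P(t + y) - P(t) - P(y) has degree less than |V|. It vanishes on V because P is V-periodic,
    hence it is zero. *)
Lemma fexpD V x y : finite_subspace V -> fexp V (x + y) = fexp V x + fexp V y.
Proof.
move=> sV; have [uV V0 _ _] := sV.
rewrite !fexpE // -mulrDr; congr (_ * _); apply/eqP.
pose P t := \prod_(l <- V) (t - l).
pose p0 := \prod_(l <- V) ('X - l%:P).
pose p1 := \prod_(l <- [seq l - y | l <- V]) ('X - l%:P).
have p0E t : p0.[t] = P t.
  by rewrite horner_prod; apply: eq_bigr => l _; rewrite hornerXsubC.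
have p1E t : p1.[t] = P (t + y).
  rewrite horner_prod big_map; apply: eq_bigr => l _.
  by rewrite hornerXsubC opprB addrA (addrAC t).
have Pper t l : l \in V -> P (t + l) = P t.
  move=> lV; have pe : perm_eq [seq v + l | v <- V] V.
    apply: (map_perm_eq (g := fun v => v - l)) => // [||v vV|v vV].
    - exact: addrK.
    - exact: subrK.
    - by rewrite subspaceD.
    - by rewrite subspaceD // subspaceN.
  rewrite /P -(perm_big _ pe) /= big_map; apply: eq_bigr => v _.
  by rewrite opprD addrACA subrr addr0.
have P0 : P 0 = 0 by rewrite /P (bigD1_seq 0) //= subrr mul0r.
pose D := p1 - p0 - (P y)%:P.
suff D0 : D = 0.
  have := congr1 (fun p => p.[x]) D0; rewrite /D !hornerE p0E p1E => /eqP.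
  by rewrite -/(P (x + y)) -/(P x) -/(P y) -addrA -opprD subr_eq0.
apply/eqP; apply: contraT => Dn0.
suff: (size V < size V)%N by rewrite ltnn.
have k0 : (0 < size V)%N by case: (V) V0.
apply: (@leq_trans (size D)).
  apply: max_poly_roots => //; apply/allP => l lV.
  have Pl : P l = 0 by rewrite -[l]add0r Pper.
  by rewrite /root /D !hornerE p0E p1E Pl (addrC l) Pper // subr0 subrr.
rewrite (leq_trans (size_polyD _ _)) // geq_max; apply/andP; split; last first.
  by rewrite size_polyN (leq_trans (size_polyC_leq1 _)).
apply: size_monicB; rewrite ?monic_prod_XsubC ?size_prod_XsubC //.
by rewrite size_map.
Qed.

Lemma fexpZ V c x : finite_subspace V -> fexp V (sc c * x) = sc c * fexp V x.
Proof.
move=> [uV _ _ VZ]; have [->|c0] := eqVneq c 0.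
  by rewrite rmorph0 !mul0r /fexp mul0r.
have sc0 : sc c != 0 by rewrite fmorph_eq0.
rewrite /fexp -mulrA; congr (_ * (_ * _)).
have pe : perm_eq [seq sc c * v | v <- V] V.
  apply: (map_perm_eq (g := fun v => sc c^-1 * v)) => // v.
  - by rewrite mulrA -rmorphM mulVf // rmorph1 mul1r.
  - by rewrite mulrA -rmorphM divff // rmorph1 mul1r.
rewrite -[LHS](perm_big _ pe) /= big_map.
apply: eq_big => l; first by rewrite mulf_eq0 (negPf sc0).
rewrite mulf_eq0 negb_or => /andP[_ l0].
by congr (_ - _); field; rewrite l0.
Qed.

Lemma fexpN V x : finite_subspace V -> fexp V (- x) = - fexp V x.
Proof.
by move=> sV; rewrite -mulN1r -(rmorphN1 sc) fexpZ // rmorphN1 mulN1r.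
Qed.

Lemma fexpB V x y : finite_subspace V -> fexp V (x - y) = fexp V x - fexp V y.
Proof. by move=> sV; rewrite fexpD // fexpN. Qed.

Lemma uniq_sums V M : uniq V -> uniq M ->
  {in V &, forall x y, x - y \in V} -> {in M &, forall x y, x - y \in M} ->
  {in M, forall m, m \in V -> m = 0} ->
  uniq [seq v + m | m <- M, v <- V].
Proof.
move=> uV uM VB MB MV; apply: allpairs_uniq => // [[m v] [m' v']] /=.
move=> /allpairsP[[a b] /= [aM bV [-> ->]]] /allpairsP[[a' b'] /= [aM' bV' [-> ->]]] h.
have h2 : a - a' = b' - b.
  by apply/eqP; rewrite subr_eq addrAC -h [b + a]addrC addrK.
have/eqP : a - a' = 0 by apply: MV; rewrite ?MB // h2 VB.
by rewrite subr_eq0 => /eqP aa; move: h; rewrite aa => /addIr ->.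
Qed.

(** The factors belonging to one coset m + V multiply to e_V(m - x) / e_V(m), and additivity turns
    this into 1 - e_V(x) / e_V(m). *)
Lemma fexp_sums V M x : finite_subspace V -> uniq M -> 0 \in M ->
  {in M, forall m, m \in V -> m = 0} ->
  fexp [seq v + m | m <- M, v <- V] x =
  fexp V x * \prod_(m <- M | m != 0) (1 - fexp V x / fexp V m).
Proof.
move=> sV uM M0 MV; have [uV V0 _ _] := sV.
rewrite {1}/fexp big_mkcond big_allpairs_dep /= (bigD1_seq 0) //= mulrA.
congr (_ * _); last first.
  rewrite big_seq_cond [in RHS]big_seq_cond; apply: eq_bigr => m /andP[mM m0].
  have m_n v : v \in V -> v + m != 0.
    move=> vV; apply: contra m0; rewrite addrC addr_eq0 => /eqP mE.
    by apply/eqP/MV; rewrite // mE subspaceN.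
  have fm0 : fexp V m != 0.
    by rewrite fexp_eq0 //; apply: contra m0 => /(MV _ mM)/eqP.
  have -> : 1 - fexp V x / fexp V m = fexp V (m - x) / fexp V m.
    by rewrite fexpB // mulrBl divff.
  rewrite !fexpE // -mulf_div divff ?mul1r; last first.
    rewrite prodf_seq_neq0; apply/allP => l _ /=.
    by rewrite invr_eq0 oppr_eq0; apply/implyP.
  rewrite -(perm_big _ (map_perm_eq (f := -%R) (g := -%R) uV (@opprK _) (@opprK _)
     (subspaceN sV) (subspaceN sV))) /= big_map.
  rewrite -prodf_div big_seq_cond [in RHS]big_seq_cond; apply: eq_bigr => v /andP[vV _].
  have tE := m_n _ (subspaceN sV vV); rewrite tE (addrC (- v)).
  rewrite addrC in tE; by rewrite addrAC mulrBl divff.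
rewrite /fexp; congr (_ * _); rewrite [RHS]big_mkcond /=.
by apply: eq_bigr => v _; rewrite addr0.
Qed.

(** Only an F-subspace is required, not an A-module, so that the partial sums of A z + A used for
    the cusp expansions qualify as well. *)
Definition lattice L :=
  [/\ L 0, forall x y, L x -> L y -> L (x - y),
      forall c x, L x -> L (sc c * x)
    & forall M : R, finite_set [set l | L l /\ `|l| <= M]].

Definition disc L (M : R) : seq C := fset_set [set l | L l /\ `|l| <= M].

(** Frees the infinite product from discs: boxes of coefficients, images under homotheties and sums
    of subspaces serve equally well as index sets. *)
Definition exhausts L (M : R) (s : seq C) :=
  [/\ uniq s, forall l, l \in s -> L l & forall l, L l -> `|l| <= M -> l \in s].

Lemma mem_disc L M l : lattice L -> (l \in disc L M) <-> (L l /\ `|l| <= M).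
Proof.
case=> _ _ _ /(_ M) fL; rewrite /disc; change ((l \in fset_set [set l | L l /\ `|l| <= M]) <-> L l /\ `|l| <= M).
by rewrite in_fset_set // in_setE.
Qed.

Lemma disc_exhausts L M : lattice L -> exhausts L M (disc L M).
Proof.
move=> lL; split=> [|l|l Ll lM]; first exact: fset_uniq.
- by case/(mem_disc M l lL).
- exact/mem_disc.
Qed.

Lemma disc_subspace L M : lattice L -> 0 <= M -> finite_subspace (disc L M).
Proof.
move=> lL M0; have [L0 LB LZ _] := lL; split.
- exact: fset_uniq.
- by apply/mem_disc; rewrite ?abs0.
- move=> x y /(mem_disc _ _ lL)[Lx xM] /(mem_disc _ _ lL)[Ly yM].
  by apply/mem_disc => //; split; [apply: LB | apply: absBle].
- move=> c x /(mem_disc _ _ lL)[Lx xM]; apply/mem_disc => //; split; first exact: LZ.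
  rewrite absvM; have [->|c0] := eqVneq c 0; first by rewrite rmorph0 abs0 mul0r.
  by rewrite abs_sc // mul1r.
Qed.

Lemma exhausts_split L M s x : lattice L -> 0 <= M -> exhausts L M s ->
  fexp s x = fexp (disc L M) x * \prod_(l <- s | M < `|l|) (1 - x / l).
Proof.
move=> lL M0 [us sL Ls]; rewrite /fexp -mulrA; congr (_ * _).
rewrite (bigID (fun l => M < `|l|)) /= mulrC; congr (_ * _); last first.
  apply: eq_bigl => l; have [->|] := eqVneq l 0; last by [].
  by rewrite abs0 ltNge M0.
rewrite -big_filter -[RHS]big_filter; apply: perm_big; apply: uniq_perm.
- exact: filter_uniq.
- by apply: filter_uniq; apply: fset_uniq.
move=> l; rewrite !mem_filter -leNgt; have [_|l0] := eqVneq l 0; rewrite //=.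
apply/andP/idP => [[h1 h2]|/(mem_disc _ _ lL)[Ll h]].
  by apply/mem_disc => //; split=> //; apply: sL.
by split; rewrite ?Ls.
Qed.

(** The extra factors 1 - x / l have |l| > M >= |x| and therefore absolute value 1. *)
Lemma exhausts_abs L M s x : lattice L -> `|x| <= M -> exhausts L M s ->
  `|fexp s x| = `|fexp (disc L M) x|.
Proof.
move=> lL xM es; have M0 : 0 <= M := le_trans (absv_ge0 _) xM.
rewrite (exhausts_split x lL M0 es) absvM abs_prod big1 ?mulr1 // => l lM.
have l0 : 0 < `|l| by apply: le_lt_trans lM.
rewrite absB_dom ?abs1 // absvM absV ltr_pdivrMr // mul1r.
exact: le_lt_trans lM.
Qed.

Lemma exhausts_dist L M s x : lattice L -> 0 < M -> `|x| <= M -> exhausts L M s ->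
  `|fexp s x - fexp (disc L M) x| <= `|fexp (disc L M) x| * (`|x| / M).
Proof.
move=> lL M0 xM es; rewrite (exhausts_split x lL (ltW M0) es).
rewrite -[X in _ - X]mulr1 -mulrBr absvM ler_wpM2l ?absv_ge0 //.
apply: abs_prod1 => [||l lM].
- by rewrite divr_ge0 ?absv_ge0 ?ltW.
- by rewrite ler_pdivrMr // mul1r.
- rewrite addrAC subrr add0r absN absvM absV ler_wpM2l ?absv_ge0 //.
  by rewrite lef_pV2 ?posrE ?ltW // (lt_trans M0).
Qed.

Lemma disc_le L M M' : lattice L -> M <= M' -> exhausts L M (disc L M').
Proof.
move=> lL MM; have [h1 h2 h3] := disc_exhausts M' lL.
by split=> // l Ll lM; apply: h3 => //; apply: le_trans MM.
Qed.

Lemma exhausts_dist2 L M s s' x : lattice L -> 0 < M -> `|x| <= M ->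
  exhausts L M s -> exhausts L M s' ->
  `|fexp s x - fexp s' x| <= `|fexp s x| * (`|x| / M).
Proof.
move=> lL M0 xM es es'; rewrite (exhausts_abs lL xM es).
have -> : fexp s x - fexp s' x =
  (fexp s x - fexp (disc L M) x) - (fexp s' x - fexp (disc L M) x) by ring.
by apply: absBle; apply: exhausts_dist.
Qed.

Lemma lattice_exp_lim L x : lattice L ->
  lattice_exp L x = lim_seq (fun m => fexp (disc L m%:R) x).
Proof.
move=> lL; have [_ _ _ fL] := lL.
rewrite /lattice_exp; congr lim_seq; apply/funext => m; congr (_ * _).
rewrite fsbig_finite /=; last first.
  by apply: sub_finite_set (fL m%:R) => l [? ? ?].
rewrite -[RHS]big_filter; apply: perm_big; apply: uniq_perm.
- exact: fset_uniq.
- by apply: filter_uniq; apply: fset_uniq.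
move=> l; rewrite in_fset_set; last first.
  by apply: sub_finite_set (fL m%:R) => ? [? ? ?].
rewrite mem_filter; apply/idP/idP.
  rewrite in_setE => -[Ll l0 lm]; rewrite l0 /=; exact/mem_disc.
by case/andP => l0 /(mem_disc _ _ lL)[Ll lm]; rewrite in_setE.
Qed.

Lemma natR_gt (B : R) : exists m : nat, B < m%:R.
Proof. by exists (Num.truncn B).+1; apply: truncnS_gt. Qed.

(** From radius |x| on, the absolute value of the partial products is a constant Q, so two of them
    beyond radius M differ by at most Q |x| / M. *)
Lemma exp_disc_cvg L x : lattice L ->
  cvg_seq (fun m => fexp (disc L m%:R) x) (lattice_exp L x).
Proof.
move=> lL; rewrite lattice_exp_lim //.
suff [l cl] : exists l, cvg_seq (fun m => fexp (disc L m%:R) x) l.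
  by rewrite (lim_seqE cl).
have [m0 hm0] := natR_gt (`|x| + 1).
have m0x : `|x| <= m0%:R by rewrite (le_trans _ (ltW hm0)) // lerDl.
have m00 : 0 < m0%:R :> R by rewrite (le_lt_trans _ hm0) // addr_ge0 ?absv_ge0.
pose Q := `|fexp (disc L m0%:R) x|.
apply: absv_complete => e e0.
have [m1 hm1] := natR_gt (Q * `|x| / e).
pose m := maxn m0 m1; exists m => i j mi mj.
have mm0 : m0%:R <= m%:R :> R by rewrite ler_nat leq_maxl.
have m_0 : 0 < m%:R :> R by apply: lt_le_trans mm0.
have QE k : (m <= k)%N -> `|fexp (disc L k%:R) x| = Q.
  move=> mk; apply: exhausts_abs => //; apply: disc_le => //.
  by rewrite ler_nat (leq_trans _ mk) // leq_maxl.
apply: (le_lt_trans (exhausts_dist2 (M := m%:R) lL _ _ _ _)) => //.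
- exact: le_trans m0x mm0.
- by apply: disc_le; rewrite ?ler_nat.
- by apply: disc_le; rewrite ?ler_nat.
rewrite QE // mulrA ltr_pdivrMr // [ltRHS]mulrC -ltr_pdivrMr //.
by rewrite (lt_le_trans hm1) // ler_nat leq_maxr.
Qed.

(** The working form of convergence: exact absolute value and an explicit relative error, with no
    condition on [s] beyond containing the disc of radius M. *)
Lemma exp_approx L M s x : lattice L -> 0 < M -> `|x| <= M -> exhausts L M s ->
  `|fexp s x| = `|lattice_exp L x| /\
  `|fexp s x - lattice_exp L x| <= `|lattice_exp L x| * (`|x| / M).
Proof.
move=> lL M0 xM es; have cl := exp_disc_cvg x lL.
have [m0 hm0] := natR_gt M.
have dm k : (m0 <= k)%N -> exhausts L M (disc L k%:R).
  move=> mk; apply: disc_le => //; apply/ltW.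
  by rewrite (lt_le_trans hm0) // ler_nat.
have QE k : (m0 <= k)%N -> `|fexp (disc L k%:R) x| = `|fexp s x|.
  by move=> mk; rewrite (exhausts_abs lL xM es) (exhausts_abs lL xM (dm k mk)).
have abs_s : `|fexp s x| = `|lattice_exp L x|.
  have [l0|l0] := eqVneq (lattice_exp L x) 0; last first.
    have [N hN] := cvg_abs cl l0.
    by rewrite -(QE (maxn m0 N)) ?hN ?leq_maxr ?leq_maxl.
  rewrite l0 abs0; apply/eqP; rewrite eq_le absv_ge0 andbT leNgt.
  apply/negP => /cl[N hN]; have := hN (maxn m0 N) (leq_maxr _ _).
  by rewrite l0 subr0 QE ?leq_maxl // ltxx.
split=> //; rewrite -abs_s.
apply: (cvg_absle (cvgB (cvg_cst (fexp s x)) cl)).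
by exists m0 => i mi; apply: exhausts_dist2 (dm i mi).
Qed.

Lemma exp_cvg L (s : nat -> seq C) (M : nat -> R) x : lattice L ->
  (forall i, exhausts L (M i) (s i)) ->
  (forall B, exists N, forall i, (N <= i)%N -> B <= M i) ->
  cvg_seq (fun i => fexp (s i) x) (lattice_exp L x).
Proof.
move=> lL es hM e e0; pose Q := `|lattice_exp L x|.
pose B := Num.max (`|x| + 1) (Q * `|x| / e + 1).
have [N hN] := hM B; exists N => i /hN; rewrite ge_max => /andP[h1 h2].
have M0 : 0 < M i by rewrite (lt_le_trans _ h1) // ltr_wpDl // absv_ge0.
have xM : `|x| <= M i by rewrite (le_trans _ h1) // lerDl.
have [_ h] := exp_approx lL M0 xM (es i).
apply: (le_lt_trans h); rewrite mulrA ltr_pdivrMr // [ltRHS]mulrC -ltr_pdivrMr //.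
by rewrite (lt_le_trans _ h2) // ltrDl.
Qed.

Lemma exp_abs L M s x : lattice L -> 0 < M -> `|x| <= M -> exhausts L M s ->
  `|lattice_exp L x| = `|x| * \prod_(l <- s | l != 0) `|1 - x / l|.
Proof.
by move=> lL M0 xM es; have [<- _] := exp_approx lL M0 xM es; rewrite absvM abs_prod.
Qed.

Lemma exp_D L x y : lattice L ->
  lattice_exp L (x + y) = lattice_exp L x + lattice_exp L y.
Proof.
move=> lL; apply: cvg_unique (exp_disc_cvg _ lL) _.
apply: cvg_eq (cvgD (exp_disc_cvg x lL) (exp_disc_cvg y lL)) => m.
by rewrite fexpD //; apply: disc_subspace.
Qed.

Lemma exp_Z L c x : lattice L -> lattice_exp L (sc c * x) = sc c * lattice_exp L x.
Proof.
move=> lL; apply: cvg_unique (exp_disc_cvg _ lL) _.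
apply: cvg_eq (cvgM (cvg_cst (sc c)) (exp_disc_cvg x lL)) => m.
by rewrite fexpZ //; apply: disc_subspace.
Qed.

Lemma exp_N L x : lattice L -> lattice_exp L (- x) = - lattice_exp L x.
Proof. by move=> lL; rewrite -mulN1r -(rmorphN1 sc) exp_Z // rmorphN1 mulN1r. Qed.

Lemma exp_B L x y : lattice L ->
  lattice_exp L (x - y) = lattice_exp L x - lattice_exp L y.
Proof. by move=> lL; rewrite exp_D // exp_N. Qed.

Lemma exp_eq0 L x : lattice L -> lattice_exp L x = 0 <-> L x.
Proof.
move=> lL; have L0 : L 0 by case: lL.
have M0 : 0 < `|x| + 1 by rewrite ltr_wpDl // absv_ge0.
have xM : `|x| <= `|x| + 1 by rewrite lerDl.
have [/esym h _] := exp_approx lL M0 xM (disc_exhausts _ lL).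
rewrite (rwP eqP) -abs_eq0 h abs_eq0.
rewrite fexp_eq0; [|exact: fset_uniq|by apply/mem_disc; rewrite ?abs0 ?ltW].
by split=> [/(mem_disc _ _ lL)[]//|Lx]; apply/mem_disc.
Qed.

Lemma exp0 L : lattice L -> lattice_exp L 0 = 0.
Proof. by move=> lL; apply/exp_eq0 => //; case: lL. Qed.

Lemma exp_periodic L x l : lattice L -> L l -> lattice_exp L (x + l) = lattice_exp L x.
Proof. by move=> lL Ll; rewrite exp_D // (proj2 (exp_eq0 l lL) Ll) addr0. Qed.

Definition scale_set (c : C) L : set C := [set x | L (x / c)].

Lemma scale_lattice c L : c != 0 -> lattice L -> lattice (scale_set c L).
Proof.
move=> c0 [L0 LB LZ fL]; split.
- by rewrite /scale_set /= mul0r.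
- by move=> x y; rewrite /scale_set /= mulrBl; apply: LB.
- by move=> a x; rewrite /scale_set /= -mulrA; apply: LZ.
- move=> M; apply: (sub_finite_set _ (finite_image ( *%R c) (fL (M / `|c|)))).
  move=> x [Lx xM] /=; exists (x / c); last by rewrite mulrC divfK.
  by split=> //; rewrite absvM absV ler_pM2r // invr_gt0 abs_gt0.
Qed.

(** The images under c of the discs of L exhaust c L, and the factors of the two finite products
    agree one by one. *)
Lemma exp_scale c L x : c != 0 -> lattice L ->
  lattice_exp (scale_set c L) (c * x) = c * lattice_exp L x.
Proof.
move=> c0 lL; have c0' : 0 < `|c| by rewrite abs_gt0.
apply: cvg_unique (cvgM (cvg_cst c) (exp_disc_cvg x lL)).
apply: cvg_eq (exp_cvg (M := fun m => m%:R * `|c|)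
  (s := fun m => [seq c * l | l <- disc L m%:R]) (c * x) (scale_lattice c0 lL) _ _).
- move=> m; rewrite /fexp big_map mulrA; congr (_ * _).
  apply: eq_big => l; first by rewrite mulf_eq0 (negPf c0).
  by move=> l0; rewrite -mulf_div divff // mul1r.
- move=> m; split.
  + by rewrite map_inj_uniq ?fset_uniq //; apply: mulfI.
  + move=> _ /mapP[l /(mem_disc _ _ lL)[Ll _] ->].
    by rewrite /scale_set /= mulrC mulKf.
  + move=> l Ll lm; apply/mapP; exists (l / c); last by rewrite mulrC divfK.
    by apply/mem_disc => //; split=> //; rewrite absvM absV ler_pdivrMr.
- move=> B; have [N hN] := natR_gt (B / `|c|); exists N => i Ni.
  by rewrite -ler_pdivrMr // (le_trans (ltW hN)) // ler_nat.
Qed.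

Lemma bounded_seq (M : seq C) : exists B : R, forall m, m \in M -> `|m| <= B.
Proof.
elim: M => [|m M [B hB]]; first by exists 0.
exists (Num.max `|m| B) => x; rewrite inE => /orP[/eqP ->|/hB h].
  by rewrite le_max lexx.
by rewrite le_max h orbT.
Qed.

(** Passage to the limit in [fexp_sums]. The finite set [M] is a complement of L in L', and the
    product is the polynomial of the isogeny evaluated at e_L(x). *)
Lemma exp_isogeny L L' M x : lattice L -> lattice L' -> uniq M -> 0 \in M ->
  {in M &, forall x y, x - y \in M} -> {in M, forall m, L m -> m = 0} ->
  (forall l, L' l <-> exists l0 m, [/\ L l0, m \in M & l = l0 + m]) ->
  lattice_exp L' x = lattice_exp L x *
    \prod_(m <- M | m != 0) (1 - lattice_exp L x / lattice_exp L m).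
Proof.
move=> lL lL' uM M0 MB ML LL'; have [B hB] := bounded_seq M.
have [k hk] := natR_gt B.
have MV i : {in M, forall m, m \in disc L i -> m = 0}.
  by move=> m mM /(mem_disc _ _ lL)[Lm _]; apply: ML.
have eM m : m \in M -> m != 0 -> lattice_exp L m != 0.
  by move=> mM; apply: contra => /eqP/(exp_eq0 _ lL)/(ML _ mM)/eqP.
apply: (@cvg_unique _ _ _ (fun i => fexp (disc L (i + k)%:R) x *
   \prod_(m <- M | m != 0) (1 - fexp (disc L (i + k)%:R) x / fexp (disc L (i + k)%:R) m))).
  apply: cvg_eq (exp_cvg (M := fun i => (i + k)%:R)
    (s := fun i => [seq v + m | m <- M, v <- disc L (i + k)%:R]) x lL' _ _).
  - move=> i; rewrite fexp_sums //.
    exact: disc_subspace.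
  - move=> i; have sV := disc_subspace lL (ler0n _ (i + k)).
    have [uV _ VB _] := sV.
    split; first by apply: uniq_sums.
      move=> _ /allpairsP[[m v] /= [mM /(mem_disc _ _ lL)[Lv _] ->]].
      by apply/LL'; exists v, m.
    move=> _ /LL'[l0 [m [Ll0 mM ->]]] hl.
    apply/allpairsP; exists (m, l0); split=> //=.
    apply/mem_disc => //; split=> //; rewrite -(addrK m l0) absBle //.
    rewrite (le_trans (hB m mM)) // (le_trans (ltW hk)) // ler_nat leq_addl //.
  - move=> D; have [N hN] := natR_gt D; exists N => i Ni.
    by rewrite (le_trans (ltW hN)) // ler_nat (leq_trans Ni) // leq_addr.
have cx y := cvg_shift k (exp_disc_cvg y lL).
apply: cvgM; first exact: cx.
apply: (@cvg_eq _ _ _ _ (fun i => \prod_(m <- M | (m \in M) && (m != 0))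
  (1 - fexp (disc L (i + k)%:R) x / fexp (disc L (i + k)%:R) m))).
  by move=> i; rewrite big_seq_cond.
rewrite big_seq_cond; apply: cvg_prod => m /andP[mM m0].
apply: cvgB; first exact: cvg_cst.
by apply: cvgM; [exact: cx | apply: cvgV; [exact: cx | exact: eM]].
Qed.

End LatticeExp.

(** * The lattices A z + A and n A *)

Section Lattices.
Variables (F : finFieldType) (R : realType) (C : Cinfty F R).
Local Notation q := #|F|.
Local Notation "`| x |" := (absv x) : ring_scope.
Local Notation sc := (sc C).
Local Notation Aemb := (Aemb C).
Local Notation T := (Aemb 'X).
Implicit Types (x y z : C) (e : R) (a b : {poly F}) (L : set C).

Definition pols d : seq {poly F} := [seq rVpoly u | u : 'rV[F]_d].

Lemma mem_pols d a : (a \in pols d) = (size a <= d)%N.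
Proof.
apply/mapP/idP => [[u _ ->]|sa]; first exact: size_poly.
by exists (poly_rV a); rewrite ?mem_enum ?poly_rV_K.
Qed.

Lemma pols_uniq d : uniq (pols d).
Proof. by rewrite map_inj_uniq ?enum_uniq //; apply: can_inj rVpolyK. Qed.

Lemma size_pols d : size (pols d) = (q ^ d)%N.
Proof. by rewrite size_map -cardE card_mx mul1n. Qed.

(** Tests the distance to K only; by density this is the distance to its closure K_oo, as [far_Kinf]
    records. *)
Definition far e z := forall k : ratfun F, e <= `|z - Kemb C k|.

Lemma far_Kinf e z : far e z <-> forall x, Kinf x -> e <= `|z - x|.
Proof.
split=> [h x Kx|h k].
  rewrite leNgt; apply/negP => zx.
  have [|k hk] := Kx e; first by apply: le_lt_trans zx; apply: absv_ge0.
  by have := absDlt zx hk; rewrite addrA subrK ltNge h.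
by apply: h => d d0; exists k; rewrite subrr abs0.
Qed.

Lemma OmegaP z : Omega z <-> exists2 e, 0 < e & far e z.
Proof.
split=> [h|[e e0 h] Kz].
  apply: contrapT => h2; apply: h => e e0; apply: contrapT => h3.
  by apply: h2; exists e => // k; rewrite leNgt; apply/negP => h4; apply: h3; exists k.
by have [k] := Kz e e0; rewrite ltNge h.
Qed.

Lemma Omega_aff_far m z : Omega_aff m z <->
  `|z| <= q%:R ^+ m /\ far (q%:R ^- m) z.
Proof. by rewrite /Omega_aff /= natrX; split=> -[h1 h2]; split=> //; apply/far_Kinf. Qed.

Lemma Omega_aff_Omega m z : Omega_aff m z -> Omega z.
Proof.
move=> /Omega_aff_far[_ h]; apply/OmegaP; exists (q%:R ^- m) => //.
by rewrite invr_gt0 exprn_gt0 ?qR_gt0.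
Qed.

(** Dominates the three constants 1, 1 / e and B / e that arise in bounding |a| and |b| by |a z +
    b|. *)
Definition kappa e (B : R) : R := 1 + e^-1 + B / e.

Lemma kappa_gt0 e (B : R) : 0 < e -> 0 <= B -> 0 < kappa e B.
Proof.
by move=> e0 B0; rewrite /kappa -addrA ltr_wpDr // addr_ge0 ?divr_ge0 ?invr_ge0 // ltW.
Qed.

(** For a != 0 one has |a z + b| = |a| |z + b / a| >= |a| e, since -b / a lies in K; then b = (a z +
    b) - a z. The bound is uniform over an affinoid of Omega. *)
Lemma Aemb_kappa e (B : R) z a b : 0 < e -> 0 <= B -> far e z -> `|z| <= B ->
  `|Aemb a| <= kappa e B * `|Aemb a * z + Aemb b| /\
  `|Aemb b| <= kappa e B * `|Aemb a * z + Aemb b|.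
Proof.
move=> e0 B0 fz zB; set l := _ + _.
have k1 : 1 <= kappa e B.
  by rewrite /kappa -addrA lerDl addr_ge0 ?divr_ge0 ?invr_ge0 // ltW.
have k2 : e^-1 <= kappa e B.
  by rewrite /kappa addrAC lerDr addr_ge0 ?divr_ge0 // ltW.
have k3 : B / e <= kappa e B.
  by rewrite /kappa lerDr addr_ge0 ?invr_ge0 // ltW.
have l0 := absv_ge0 l.
have al : `|Aemb a| <= `|l| / e.
  have [->|a0] := eqVneq a 0; first by rewrite Aemb0 abs0 divr_ge0 // ltW.
  rewrite ler_pdivlMr //; have a0' : Aemb a != 0 by rewrite Aemb_eq0.
  have -> : l = Aemb a * (z - Kemb C (- b%:F / a%:F)).
    by rewrite fmorph_div rmorphN /= /l /Defs.Aemb; field.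
  by rewrite absvM ler_wpM2l ?absv_ge0.
split; first by rewrite (le_trans al) // mulrC ler_wpM2r.
have -> : Aemb b = l - Aemb a * z by rewrite /l addrAC subrr add0r.
apply: absBle; first by rewrite -{1}[ `|l|]mul1r ler_wpM2r.
rewrite absvM (le_trans (ler_pM _ _ al zB)) ?absv_ge0 //.
by rewrite mulrAC -mulrA [leLHS]mulrC ler_wpM2r.
Qed.

Lemma size_abs_lt a d : `|Aemb a| < q%:R ^+ d -> (size a <= d)%N.
Proof.
have [->|a0] := eqVneq a 0; first by rewrite size_poly0.
rewrite abs_Aemb // ltr_eXn2l ?qR_gt1 // => h.
by rewrite -ltnS prednK ?size_poly_gt0 in h.
Qed.

Lemma abs_size_lt a d : (size a <= d)%N -> `|Aemb a| < q%:R ^+ d.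
Proof.
have [->|a0] := eqVneq a 0; first by rewrite Aemb0 abs0 exprn_gt0 ?qR_gt0.
rewrite abs_Aemb // ltr_eXn2l ?qR_gt1 // => h.
by rewrite -ltnS prednK ?size_poly_gt0.
Qed.

Definition pts z d : seq C := [seq Aemb a * z + Aemb b | a <- pols d, b <- pols d].

Lemma Az_inj e z a b a' b' : 0 < e -> far e z ->
  Aemb a * z + Aemb b = Aemb a' * z + Aemb b' -> a = a' /\ b = b'.
Proof.
move=> e0 fz /eqP; rewrite -subr_eq0 opprD addrACA -mulrBl -!AembB => /eqP h.
have [] := Aemb_kappa (a - a') (b - b') e0 (absv_ge0 z) fz (lexx _).
rewrite h abs0 mulr0 => h1 h2.
have h3 c : `|Aemb c| <= 0 -> c = 0.
  by move=> hc; apply/eqP; rewrite -(Aemb_eq0 C) -abs_eq0 eq_le hc absv_ge0.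
by split; apply/eqP; rewrite -subr_eq0; apply/eqP/h3.
Qed.

Lemma pts_uniq z d : Omega z -> uniq (pts z d).
Proof.
move=> /OmegaP[e e0 fz]; apply: allpairs_uniq; rewrite ?pols_uniq //.
by move=> [a b] [a' b'] _ _ /= /(Az_inj e0 fz)[-> ->].
Qed.

Lemma pts0 z d : 0 \in pts z d.
Proof.
apply/allpairsP; exists (0, 0) => /=; rewrite !mem_pols size_poly0.
by split=> //; rewrite Aemb0 mul0r addr0.
Qed.

Lemma ptsB z d : {in pts z d &, forall x y, x - y \in pts z d}.
Proof.
move=> _ _ /allpairsP[[a b] /= [ad bd ->]] /allpairsP[[a' b'] /= [ad' bd' ->]].
apply/allpairsP; exists (a - a', b - b') => /=; rewrite !mem_pols in ad bd ad' bd' *.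
rewrite !(leq_trans (size_polyD _ _)) ?geq_max ?size_polyN ?ad ?bd //.
by split=> //; rewrite !AembB; ring.
Qed.

Lemma size_pts z d : size (pts z d) = (q ^ d.*2)%N.
Proof. by rewrite size_allpairs size_pols -expnD addnn. Qed.

(** The degree [d] depends on z only through e and B, so one box of coefficients serves a whole
    affinoid. *)
Lemma pts_exhausts e (B : R) z d (M : R) : 0 < e -> 0 <= B -> far e z -> `|z| <= B ->
  kappa e B * M < q%:R ^+ d -> exhausts (lattice2 z) M (pts z d).
Proof.
move=> e0 B0 fz zB hM; have Oz : Omega z by apply/OmegaP; exists e.
split; first exact: pts_uniq.
  by move=> _ /allpairsP[[a b] /= [_ _ ->]]; exists a, b.
move=> _ [a [b ->]] lM; apply/allpairsP; exists (a, b) => /=.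
have [h1 h2] := Aemb_kappa a b e0 B0 fz zB.
have k0 := kappa_gt0 e0 B0.
by split=> //; rewrite mem_pols size_abs_lt //;
  [apply: (le_lt_trans h1) | apply: (le_lt_trans h2)]; apply: le_lt_trans hM;
  rewrite ler_pM2l.
Qed.

Lemma lattice2_lattice z : Omega z -> lattice (lattice2 z).
Proof.
move=> /OmegaP[e e0 fz]; split.
- by exists 0, 0; rewrite Aemb0 mul0r addr0.
- move=> _ _ [a [b ->]] [a' [b' ->]]; exists (a - a'), (b - b').
  by rewrite !AembB; ring.
- move=> c _ [a [b ->]]; exists (c%:P * a), (c%:P * b).
  by rewrite !AembM mulrDr mulrA.
move=> M; have [d hd] := qX_gt F (kappa e `|z| * M).
have [_ _ h] := pts_exhausts e0 (absv_ge0 z) fz (lexx _) hd.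
apply: (@sub_finite_set _ _ [set` pts z d]); last exact: finite_seq.
by move=> l [Ll lM]; apply: h.
Qed.

Definition mults n d : seq C := [seq Aemb (n * a) | a <- pols d].

Lemma mults_exhausts n d (M : R) : n != 0 -> M < q%:R ^+ d ->
  exhausts (@lattice1 F R C n) M (mults n d).
Proof.
move=> n0 hM; split.
- rewrite map_inj_uniq ?pols_uniq // => a b /Aemb_inj; exact: mulfI.
- by move=> _ /mapP[a _ ->]; exists a.
- move=> _ [a ->] h; apply/mapP; exists a => //; rewrite mem_pols size_abs_lt //.
  apply: le_lt_trans hM; apply: le_trans h.
  by rewrite AembM absvM ler_peMl ?absv_ge0 // abs_Aemb_ge1.
Qed.

Lemma lattice1_lattice n : n != 0 -> lattice (@lattice1 F R C n).
Proof.
move=> n0; split.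
- by exists 0; rewrite mulr0 Aemb0.
- by move=> _ _ [a ->] [b ->]; exists (a - b); rewrite mulrBr AembB.
- by move=> c _ [a ->]; exists (c%:P * a); rewrite [in RHS]mulrCA [in RHS]AembM.
move=> M; have [d hd] := qX_gt F M; have [_ _ h] := mults_exhausts n0 hd.
apply: (@sub_finite_set _ _ [set` mults n d]); last exact: finite_seq.
by move=> l [Ll lM]; apply: h.
Qed.

(** The only lattice point in the disc of radius |x| is 0, so every factor 1 - x / l has absolute
    value 1. *)
Lemma exp_abs_small L x : lattice L -> (forall l, L l -> l != 0 -> `|x| < `|l|) ->
  `|lattice_exp L x| = `|x|.
Proof.
move=> lL h; have [->|x0] := eqVneq x 0; first by rewrite exp0 // abs0.
rewrite (exp_abs (M := `|x|) (s := [:: 0]) lL) ?abs_gt0 //.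
  by rewrite big_cons eqxx /= big_nil mulr1.
split=> // l; first by rewrite inE => /eqP ->; case: lL.
move=> Ll lx; rewrite inE; apply: contraT => l0.
by have := h l Ll l0; rewrite ltNge lx.
Qed.

Lemma lattice_gap L : lattice L -> exists2 e, 0 < e &
  forall l, L l -> l != 0 -> e <= `|l|.
Proof.
move=> lL.
have [e e0 he] : exists2 e, 0 < e & forall l, l \in disc L 1 -> l != 0 -> e <= `|l|.
  elim: (disc L 1) => [|l s [e e0 he]]; first by exists 1.
  have [->|l0] := eqVneq l 0.
    by exists e => // k; rewrite inE => /orP[/eqP ->|/he//]; rewrite eqxx.
  exists (Num.min e `|l|); first by rewrite lt_min e0 abs_gt0.
  move=> k; rewrite inE ge_min => /orP[/eqP -> _|/he h /h ->//].
  by rewrite lexx orbT.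
exists (Num.min e 1); first by rewrite lt_min e0 ltr01.
move=> l Ll l0; rewrite ge_min; have [l1|l1] := leP `|l| 1.
  by rewrite he //; apply/mem_disc.
by rewrite (ltW l1) orbT.
Qed.

(* The values e_L (T^-k) have pairwise distinct absolute values for large k. *)
Lemma exp_poly_eq L (p s : {poly C}) : lattice L ->
  (forall x, p.[lattice_exp L x] = s.[lattice_exp L x]) -> p = s.
Proof.
move=> lL h; have [e e0 he] := lattice_gap lL.
have [d hd] := qXV_lt F e0.
pose v k := lattice_exp L (T ^- (d + k)).
have av k : `|v k| = q%:R ^- (d + k).
  rewrite /v exp_abs_small ?absV ?absX ?abs_T // => l Ll l0.
  apply: (lt_le_trans _ (he l Ll l0)); apply: le_lt_trans hd.
  by rewrite lef_pV2 ?posrE ?exprn_gt0 ?qR_gt0 // ler_eXn2l ?qR_gt1 // leq_addr.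
apply/eqP; rewrite -subr_eq0; apply: contraT => D0.
suff: (size (p - s)%R < size (p - s)%R)%N by rewrite ltnn.
rewrite -[X in (X < _)%N](size_mkseq v); apply: max_poly_roots => //.
  by apply/allP => _ /mapP[k _ ->]; rewrite /root !hornerE h subrr.
apply/mkseq_uniqP => i j _ _ /(congr1 (@absv _ _ _)); rewrite !av => /invr_inj h2.
by have/eqP := ieexprIn (qR_gt0 F R) (negbT (gt_eqF (qR_gt1 F R))) h2; rewrite eqn_add2l => /eqP.
Qed.
End Lattices.

(** * Drinfeld modules of rank 2 and the discriminant under z -> m z *)

Section Discriminant.
Variables (F : finFieldType) (R : realType) (C : Cinfty F R).
Local Notation q := #|F|.
Local Notation "`| x |" := (absv x) : ring_scope.
Local Notation sc := (sc C).
Local Notation Aemb := (Aemb C).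
Local Notation T := (Aemb 'X).
Implicit Types (x y z : C) (e : R) (a b : {poly F}) (L : set C).

Definition isogeny_pol L (M : seq C) : {poly C} :=
  'X * \prod_(m <- M | m != 0) (1 - (lattice_exp L m)^-1 *: 'X).

Lemma horner_isogeny_pol L M x : (isogeny_pol L M).[x] =
  x * \prod_(m <- M | m != 0) (1 - x / lattice_exp L m).
Proof.
rewrite /isogeny_pol !hornerE horner_prod; congr (_ * _).
by apply: eq_bigr => m _; rewrite !hornerE mulrC.
Qed.

Lemma size_nonzero (M : seq C) : uniq M -> 0 \in M ->
  size [seq m <- M | m != 0] = (size M).-1.
Proof. by move=> uM M0; rewrite -(rem_filter 0 uM) size_rem. Qed.

Lemma isogeny_pol_lead L M : lattice L -> uniq M -> 0 \in M ->
  {in M, forall m, L m -> m = 0} ->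
  [/\ size (isogeny_pol L M) = (size M).+1,
      lead_coef (isogeny_pol L M) = \prod_(m <- M | m != 0) (- (lattice_exp L m)^-1)
    & \prod_(m <- M | m != 0) (- (lattice_exp L m)^-1) != 0].
Proof.
move=> lL uM M0 ML; pose s := [seq m <- M | m != 0].
have se m : m \in s -> lattice_exp L m != 0.
  rewrite mem_filter => /andP[m0 mM]; apply: contra m0.
  by move=> /eqP/(exp_eq0 _ lL)/(ML _ mM)/eqP.
have P0 : \prod_(m <- M | m != 0) (- (lattice_exp L m)^-1) != 0.
  rewrite -big_filter prodf_seq_neq0; apply/allP => m ms /=.
  by rewrite oppr_eq0 invr_eq0 se.
have E : isogeny_pol L M = (\prod_(m <- M | m != 0) (- (lattice_exp L m)^-1)) *:
    \prod_(c <- 0 :: [seq lattice_exp L m | m <- s]) ('X - c%:P).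
  rewrite big_cons subr0 big_map -big_filter -/s scalerAr -scaler_prod.
  rewrite /isogeny_pol -big_filter -/s.
  congr (_ * _); apply: eq_big_seq => m ms.
  rewrite scalerBr !scaleNr opprK [LHS]addrC; congr (_ + _).
  by rewrite -alg_polyC scalerA mulVf ?se // scale1r.
split=> //; rewrite E.
  rewrite size_scale // size_prod_XsubC /= size_map size_nonzero // prednK //.
  by case: (M) M0.
by rewrite lead_coefZ (monicP (monic_prod_XsubC _ _ _)) mulr1.
Qed.

(** The defining choice is unambiguous because e_L takes infinitely many values, so any polynomial
    with the functional equation is the chosen one. *)
Lemma drinfeld_TE L p : lattice L ->
  (forall x, lattice_exp L (T * x) = p.[lattice_exp L x]) -> drinfeld_T L = p.
Proof.
move=> lL h; rewrite /drinfeld_T; case: xgetP => [s _ hs|/(_ p)//].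
by apply: (exp_poly_eq lL) => x; rewrite -h -hs.
Qed.

Lemma Omega_far_mul k x : far k x -> forall m : {poly F}, m != 0 -> far (`|Aemb m| * k) (Aemb m * x).
Proof.
move=> fx m m0 y; have m0' : Aemb m != 0 by rewrite Aemb_eq0.
have -> : Aemb m * x - Kemb C y = Aemb m * (x - Kemb C (y / m%:F)).
  by rewrite fmorph_div /= -/(Defs.Aemb C m); field.
by rewrite absvM ler_wpM2l ?absv_ge0.
Qed.

Lemma Omega_mul (m : {poly F}) z : m != 0 -> Omega z -> Omega (Aemb m * z).
Proof.
move=> m0 /OmegaP[e e0 fz]; apply/OmegaP; exists (`|Aemb m| * e); last exact: Omega_far_mul.
by rewrite mulr_gt0 // abs_gt0 Aemb_eq0.
Qed.

(* Representatives of m^-1 L / L for L = A z + A *)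
Definition torsion z (m : {poly F}) : seq C := [seq l / Aemb m | l <- pts z (size m).-1].

(* Representatives of (A z + m^-1 A) / (A z + A) *)
Definition torsion1 (m : {poly F}) : seq C := [seq Aemb b / Aemb m | b <- pols F (size m).-1].

Lemma size_modp_pred a (m : {poly F}) : m != 0 -> (size (a %% m)%R <= (size m).-1)%N.
Proof. by move=> m0; rewrite -ltnS prednK ?size_poly_gt0 // ltn_modp. Qed.

Lemma multiple_small a (m : {poly F}) : (m * a)%R \in pols F (size m).-1 -> m != 0 -> a = 0.
Proof.
rewrite mem_pols => h m0; apply/eqP; apply: contraT => a0.
have := dvdp_leq (mulf_neq0 m0 a0) (dvdp_mulr a (dvdpp m)).
by move=> /leq_trans /(_ h); rewrite -ltnS prednK ?size_poly_gt0 // ltnn.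
Qed.

(** Supplies the hypotheses of [exp_isogeny] for L_z inside m^-1 L_z; the decomposition is Euclidean
    division of both coordinates by m. *)
Lemma torsion_props z (m : {poly F}) : m != 0 -> Omega z ->
  [/\ uniq (torsion z m), 0 \in torsion z m,
     {in torsion z m &, forall x y, x - y \in torsion z m},
     {in torsion z m, forall x, lattice2 z x -> x = 0}
   & forall l, scale_set (Aemb m)^-1 (lattice2 z) l <->
       exists l0 t, [/\ lattice2 z l0, t \in torsion z m & l = l0 + t] ].
Proof.
move=> m0 Oz; have m0' : Aemb m != 0 by rewrite Aemb_eq0.
have /OmegaP[e e0 fz] := Oz.
split.
- by rewrite map_inj_uniq ?pts_uniq //; apply: mulIf; rewrite invr_eq0.
- by apply/mapP; exists 0; rewrite ?pts0 ?mul0r.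
- move=> _ _ /mapP[x hx ->] /mapP[y hy ->]; apply/mapP; exists (x - y).
    exact: ptsB.
  by rewrite mulrBl.
- move=> _ /mapP[_ /allpairsP[[a b] /= [ha hb ->]] ->] [a' [b' h]].
  have {h} : Aemb a * z + Aemb b = Aemb (m * a') * z + Aemb (m * b').
    by rewrite !AembM -mulrA -mulrDr -h [RHS]mulrC divfK.
  move=> /(Az_inj e0 fz)[Ea Eb]; subst a b.
  have -> := multiple_small ha m0; have -> := multiple_small hb m0.
  by rewrite mulr0 Aemb0 mul0r addr0 mul0r.
- move=> l; rewrite /scale_set /= invrK; split.
    move=> [a [b h]]; exists (Aemb (a %/ m) * z + Aemb (b %/ m)),
      ((Aemb (a %% m) * z + Aemb (b %% m)) / Aemb m); split.
    + by exists (a %/ m), (b %/ m).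
    + apply/mapP; exists (Aemb (a %% m) * z + Aemb (b %% m)) => //.
      by apply/allpairsP; exists (a %% m, b %% m); rewrite /= !mem_pols !size_modp_pred.
    + apply: (mulIf m0'); rewrite h mulrDl divfK //.
      rewrite {1}(divp_eq a m) {1}(divp_eq b m) !AembD !AembM; ring.
  move=> [_ [_ [[a [b ->]] /mapP[_ /allpairsP[[a' b'] /= [_ _ ->]] ->] ->]]].
  exists (a * m + a'), (b * m + b'); rewrite mulrDl divfK // !AembD !AembM; ring.
Qed.

(** The same for L_z inside m^-1 L_(m z) = A z + m^-1 A, where only the second coordinate is divided
    by m. *)
Lemma torsion1_props z (m : {poly F}) : m != 0 -> Omega z ->
  [/\ uniq (torsion1 m), 0 \in torsion1 m,
     {in torsion1 m &, forall x y, x - y \in torsion1 m},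
     {in torsion1 m, forall x, lattice2 z x -> x = 0}
   & forall l, scale_set (Aemb m)^-1 (lattice2 (Aemb m * z)) l <->
       exists l0 t, [/\ lattice2 z l0, t \in torsion1 m & l = l0 + t] ].
Proof.
move=> m0 Oz; have m0' : Aemb m != 0 by rewrite Aemb_eq0.
have /OmegaP[e e0 fz] := Oz.
split.
- rewrite map_inj_uniq ?pols_uniq // => a b /mulIf; rewrite invr_eq0 => /(_ m0').
  exact: Aemb_inj.
- by apply/mapP; exists 0; rewrite ?mem_pols ?size_poly0 // Aemb0 mul0r.
- move=> _ _ /mapP[a ha ->] /mapP[b hb ->]; apply/mapP; exists (a - b).
    rewrite mem_pols (leq_trans (size_polyD _ _)) // geq_max size_polyN.
    by rewrite -!mem_pols ha.
  by rewrite AembB mulrBl.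
- move=> _ /mapP[b hb ->] [a' [b' h]].
  have {h} : Aemb 0 * z + Aemb b = Aemb (m * a') * z + Aemb (m * b').
    by rewrite Aemb0 mul0r add0r !AembM -mulrA -mulrDr -h [RHS]mulrC divfK.
  move=> /(Az_inj e0 fz)[Ea Eb]; subst b.
  by have -> := multiple_small hb m0; rewrite mulr0 Aemb0 mul0r.
- move=> l; rewrite /scale_set /= invrK; split.
    move=> [a [b h]]; exists (Aemb a * z + Aemb (b %/ m)), (Aemb (b %% m) / Aemb m); split.
    + by exists a, (b %/ m).
    + by apply/mapP; exists (b %% m); rewrite ?mem_pols ?size_modp_pred.
    + apply: (mulIf m0'); rewrite h mulrDl divfK //.
      rewrite {1}(divp_eq b m) !AembD !AembM; ring.
  move=> [_ [_ [[a [b ->]] /mapP[b' _ ->] ->]]].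
  exists a, (b * m + b'); rewrite mulrDl divfK // !AembD !AembM; ring.
Qed.

(** By homothety e_L(T x) = T e_(T^-1 L)(x), and T^-1 L is L plus its T-torsion. *)
Lemma drinfeld2 z : Omega z ->
  drinfeld_T (lattice2 z) = T *: isogeny_pol (lattice2 z) (torsion z 'X).
Proof.
move=> Oz; have lL := lattice2_lattice Oz; have T0 := T_neq0 C.
have [h1 h2 h3 h4 h5] := torsion_props (negbT (polyX_eq0 F)) Oz.
apply: drinfeld_TE => // x; rewrite hornerZ horner_isogeny_pol.
have T0' : T^-1 != 0 by rewrite invr_eq0.
rewrite -(exp_isogeny x lL (scale_lattice T0' lL) h1 h2 h3 h4 h5).
have := exp_scale (T * x) T0' lL; rewrite mulKf // => ->.
by rewrite mulrA divff // mul1r.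
Qed.

Lemma drinfeld_spec z x : Omega z ->
  lattice_exp (lattice2 z) (T * x) = (drinfeld_T (lattice2 z)).[lattice_exp (lattice2 z) x].
Proof.
move=> Oz; have lL := lattice2_lattice Oz; have T0 := T_neq0 C.
have [h1 h2 h3 h4 h5] := torsion_props (negbT (polyX_eq0 F)) Oz.
rewrite drinfeld2 // hornerZ horner_isogeny_pol.
have T0' : T^-1 != 0 by rewrite invr_eq0.
rewrite -(exp_isogeny x lL (scale_lattice T0' lL) h1 h2 h3 h4 h5).
have := exp_scale (T * x) T0' lL; rewrite mulKf // => ->.
by rewrite mulrA divff // mul1r.
Qed.

(** The T-torsion has q^2 elements, so the coefficient picked in [Delta] is the leading one, a
    product of nonzero factors. *)
Lemma Delta_lead z : Omega z ->
  [/\ size (drinfeld_T (lattice2 z)) = (q ^ 2).+1,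
      Delta z = lead_coef (drinfeld_T (lattice2 z)),
      Delta z = T * \prod_(m <- torsion z 'X | m != 0) (- (lattice_exp (lattice2 z) m)^-1)
    & Delta z != 0].
Proof.
move=> Oz; have lL := lattice2_lattice Oz; have T0 := T_neq0 C.
have [h1 h2 h3 h4 h5] := torsion_props (negbT (polyX_eq0 F)) Oz.
have [s1 s2 s3] := isogeny_pol_lead lL h1 h2 h4.
have sz : size (drinfeld_T (lattice2 z)) = (q ^ 2).+1.
  by rewrite drinfeld2 // size_scale // s1 size_map size_pts size_polyX.
have E : Delta z = lead_coef (drinfeld_T (lattice2 z)) by rewrite lead_coefE sz.
have E2 : Delta z = T * \prod_(m <- torsion z 'X | m != 0) (- (lattice_exp (lattice2 z) m)^-1).
  by rewrite E drinfeld2 // lead_coefZ s2.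
by split=> //; rewrite E2 mulf_neq0.
Qed.

Lemma drinfeld_scale c L p : c != 0 -> lattice L ->
  (forall x, lattice_exp L (T * x) = p.[lattice_exp L x]) ->
  drinfeld_T (scale_set c L) = c *: (p \Po (c^-1 *: 'X)).
Proof.
move=> c0 lL h; apply: drinfeld_TE; first exact: scale_lattice.
move=> x; rewrite -[x](mulVKf c0); move: (c^-1 * x) => {}x.
by rewrite mulrCA !exp_scale // h hornerZ horner_comp hornerZ hornerX mulKf.
Qed.

Lemma lead_coef_scale c (p : {poly C}) : c != 0 ->
  lead_coef (c *: (p \Po (c^-1 *: 'X))) = c * (lead_coef p * c^-1 ^+ (size p).-1).
Proof.
move=> c0; rewrite lead_coefZ lead_coef_comp ?lead_coefZ ?lead_coefX ?mulr1 //.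
by rewrite size_scale ?invr_eq0 // size_polyX.
Qed.

Definition mons d := [seq b <- pols F d | b \is monic].

Lemma prod_mons (I : comPzRingType) d (g : {poly F} -> I) :
  \prod_(b <- pols F d | b != 0) g b =
  \prod_(b <- mons d) \prod_(c : F | c != 0) g (c *: b).
Proof.
transitivity (\prod_(b <- [seq c *: b | b <- mons d, c <- [seq c <- enum {: F} | c != 0]]) g b).
  rewrite -big_filter; apply: perm_big; apply: uniq_perm.
  - by rewrite filter_uniq // pols_uniq.
  - apply: allpairs_uniq; rewrite ?filter_uniq ?pols_uniq ?enum_uniq -?enumT ?enum_uniq //.
    move=> [a c] [b d'] /allpairsP[[x y] /= [hx hy [-> ->]]].
    move=> /allpairsP[[x' y'] /= [hx' hy' [-> ->]]] h.
    move: hx hx' hy hy'; rewrite !mem_filter => /andP[/monicP mx _] /andP[/monicP mx' _].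
    move=> /andP[y0 _] _; have := congr1 lead_coef h; rewrite !lead_coefZ mx mx' !mulr1 => yy.
    by move: h; rewrite -yy => /(scalerI y0) ->.
  - move=> b; rewrite mem_filter; apply/andP/allpairsP => [[b0 hb]|].
      exists ((lead_coef b)^-1 *: b, lead_coef b) => /=.
      rewrite !mem_filter -enumT mem_enum !inE lead_coef_eq0 b0 monicE lead_coefZ mulVf ?lead_coef_eq0 //.
      rewrite eqxx mem_pols size_scale ?invr_eq0 ?lead_coef_eq0 // -mem_pols hb.
      by rewrite scalerA divff ?lead_coef_eq0 // scale1r.
    move=> [[a c] /= []]; rewrite !mem_filter => /andP[am ad] /andP[c0 _] ->.
    by rewrite scaler_eq0 negb_or c0 monic_neq0 // mem_pols size_scale // -mem_pols.
rewrite big_allpairs_dep /=; apply: eq_bigr => b _.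
by rewrite big_filter big_enum_cond.
Qed.

Lemma card_nonzero : #|[pred c : F | c != 0]| = q.-1.
Proof. by rewrite (cardC1 0). Qed.

Lemma size_mons d : ((q - 1) * size (mons d) = q ^ d - 1)%N.
Proof.
have: size [seq b <- pols F d | b != 0] = (q ^ d - 1)%N.
  rewrite -rem_filter ?pols_uniq // size_rem ?size_pols ?subn1 //.
  by rewrite mem_pols size_poly0.
(* Taking every factor of [prod_mons] to be the indeterminate turns its identity of products into an
   identity of degrees, that is, of cardinalities. *)
rewrite mulnC => <-; pose X := ('X : {poly rat}).
have := @prod_mons {poly rat} d (fun=> 'X); rewrite -big_filter.
rewrite big_const_seq count_predT iter_mulr_1.
under [RHS]eq_bigr do rewrite prodr_const card_nonzero.
rewrite big_const_seq count_predT iter_mulr_1.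
rewrite -exprM => /(congr1 (fun p : {poly rat} => size p)).
by rewrite !size_polyXn => -[->]; rewrite subn1 mulnC.
Qed.

Lemma unit_exp c : c != 0 :> F -> c ^+ (q - 1) = 1.
Proof.
move=> c0; apply: (mulfI c0); rewrite -exprS subn1 prednK ?q_gt0 //.
by rewrite expf_card mulr1.
Qed.

Definition level : nat := ((q - 1) * (q ^ 2 - 1))%N.

Lemma q2_factor : (q ^ 2 - 1 = (q - 1) * (q + 1))%N.
Proof. by rewrite -(subn_sqr q 1) exp1n. Qed.

(* The nonzero m-torsion points e_L(b / m) up to scalars of F *)
Definition Eprod (m : {poly F}) z : C :=
  \prod_(b <- mons (size m).-1) lattice_exp (lattice2 z) (Aemb b / Aemb m).

Lemma Eprod_neq0 (m : {poly F}) z : m != 0 -> Omega z -> forall b, b \in mons (size m).-1 ->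
  lattice_exp (lattice2 z) (Aemb b / Aemb m) != 0.
Proof.
move=> m0 Oz b; rewrite mem_filter => /andP[bm hb].
have [_ _ _ h4 _] := torsion1_props m0 Oz.
apply/eqP => /(exp_eq0 _ (lattice2_lattice Oz)) h.
have /eqP : Aemb b / Aemb m = 0 by apply: h4 => //; apply/mapP; exists b.
by rewrite mulf_eq0 invr_eq0 !Aemb_eq0 (negPf m0) orbF (negPf (monic_neq0 bm)).
Qed.

Lemma Delta_mul (m : {poly F}) z : m != 0 -> Omega z ->
  Delta (Aemb m * z) =
    Aemb m ^- (q ^ 2 - 1) * Delta z ^+ pnorm m * Eprod m z ^+ level.
Proof.
move=> m0 Oz; have lL := lattice2_lattice Oz.
have m0' : Aemb m != 0 by rewrite Aemb_eq0.
have m0V : (Aemb m)^-1 != 0 by rewrite invr_eq0.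
have Omz := Omega_mul m0 Oz; have lLm := lattice2_lattice Omz.
have lL' := scale_lattice m0V lLm.
have [h1 h2 h3 h4 h5] := torsion1_props m0 Oz.
have [s1 s2 s3] := isogeny_pol_lead lL h1 h2 h4.
set P := isogeny_pol _ _ in s1 s2; set pi := \prod_(_ <- _ | _) _ in s2 s3.
have PE x : P.[lattice_exp (lattice2 z) x] =
    lattice_exp (scale_set (Aemb m)^-1 (lattice2 (Aemb m * z))) x.
  by rewrite horner_isogeny_pol (exp_isogeny x lL lL' h1 h2 h3 h4 h5).
have [dz1 dz2 _ dz4] := Delta_lead Oz; have [dm1 dm2 _ dm4] := Delta_lead Omz.
set p := drinfeld_T (lattice2 z) in dz1 dz2.
set p'' := drinfeld_T (lattice2 (Aemb m * z)) in dm1 dm2.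
have spec'' x := drinfeld_spec x Omz.
pose p' := (Aemb m)^-1 *: (p'' \Po ((Aemb m)^-1^-1 *: 'X)).
have spec' x : lattice_exp (scale_set (Aemb m)^-1 (lattice2 (Aemb m * z))) (T * x) =
    p'.[lattice_exp (scale_set (Aemb m)^-1 (lattice2 (Aemb m * z))) x].
  rewrite -[x](mulVKf m0V); move: ((Aemb m)^-1^-1 * x) => {}x.
  by rewrite mulrCA !exp_scale // spec'' hornerZ horner_comp hornerZ hornerX mulKf.
(* At y = e_L(x) both sides equal e_L'(T x), where L' = m^-1 L_(m z): the isogeny intertwines the
   two actions of T. *)
have comp : p' \Po P = P \Po p.
  apply: (exp_poly_eq lL) => x.
  by rewrite !horner_comp PE -spec' -drinfeld_spec // PE.
have tsz : size (torsion1 m) = pnorm m by rewrite size_map size_pols.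
have q20 : (0 < q ^ 2)%N by rewrite expn_gt0 q_gt0.
have pn0 : (0 < pnorm m)%N by rewrite expn_gt0 q_gt0.
have szp' : size p' = (q ^ 2).+1.
  by rewrite size_scale // size_comp_poly2 ?dm1 // size_scale ?invr_eq0 // size_polyX.
have := congr1 lead_coef comp; rewrite !lead_coef_comp ?s1 ?dz1 ?ltnS ?tsz //.
rewrite s2 -dz2 szp' lead_coef_scale // -dm2 dm1 /= invrK.
have -> : (q ^ 2 = (q ^ 2 - 1).+1)%N by rewrite subn1 prednK.
rewrite !exprS subSS subn0; set k := (q ^ 2 - 1)%N => E.
have piV : pi^-1 ^+ k = Eprod m z ^+ level.
  rewrite /pi -prodfV big_map.
  rewrite (eq_bigl (fun b => b != 0)); last first.
    by move=> b; rewrite mulf_eq0 invr_eq0 !Aemb_eq0 (negPf m0) orbF.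
  rewrite prod_mons /Eprod -!prodrXl; apply: eq_bigr => b _.
  (* The multiples c b of one monic b contribute e_z(b / m)^(q - 1) up to a constant of F. Raising
     to the power q^2 - 1, a multiple of q - 1, removes the constant, and the exponent becomes N. *)
  have -> : \prod_(c : F | c != 0) (- (lattice_exp (lattice2 z) (Aemb (c *: b) / Aemb m))^-1)^-1 =
    sc (\prod_(c : F | c != 0) (- c)) * lattice_exp (lattice2 z) (Aemb b / Aemb m) ^+ (q - 1).
    rewrite rmorph_prod subn1 -card_nonzero -prodr_const -big_split /=.
    apply: eq_bigr => c _; rewrite invrN invrK -mul_polyC AembM -mulrA exp_Z //.
    by rewrite rmorphN mulNr.
  rewrite exprMn -rmorphXn /k q2_factor exprM unit_exp ?expr1n ?rmorph1 ?mul1r.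
    by rewrite -exprM /level q2_factor.
  by rewrite prodf_seq_neq0; apply/allP => c _; apply/implyP; rewrite oppr_eq0.
rewrite -piV; move: E.
have -> : (Aemb m)^-1 * (Delta (Aemb m * z) * (Aemb m * Aemb m ^+ k)) * (pi * pi ^+ k) =
   pi * (Delta (Aemb m * z) * Aemb m ^+ k * pi ^+ k) by field.
move=> /(mulfI s3) <-; rewrite exprVn; field.
by rewrite !expf_neq0.
Qed.

End Discriminant.

(** * The (q - 1)-st power residue symbol over A *)

Section ResidueSymbol.
Variable F : finFieldType.
Local Notation q := #|F|.
Implicit Types (a b d m p u : {poly F}).

Local Notation mons := (mons F).
Local Notation pols := (pols F).

(* Gauss' lemma makes this the (q-1)-st power residue symbol (d / m). *)
Definition symbol m d : F := \prod_(b <- mons (size m).-1) lead_coef ((b * d) %% m).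

Lemma mem_mons k b : (b \in mons k) = (b \is monic) && (size b <= k)%N.
Proof. by rewrite mem_filter mem_pols. Qed.

Lemma mons_uniq k : uniq (mons k).
Proof. by rewrite filter_uniq // pols_uniq. Qed.

Lemma small_dvdp b m : m != 0 -> (size b <= (size m).-1)%N -> m %| b -> b = 0.
Proof.
move=> m0 sb mb; apply/eqP; apply: contraT => b0.
have := leq_trans (dvdp_leq b0 mb) sb.
by rewrite -ltnS prednK ?size_poly_gt0 // ltnn.
Qed.

Lemma modp_mul_neq0 b d m : m \is monic -> coprimep d m -> b \in mons (size m).-1 ->
  (b * d) %% m != 0.
Proof.
move=> mm cdm; rewrite mem_mons => /andP[bm sb].
apply/negP => /eqP/modp_eq0P; rewrite Gauss_dvdpl 1?coprimep_sym // => mb.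
by have := small_dvdp (monic_neq0 mm) sb mb => /eqP; rewrite (negPf (monic_neq0 bm)).
Qed.

Lemma symbol_neq0 m d : m \is monic -> coprimep d m -> symbol m d != 0.
Proof.
move=> mm cdm; rewrite prodf_seq_neq0; apply/allP => b bm /=.
by rewrite lead_coef_eq0 modp_mul_neq0.
Qed.

Lemma symbol_mod m d : symbol m (d %% m) = symbol m d.
Proof. by apply: eq_bigr => b _; rewrite modp_mul. Qed.

Definition normalize p := (lead_coef p)^-1 *: p.

Lemma normalizeK p : p != 0 -> lead_coef p *: normalize p = p.
Proof. by move=> p0; rewrite scalerA divff ?lead_coef_eq0 // scale1r. Qed.

Lemma normalize_monic p : p != 0 -> normalize p \is monic.
Proof. by move=> p0; rewrite monicE lead_coefZ mulVf // lead_coef_eq0. Qed.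

Lemma size_normalize p : size (normalize p) = size p.
Proof.
have [->|p0] := eqVneq p 0; first by rewrite /normalize scaler0.
by rewrite size_scale // invr_eq0 lead_coef_eq0.
Qed.

(* Multiplication by d permutes the lines of A / m. *)
Lemma symbol_perm (E : fieldType) (iota : {rmorphism F -> E}) m d (psi : {poly F} -> E) :
  m \is monic -> coprimep d m ->
  (forall c b, psi (c *: b) = iota c * psi b) ->
  (forall b, psi (b %% m) = psi b) ->
  \prod_(b <- mons (size m).-1) psi (b * d) =
  iota (symbol m d) * \prod_(b <- mons (size m).-1) psi b.
Proof.
move=> mm cdm psiZ psim; have m0 := monic_neq0 mm.
pose tau b := normalize ((b * d) %% m); set s := mons _.
have tau_s : {subset [seq tau b | b <- s] <= s}.
  move=> _ /mapP[b bs ->]; have n0 := modp_mul_neq0 mm cdm bs.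
  by rewrite mem_mons normalize_monic //= size_normalize size_modp_pred.
have tau_inj : {in s &, injective tau}.
  move=> b b' bs bs' h; have n0 := modp_mul_neq0 mm cdm bs.
  have n0' := modp_mul_neq0 mm cdm bs'.
  pose c := lead_coef ((b * d) %% m) / lead_coef ((b' * d) %% m).
  have E1 : (b * d) %% m = c *: ((b' * d) %% m).
    rewrite -[LHS](normalizeK n0) -/(tau b) h -[X in _ = _ *: X](normalizeK n0').
    by rewrite -/(tau b') [RHS]scalerA /c divfK ?lead_coef_eq0.
  have : m %| (b - c *: b') * d.
    apply/modp_eq0P; rewrite mulrBl modpD modpN -scalerAl modpZl E1 subrr //.
  rewrite Gauss_dvdpl 1?coprimep_sym // => /(small_dvdp m0) h2.
  move: bs bs'; rewrite !mem_mons => /andP[bm sb] /andP[bm' sb'].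
  have {}h2 : b = c *: b'.
    apply/eqP; rewrite -subr_eq0; apply/eqP/h2.
    rewrite (leq_trans (size_polyD _ _)) // geq_max sb size_polyN.
    by rewrite (leq_trans (size_scale_leq _ _)).
  have := congr1 lead_coef h2; rewrite lead_coefZ (monicP bm) (monicP bm') mulr1 => c1.
  by rewrite h2 -c1 scale1r.
have pe : perm_eq [seq tau b | b <- s] s.
  have ut : uniq [seq tau b | b <- s] by rewrite map_inj_in_uniq // mons_uniq.
  apply: uniq_perm => //; first exact: mons_uniq.
  by have [] := uniq_min_size ut tau_s _; rewrite ?size_map.
rewrite -[in RHS](perm_big _ pe) /= big_map rmorph_prod -big_split /=.
apply: eq_big_seq => b bs; have n0 := modp_mul_neq0 mm cdm bs.
by rewrite -psim -{1}(normalizeK n0) psiZ.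
Qed.

(** Euclidean division by m: a monic b of degree at least k = deg m has a monic quotient b1 and an
    arbitrary remainder b0 of degree less than k. *)
Lemma mons_split m k k' (I : comPzRingType) (g : {poly F} -> I) :
  m \is monic -> size m = k.+1 ->
  \prod_(b <- mons (k + k')) g b =
  \prod_(b <- mons k) g b * \prod_(b1 <- mons k') \prod_(b0 <- pols k) g (b1 * m + b0).
Proof.
move=> mm sm; have m0 := monic_neq0 mm.
have small b0 : b0 \in pols k -> (size b0 < size m)%N by rewrite mem_pols sm.
have big b1 b0 : b1 \in mons k' -> b0 \in pols k ->
    [/\ size (b1 * m + b0) = (size b1 + k)%N & b1 * m + b0 \is monic].
  rewrite mem_mons => /andP[b1m _] /small hb0.
  have s1 : size (b1 * m) = (size b1 + k)%N by rewrite size_Mmonic ?monic_neq0 // sm addnS.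
  have b1_0 : (0 < size b1)%N by rewrite size_poly_gt0 monic_neq0.
  have lt : (size b0 < size (b1 * m)%R)%N.
    by rewrite s1 (leq_trans hb0) // sm -add1n leq_add2r.
  split; first by rewrite size_polyDl // s1.
  by rewrite monicE lead_coefDl // lead_coef_Mmonic // (monicP b1m).
rewrite -(big_allpairs_dep (h := fun b1 b0 => b1 * m + b0)) -big_cat.
apply: perm_big; apply: uniq_perm; first exact: mons_uniq.
  rewrite cat_uniq mons_uniq allpairs_uniq ?mons_uniq ?pols_uniq ?andbT //=.
    apply/hasPn => _ /allpairsP[[b1 b0] /= [h1 h2 ->]].
    have [sb _] := big _ _ h1 h2; rewrite mem_mons negb_and sb -ltnNge.
    move: h1; rewrite mem_mons => /andP[b1m _].
    by rewrite -[k in (k < _)%N]add0n ltn_add2r size_poly_gt0 monic_neq0 // orbT.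
  move=> [x1 x0] [y1 y0] /allpairsP[[b1 b0] /= [h1 h2 [-> ->]]].
  move=> /allpairsP[[c1 c0] /= [h3 h4 [-> ->]]] h.
  have := congr1 (fun p => p %/ m) h; have := congr1 (fun p => p %% m) h.
  rewrite !modp_addl_mul_small ?small // !divp_addl_mul_small ?small //.
  by move=> -> ->.
move=> b; rewrite mem_cat; apply/idP/orP => [bK|[]].
- move: (bK); rewrite mem_mons => /andP[bm sb].
  have [sk|sk] := leqP (size b) k; first by left; rewrite mem_mons bm.
  right; apply/allpairsP; exists (b %/ m, b %% m) => /=.
  have hm : b %% m \in pols k by rewrite mem_pols -ltnS -sm ltn_modp.
  split; rewrite -?divp_eq // mem_mons size_divp // sm /= leq_subLR sb andbT.
  rewrite monicE -(monicP bm) {2}(divp_eq b m) lead_coefDl ?lead_coef_Mmonic //.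
  have d0 : b %/ m != 0 by rewrite divp_eq0 !negb_or monic_neq0 // m0 sm -leqNgt.
  rewrite (leq_trans (small _ hm)) // size_Mmonic // sm addnS /=.
  by rewrite -add1n leq_add2r size_poly_gt0.
- by rewrite !mem_mons => /andP[-> h]; rewrite (leq_trans h) ?leq_addr.
- move=> /allpairsP[[b1 b0] /= [h1 h2 ->]]; have [sb bm] := big _ _ h1 h2.
  rewrite mem_mons bm sb addnC leq_add2l; move: h1; rewrite mem_mons.
  by case/andP.
Qed.

(** By [symbol_perm], the symbol is the product of psi(b d) / psi(b) over the monic b for any
    nonvanishing F-homogeneous psi on A / (m m'). The choice of psi below makes this product split
    along [mons_split]. *)
Lemma symbolM m m' d : m \is monic -> m' \is monic -> coprimep d m -> coprimep d m' ->
  symbol (m * m') d = symbol m d * symbol m' d.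
Proof.
move=> mm mm' cm cm'; have m0 := monic_neq0 mm; have m0' := monic_neq0 mm'.
(* Reads off the residue of b modulo m, or that of b / m modulo m' when m divides b; both depend
   only on b modulo m m'. *)
pose psi b := if m %| b then lead_coef ((b %/ m) %% m') else lead_coef (b %% m).
have psiZ c b : psi (c *: b) = c * psi b.
  have [->|c0] := eqVneq c 0.
    by rewrite scale0r mul0r /psi dvdp0 div0p mod0p lead_coef0.
  by rewrite /psi dvdpZr // divpZl !modpZl !lead_coefZ; case: ifP.
have psim b : psi (b %% (m * m')) = psi b.
  rewrite /psi; have := divp_eq b (m * m'); set Q := b %/ (m * m'); set r := b %% _ => bE.
  rewrite bE; have mQ : m %| Q * (m * m') by rewrite dvdp_mull // dvdp_mulr.
  rewrite (dvdp_addr _ mQ); case: ifP => [mr|_]; last first.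
    by rewrite modpD (modp_eq0 mQ) add0r.
  move: mr => /dvdpP[r' ->].
  by rewrite [m * m']mulrC mulrA -mulrDl !mulpK // modpD modp_mull add0r.
have cmm : coprimep d (m * m') by rewrite coprimepMr cm.
have mmm : m * m' \is monic by rewrite monicMl.
pose k := (size m).-1; pose k' := (size m').-1.
have sm : size m = k.+1 by rewrite prednK // size_poly_gt0.
have sm' : size m' = k'.+1 by rewrite prednK // size_poly_gt0.
have sK : (size (m * m')%R).-1 = (k + k')%N.
  by rewrite size_Mmonic // sm sm' addnS.
have := symbol_perm (iota := idfun) mmm cmm psiZ psim; rewrite sK /= => E.
have dmul b : (m %| b * d) = (m %| b) by rewrite Gauss_dvdpl // coprimep_sym.
have psi0 b : b \in mons (k + k') -> psi b != 0.
  rewrite mem_mons -sK => /andP[bm sb]; rewrite /psi; case: ifP => [mb|/negbT mb].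
    rewrite lead_coef_eq0; apply/negP => /eqP/modp_eq0P m'b.
    have : m * m' %| b by rewrite -(divpK mb) mulrC dvdp_mul.
    move=> /(small_dvdp (monic_neq0 mmm) sb) /eqP; exact/negP/monic_neq0.
  by rewrite lead_coef_eq0; apply: contra mb => /eqP/modp_eq0P.
have P0 : \prod_(b <- mons (k + k')) psi b != 0.
  by rewrite prodf_seq_neq0; apply/allP => b /psi0.
apply: (mulIf P0); rewrite -E.
have -> : \prod_(b <- mons (k + k')) psi (b * d) =
  \prod_(b <- mons (k + k')) (psi (b * d) / psi b) * \prod_(b <- mons (k + k')) psi b.
  by rewrite -big_split /=; apply: eq_big_seq => b bs; rewrite divfK // psi0.
congr (_ * _); rewrite (mons_split _ _ mm sm); congr (_ * _).
  apply: eq_big_seq => b; rewrite mem_mons => /andP[bm sb].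
  have mb : (m %| b) = false.
    by apply/negP => /(small_dvdp m0 sb)/eqP; apply/negP/monic_neq0.
  rewrite /psi dmul mb (modp_small (p := b)) ?(monicP bm) ?divr1 //.
  by rewrite sm ltnS.
apply: eq_big_seq => b1; rewrite mem_mons => /andP[b1m sb1].
rewrite (bigD1_seq 0) ?pols_uniq ?mem_pols ?size_poly0 //= addr0.
have -> : psi (b1 * m * d) / psi (b1 * m) = lead_coef ((b1 * d) %% m').
  rewrite /psi dmul dvdp_mull // mulrAC !mulpK // (modp_small (p := b1)) ?sm' ?ltnS //.
  by rewrite (monicP b1m) divr1.
rewrite -[RHS]mulr1; congr (_ * _).
pose g b0 := lead_coef ((b0 * d) %% m) / lead_coef b0.
transitivity (\prod_(b0 <- pols k | b0 != 0) g b0).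
  rewrite big_seq_cond [RHS]big_seq_cond; apply: eq_bigr => b0.
  rewrite mem_pols => /andP[sb0 b00].
  have mb : (m %| b1 * m + b0) = false.
    rewrite dvdp_addr ?dvdp_mull //; apply/negP => /(small_dvdp m0 sb0)/eqP.
    exact/negP.
  rewrite /psi dmul mb mulrDl !modpD -mulrAC !modp_mull !add0r.
  by rewrite (modp_small (p := b0)) // sm ltnS.
(* For b0 != 0 the factor depends only on the F-line of b0, so each line contributes the (q - 1)-st
   power of an element of F, which is 1. Only b0 = 0 remains, and it gives the symbol modulo m'. *)
rewrite prod_mons big1_seq // => b /= bs.
have n0 := modp_mul_neq0 mm cm bs.
rewrite (eq_bigr (fun=> lead_coef ((b * d) %% m))).
  by rewrite prodr_const card_nonzero -subn1 unit_exp // lead_coef_eq0.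
move=> c c0; rewrite /g -scalerAl modpZl !lead_coefZ.
move: bs; rewrite mem_mons => /andP[/monicP -> _].
by rewrite mulr1 mulrAC divff // mul1r.
Qed.

Lemma symbol1l d : symbol 1 d = 1.
Proof.
rewrite /symbol size_poly1 big1_seq // => b /=; rewrite mem_mons leqn0 size_poly_eq0.
by case/andP => /monic_neq0/negPf ->.
Qed.

Lemma symbol1r m : m \is monic -> symbol m 1 = 1.
Proof.
move=> mm; rewrite /symbol big1_seq // => b /=; rewrite mem_mons => /andP[/monicP bm sb].
rewrite mulr1 modp_small ?bm // (leq_ltn_trans sb) // prednK //.
by rewrite size_poly_gt0 monic_neq0.
Qed.

Lemma symbolX m d k : m \is monic -> coprimep d m -> symbol (m ^+ k) d = symbol m d ^+ k.
Proof.
move=> mm cm; elim: k => [|k IH]; first by rewrite symbol1l.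
by rewrite !exprS symbolM ?IH ?monic_exp // coprimep_expr.
Qed.

Lemma symbol_prod (s : seq {poly F}) (k : {poly F} -> nat) d :
  (forall m, m \in s -> m \is monic /\ coprimep d m) ->
  symbol (\prod_(m <- s) m ^+ k m) d = \prod_(m <- s) symbol m d ^+ k m.
Proof.
elim: s => [|m s IH] h; first by rewrite !big_nil symbol1l.
have hs x : x \in s -> x \is monic /\ coprimep d x.
  by move=> xs; apply: h; rewrite inE xs orbT.
have [mm cm] := h m (mem_head _ _).
rewrite !big_cons symbolM ?IH ?symbolX ?monic_exp //.
- rewrite big_seq; apply: monic_prod => x /hs[? _]; exact: monic_exp.
- exact: coprimep_expr.
- rewrite big_seq; apply: (big_ind (coprimep d)); first exact: coprimep1.
    by move=> x y hx hy; rewrite coprimepMr hx.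
  by move=> x /hs[_ cx]; apply: coprimep_expr.
Qed.

Section Evaluation.
Variables (E : closedFieldType) (iota : {rmorphism F -> E}).

(** Evaluation at a root of p embeds the residue field in [E] and identifies the symbol with the
    w-th power map, w = (q^deg p - 1) / (q - 1). With k0 = k modulo q - 1, all w (q - 1) nonzero
    residues are roots of X^(w k0) - 1, which is impossible for 0 < k0 < q - 1. *)
Lemma symbol_irreducible p (k : nat) : p \is monic -> irreducible_poly p ->
  (forall d, coprimep d p -> symbol p d ^+ k = 1) -> (q - 1 %| k)%N.
Proof.
move=> pm ip hk; have p0 := monic_neq0 pm; have [sp _] := ip.
have [th rth] : exists th, root (map_poly iota p) th.
  by apply/closed_rootP; rewrite size_map_poly; case: (size p) sp => [|[]].
pose psi b := (map_poly iota b).[th].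
have psiM b b' : psi (b * b') = psi b * psi b' by rewrite /psi rmorphM hornerM.
have psiB b b' : psi (b - b') = psi b - psi b' by rewrite /psi rmorphB !hornerE.
have psiD b b' : psi (b + b') = psi b + psi b' by rewrite /psi rmorphD hornerD.
have psip : psi p = 0 by apply/eqP.
have psiZ c b : psi (c *: b) = iota c * psi b by rewrite /psi map_polyZ hornerZ.
have psim b : psi (b %% p) = psi b.
  by rewrite {2}(divp_eq b p) psiD psiM psip mulr0 add0r.
have psi0 b : psi b = 0 -> p %| b.
  move=> pb; apply: contraT; rewrite -(irreducible_poly_coprime _ ip) => /Bezout_eq1_coprimepP[[x y] /= h].
  have /eqP := congr1 psi h; rewrite psiD !psiM psip pb !mulr0 addr0.
  by rewrite /psi rmorph1 hornerC eq_sym oner_eq0.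
pose K := (size p).-1; pose w := size (mons K).
have K0 : (0 < K)%N by rewrite /K; case: (size p) sp => [|[]].
have psi_s d : coprimep d p -> psi d ^+ w = iota (symbol p d).
  move=> cd; have := symbol_perm pm cd psiZ psim.
  have P0 : \prod_(b <- mons K) psi b != 0.
    rewrite prodf_seq_neq0; apply/allP => b /=; rewrite mem_mons => /andP[bm sb].
    apply/eqP => /psi0/(small_dvdp p0 sb)/eqP; exact/negP/monic_neq0.
  under eq_bigr do rewrite psiM; rewrite big_split /= [X in X = _]mulrC => /(mulIf P0) <-.
  by rewrite big_const_seq count_predT iter_mulr_1.
apply/negP => /negP nk; pose k0 := (k %% (q - 1))%N.
have q1 : (0 < q - 1)%N by rewrite subn_gt0 q_gt1.
have k0_gt0 : (0 < k0)%N by rewrite lt0n; apply: contra nk => /eqP h; apply/eqP.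
have w0 : (0 < w)%N.
  rewrite /w; suff: 1 \in mons K by case: (mons K).
  by rewrite mem_mons monic1 size_poly1.
pose s := [seq psi b | b <- [seq b <- pols K | b != 0]].
have cop b : b \in pols K -> b != 0 -> coprimep b p.
  rewrite mem_pols => sb b0; rewrite coprimep_sym irreducible_poly_coprime //.
  by apply: contra b0 => /(small_dvdp p0 sb) ->.
have us : uniq s.
  rewrite map_inj_in_uniq ?filter_uniq ?pols_uniq // => b b'.
  rewrite !mem_filter !mem_pols => /andP[_ sb] /andP[_ sb'] /eqP.
  rewrite -subr_eq0 -psiB => /eqP/psi0/(small_dvdp p0) h.
  apply/eqP; rewrite -subr_eq0; apply/eqP/h.
  by rewrite (leq_trans (size_polyD _ _)) // geq_max sb size_polyN.
have rs : all (root ('X^(w * k0) - 1)) s.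
  apply/allP => _ /mapP[b + ->]; rewrite mem_filter => /andP[b0 bK].
  have cb := cop b bK b0.
  rewrite /root !hornerE subr_eq0 exprM psi_s // -rmorphXn.
  have -> : symbol p b ^+ k0 = 1.
    rewrite -(hk b cb) (divn_eq k (q - 1)) exprD mulnC exprM unit_exp ?symbol_neq0 //.
    by rewrite expr1n mul1r.
  by rewrite rmorph1.
have wk0 : (0 < w * k0)%N by rewrite muln_gt0 w0.
have n0 : 'X^(w * k0) - 1 != 0 :> {poly E}.
  by rewrite -size_poly_eq0 size_XnsubC.
have := max_poly_roots n0 rs us; rewrite size_XnsubC // ltnS size_map.
have -> : size [seq b <- pols K | b != 0] = (w * (q - 1))%N.
  rewrite -rem_filter ?pols_uniq // size_rem ?size_pols ?mem_pols ?size_poly0 //.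
  by rewrite mulnC size_mons subn1.
by rewrite leq_pmul2l // leqNgt ltn_pmod.
Qed.

Lemma irreducible_factor u : (1 < size u)%N ->
  exists p, [/\ p \is monic, irreducible_poly p & p %| u].
Proof.
elim: {u}(size u) {-2}u (leqnn (size u)) => [|k IH] u; first by case: (size u).
move=> su s1; have u0 : u != 0 by rewrite -size_poly_gt0 (ltn_trans _ s1).
have [iu|iu] := pselect (irreducible_poly u).
  have [_ iu2] := iu; exists (normalize u); split; first exact: normalize_monic.
    split; first by rewrite size_normalize.
    move=> d sd; rewrite dvdpZr ?invr_eq0 ?lead_coef_eq0 // => /(iu2 _ sd) h.
    by rewrite (eqp_trans h) // eqp_sym eqp_scale // invr_eq0 lead_coef_eq0.
  by rewrite dvdpZl ?invr_eq0 ?lead_coef_eq0.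
have [d [sd du nd]] : exists d, [/\ size d != 1%N, d %| u & ~~ (d %= u)].
  apply: contrapT => h; apply: iu; split=> // d sd du.
  by apply: contraT => nd; case: h; exists d.
have d0 : d != 0 by apply: contraNneq nd => d0; move: du; rewrite d0 dvd0p => /eqP ->; rewrite eqpxx.
have s2 : (size d < size u)%N.
  by rewrite ltn_neqAle dvdp_leq // andbT; apply: contra nd; rewrite dvdp_size_eqp.
have [||p [p1 p2 p3]] := IH d; first by rewrite -ltnS (leq_trans s2).
  by rewrite ltn_neqAle eq_sym sd size_poly_gt0.
by exists p; split=> //; apply: dvdp_trans du.
Qed.

Lemma split_power p u : (1 < size p)%N -> u != 0 ->
  exists k u', u = p ^+ k * u' /\ ~~ (p %| u').
Proof.
move=> sp; elim: {u}(size u) {-2}u (leqnn (size u)) => [|k IH] u.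
  by rewrite leqn0 size_poly_eq0 => /eqP -> /eqP.
move=> su u0; have [|npu] := boolP (p %| u); last by exists 0%N, u; rewrite mul1r.
move=> /dvdpP[v uv]; have v0 : v != 0 by apply: contraNneq u0; rewrite uv => ->; rewrite mul0r.
have p0 : p != 0 by rewrite -size_poly_gt0 (ltn_trans _ sp).
have [|j [v' [vE nv]]] := IH v _ v0.
  rewrite -ltnS (leq_trans _ su) // uv size_mul //.
  by case: (size p) sp => [|[|i]] // _; rewrite !addnS ltnS leq_addr.
by exists j.+1, v'; rewrite uv vE exprSr mulrAC.
Qed.

(** Induction on the degree, splitting off the full power p^j of an irreducible factor. The Chinese
    remainder theorem isolates the symbol at p, so that [symbol_irreducible] gives q - 1 | j. *)
Lemma symbol_power u n : u \is monic -> n != 0 ->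
  (forall d, coprimep d n -> coprimep d u) ->
  (forall d, coprimep d n -> symbol u d = 1) ->
  exists2 v, v \is monic & u = v ^+ (q - 1).
Proof.
elim: {u}(size u) {-2}u (leqnn (size u)) => [|k IH] u.
  by rewrite leqn0 size_poly_eq0 => /eqP -> /monic_neq0/eqP.
move=> su um n0 cu hu; have u0 := monic_neq0 um.
have [s1|s1] := leqP (size u) 1.
  exists 1; first exact: monic1.
  rewrite expr1n (size1_polyC s1); congr (_%:P); move/monicP: um.
  by rewrite (size1_polyC s1) lead_coefC coefC.
have [p [pm ip pu]] := irreducible_factor s1; have [sp _] := ip.
have [j [u' [uE pu']]] := split_power sp u0.
have [j' [n' [nE pn']]] := split_power sp n0.
have p0 := monic_neq0 pm.
have u'm : u' \is monic by move: um; rewrite uE monicMl // monic_exp.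
have u'0 := monic_neq0 u'm.
have n'0 : n' != 0 by apply: contraNneq n0; rewrite nE => ->; rewrite mulr0.
have cu' d : coprimep d n -> coprimep d u' by move=> /cu; rewrite uE coprimepMr => /andP[].
have cpM : coprimep p (u' * n').
  by rewrite coprimepMr !irreducible_poly_coprime // pu' pn'.
have hp d : coprimep d p -> symbol p d ^+ j = 1.
  move=> cd; have /Bezout_eq1_coprimepP[[x y] /= xy] := cpM.
  (* Congruent to d modulo p and to 1 modulo u' n', where n' is n freed of p. Hence D is prime to n,
     and its symbol modulo u is the j-th power of that of d modulo p. *)
  pose D := d * (y * (u' * n')) + x * p.
  have Dp : D %% p = d %% p.
    have -> : D = d + (x - d * x) * p.
      have yE : y * (u' * n') = 1 - x * p by rewrite -xy addrAC subrr add0r.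
      by rewrite /D yE; ring.
    by rewrite modpD modp_mull addr0.
  have Du a : a %| u' * n' -> D %% a = 1 %% a.
    move=> /dvdpP[c cE]; have -> : D = 1 + ((d - 1) * y * c) * a.
      have xE : x * p = 1 - y * (u' * n') by rewrite -xy addrK.
      by rewrite /D xE cE; ring.
    by rewrite modpD modp_mull addr0.
  have cDp : coprimep D p by rewrite -coprimep_modl Dp coprimep_modl.
  have cDn' : coprimep D n' by rewrite -coprimep_modl Du ?dvdp_mull // coprimep_modl coprime1p.
  have cDu' : coprimep D u' by rewrite -coprimep_modl Du ?dvdp_mulr // coprimep_modl coprime1p.
  have cDn : coprimep D n by rewrite nE coprimepMr cDn' coprimep_expr.
  have := hu D cDn; rewrite uE symbolM ?monic_exp ?coprimep_expr // symbolX //.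
  rewrite -[symbol u' D]symbol_mod Du ?dvdp_mulr // symbol_mod symbol1r // mulr1.
  by rewrite -[symbol p D]symbol_mod Dp symbol_mod.
have /dvdnP[i jE] := symbol_irreducible pm ip hp.
have j0 : (0 < j)%N.
  rewrite lt0n; apply: contra pu'; move: pu; rewrite uE => + /eqP j0.
  by rewrite j0 mul1r.
have [||v vm vE] := IH u' _ u'm n0 cu'.
- rewrite -ltnS (leq_trans _ su) // uE size_Mmonic ?monic_neq0 ?monic_exp //.
  case: (j) j0 => // j1 _; rewrite exprS size_Mmonic ?expf_neq0 ?monic_exp //.
  have e1 : (0 < size (p ^+ j1)%R)%N by rewrite size_poly_gt0 expf_neq0.
  case: (size (p ^+ j1)) e1 => // i1 _; case: (size p) sp => [|[|i2]] // _.
  by rewrite !(addSn, addnS) /= ltnS leq_addl.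
- move=> d cd; have := hu d cd; have cpd : coprimep d p.
    have := cu d cd; rewrite uE coprimepMr => /andP[+ _].
    by rewrite coprimep_pexpr.
  rewrite uE symbolM ?monic_exp ?symbolX ?coprimep_expr ?cu' // hp //.
  by rewrite mul1r.
exists (p ^+ i * v); first by rewrite monicMl ?monic_exp.
by rewrite uE jE exprMn -vE exprM.
Qed.

End Evaluation.

Lemma ratfunP (Y : ratfun F) : exists a b, b != 0 /\ Y = a%:F / b%:F.
Proof.
elim/quotW: Y => x; have d0 : x.2 != 0 by case: x.
exists x.1, x.2; split=> //; have dF : x.2%:F != 0 by rewrite tofrac_eq0.
apply: (mulIf dF); rewrite divfK //.
rewrite -[LHS]/(FracField.mul _ _) !piE; apply/eqmodP => /=.
by rewrite FracField.equivfE !numden_Ratio ?mulf_neq0 ?oner_eq0 // !mulr1 mulrC.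
Qed.

(** In lowest terms the denominator of Y is prime to its numerator but divides a power of it, so it
    is constant. Constants have (q - 1)-st power 1, so the root may be made monic. *)
Lemma power_poly u (Y : ratfun F) : u \is monic -> u%:F = Y ^+ (q - 1) -> exists2 v, v \is monic & u = v ^+ (q - 1).
Proof.
move=> um uY; have u0 := monic_neq0 um.
have q1 : (0 < q - 1)%N by rewrite subn_gt0 q_gt1.
have [a [b [b0 YE]]] : exists a b, b != 0 /\ Y = a%:F / b%:F.
  exact: ratfunP.
have : u * b ^+ (q - 1) = a ^+ (q - 1).
  apply/eqP; rewrite -tofrac_eq rmorphM !rmorphXn /= uY YE exprMn exprVn divfK //.
  by rewrite expf_neq0 // tofrac_eq0.
move=> h; have g0 : gcdp a b != 0 by rewrite gcdp_eq0 negb_and b0 orbT.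
pose a1 := a %/ gcdp a b; pose b1 := b %/ gcdp a b.
have aE : a = a1 * gcdp a b by rewrite divpK // dvdp_gcdl.
have bE : b = b1 * gcdp a b by rewrite divpK // dvdp_gcdr.
have cab : coprimep b1 a1.
  by rewrite coprimep_sym coprimep_div_gcd // b0 orbT.
have {}h : u * b1 ^+ (q - 1) = a1 ^+ (q - 1).
  have g1 : gcdp a b ^+ (q - 1) != 0 by rewrite expf_neq0.
  by apply: (mulIf g1); rewrite -mulrA -!exprMn -aE -bE.
have b10 : b1 != 0 by apply: contraNneq b0; rewrite bE => ->; rewrite mul0r.
have sb1 : size b1 = 1%N.
  apply/eqP; rewrite -coprimepp.
  have : coprimep b1 (a1 ^+ (q - 1)) by rewrite coprimep_expr.
  by rewrite -h coprimepMr coprimep_pexpr // => /andP[].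
have [be be0 b1E] := size_poly1P _ (introT eqP sb1).
have uE : u = (be^-1 *: a1) ^+ (q - 1).
  rewrite exprZn -h b1E -polyC_exp !unit_exp ?invr_eq0 //.
  by rewrite mulr1 scale1r.
exists (normalize (be^-1 *: a1)).
  apply: normalize_monic; apply: contraNneq u0 => z0.
  by rewrite uE z0 expr0n; case: (q - 1)%N q1.
rewrite /normalize exprZn -uE exprVn unit_exp ?invr1 ?scale1r // lead_coef_eq0.
by apply: contraNneq u0 => z0; rewrite uE z0 expr0n; case: (q - 1)%N q1.
Qed.

End ResidueSymbol.

(** Reduces integer exponents to natural ones modulo an N-th power, which turns a product of
    rational functions into a polynomial. *)
Lemma prod_exprz_split (K : fieldType) (I : eqType) (s : seq I) (x : I -> K) (r : I -> int) (N : nat) :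
  (0 < N)%N -> (forall i, i \in s -> x i != 0) ->
  \prod_(i <- s) x i ^ r i = (\prod_(i <- s) x i ^ (r i %/ N%:Z)%Z) ^+ N *
    \prod_(i <- s) x i ^+ `|(r i %% N%:Z)%Z|.
Proof.
move=> N0 x0; rewrite -prodrXl -big_split /=; apply: eq_big_seq => i /x0 xi.
rewrite {1}(divz_eq (r i) N%:Z) expfzDr // -exprz_exp.
by congr (_ * _); rewrite exprnP gez0_abs // modz_ge0 // eqz_nat -lt0n.
Qed.

Lemma divX_eq (K : fieldType) (x y w : K) (k : nat) :
  x != 0 -> x ^+ k * w = y ^+ k -> w = (y / x) ^+ k.
Proof. by move=> x0 h; rewrite exprMn exprVn -h mulrC mulKf // expf_neq0. Qed.

Section Character.
Variables (F : finFieldType) (E : closedFieldType) (iota : {rmorphism F -> E}).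
Local Notation q := #|F|.
Implicit Types (d m n : {poly F}).

(** Both sides depend on the exponents only modulo q - 1. After reduction they concern a single
    monic polynomial [u], and [power_poly] and [symbol_power] give the two directions. *)
Lemma char_power n (r : {poly F} -> int) : n \is monic ->
  is_power (q - 1) (\prod_(m <- monic_divisors n) m%:F ^ r m) <->
  forall d, coprimep d n -> \prod_(m <- monic_divisors n) symbol m d ^ r m = 1.
Proof.
move=> nm; have n0 := monic_neq0 nm; set s := monic_divisors n.
have q1 : (0 < q - 1)%N by rewrite subn_gt0 q_gt1.
have ms m : m \in s -> m \is monic /\ m %| n by rewrite mem_monic_divisors // => /andP.
pose k m := `|(r m %% (q - 1)%N%:Z)%Z|%N.
pose u := \prod_(m <- s) m ^+ k m.
have um : u \is monic.
  by rewrite /u big_seq; apply: monic_prod => m /ms[? _]; apply: monic_exp.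
have sF m : m \in s -> m%:F != 0 by move=> /ms[mm _]; rewrite tofrac_eq0 monic_neq0.
have := prod_exprz_split r q1 sF; set Y0 := \prod_(_ <- _) _ ^ (_ %/ _)%Z => EF.
have Y00 : Y0 != 0.
  by rewrite prodf_seq_neq0; apply/allP => m /sF h; rewrite /= expfz_neq0.
have uF : \prod_(m <- s) m%:F ^+ k m = u%:F.
  by rewrite /u rmorph_prod; apply: eq_bigr => m _; rewrite rmorphXn.
have cds d m : coprimep d n -> m \in s -> m \is monic /\ coprimep d m.
  by move=> cd /ms[mm mn]; split=> //; apply: coprimep_dvdl cd.
have cdu d : coprimep d n -> coprimep d u.
  move=> cd; rewrite /u big_seq; apply: (big_ind (coprimep d)).
  - exact: coprimep1.
  - by move=> x y hx hy; rewrite coprimepMr hx.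
  - by move=> m /(cds _ _ cd)[_ cm]; apply: coprimep_expr.
have symE d : coprimep d n -> \prod_(m <- s) symbol m d ^ r m = symbol u d.
  move=> cd; have s0 m : m \in s -> symbol m d != 0.
    by move=> /(cds _ _ cd)[? ?]; apply: symbol_neq0.
  rewrite (prod_exprz_split r q1 s0) unit_exp ?mul1r; last first.
    by rewrite prodf_seq_neq0; apply/allP => m /s0 h; rewrite /= expfz_neq0.
  by rewrite symbol_prod // => m; apply: cds.
clearbody Y0; rewrite EF uF; split=> [[y [y0 yE]] d cd|h].
  rewrite symE //; have H := @divX_eq _ _ _ _ _ Y00 yE.
  have [v vm uE] := power_poly um H.
  have cv : coprimep d v by have := cdu d cd; rewrite uE coprimep_pexpr.
  by rewrite uE symbolX // unit_exp // symbol_neq0.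
have [||v vm uE] := symbol_power iota um n0 _ _.
- exact: cdu.
- by move=> d cd; rewrite -symE // h.
have v0 : v%:F != 0 by rewrite tofrac_eq0 monic_neq0.
have uv : u%:F = v%:F ^+ (q - 1) by rewrite uE tofracXn.
exists (Y0 * v%:F); split; first exact: mulf_neq0 Y00 v0.
by rewrite uv -exprMn.
Qed.

End Character.

(** * Action of GL_2(A) and the explicit root *)

Section Moebius.
Variables (F : finFieldType) (R : realType) (C : Cinfty F R).
Local Notation q := #|F|.
Local Notation "`| x |" := (absv x) : ring_scope.
Local Notation sc := (sc C).
Local Notation Aemb := (Aemb C).
Local Notation ez z := (lattice_exp (lattice2 z)).
Implicit Types (x y z : C) (e : R) (a b m n : {poly F}) (g : 'M[{poly F}]_2).

Definition jfac g z : C := Aemb (g 1 0) * z + Aemb (g 1 1).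

Lemma det2 g : \det g = g 0 0 * g 1 1 - g 0 1 * g 1 0.
Proof.
rewrite (expand_det_row _ 0) !big_ord_recl big_ord0 /cofactor !det_mx11 !mxE /=.
have -> : lift (0 : 'I_2) (0 : 'I_1) = 1 by apply/val_inj.
have -> : lift (1 : 'I_2) (0 : 'I_1) = 0 by apply/val_inj.
by rewrite addr0 expr0 expr1 mul1r mulN1r mulrN.
Qed.

Lemma GL2A_inv g : GL2A g -> exists D : {poly F},
  (g 0 0 * g 1 1 - g 0 1 * g 1 0) * D = 1.
Proof.
rewrite /GL2A unitmxE det2 => h.
by exists (g 0 0 * g 1 1 - g 0 1 * g 1 0)^-1; rewrite divrr.
Qed.

Lemma jfac_neq0 g z : GL2A g -> Omega z -> jfac g z != 0.
Proof.
move=> /GL2A_inv[D hD] /OmegaP[e e0 fz]; apply/eqP => h.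
have h2 : Aemb (g 1 0) * z + Aemb (g 1 1) = Aemb 0 * z + Aemb 0.
  by rewrite Aemb0 mul0r addr0.
have [c0 d0] := Az_inj e0 fz h2; move/eqP: hD.
by rewrite c0 d0 !mulr0 subrr mul0r eq_sym oner_eq0.
Qed.

(** The numerator and the denominator of g z form another A-basis of L_z, since the determinant of g
    is a unit. *)
Lemma lattice2_moebius g z : GL2A g -> Omega z ->
  lattice2 (moebius g z) = scale_set (jfac g z)^-1 (lattice2 z).
Proof.
move=> Gg Oz; have j0 := jfac_neq0 Gg Oz; have [D hD] := GL2A_inv Gg.
apply/seteqP; split=> x; rewrite /scale_set /= invrK.
  move=> [a [b ->]]; exists (a * g 0 0 + b * g 1 0), (a * g 0 1 + b * g 1 1).
  rewrite mulrDl -mulrA /moebius -/(jfac g z) divfK // !AembD !AembM /jfac; ring.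
move=> [u [v h]]; pose U := (u * g 1 1 - v * g 1 0) * D.
pose V := (v * g 0 0 - u * g 0 1) * D; exists U, V.
have Eu : u = U * g 0 0 + V * g 1 0 by rewrite -[LHS]mulr1 -hD /U /V; ring.
have Ev : v = U * g 0 1 + V * g 1 1 by rewrite -[LHS]mulr1 -hD /U /V; ring.
apply: (mulIf j0); rewrite h mulrDl -mulrA /moebius -/(jfac g z) divfK // /jfac.
clearbody U V; rewrite Eu Ev !(AembM, AembD); ring.
Qed.

(** The difference of g z and a / b is (A z + B) / (b j), with j the automorphy factor. Inverting g
    recovers b from A and B, so |b| is bounded by a multiple of |A z + B|, and the distance to K
    stays bounded below. *)
Lemma moebius_Omega g z : GL2A g -> Omega z -> Omega (moebius g z).
Proof.
move=> Gg Oz; have j0 := jfac_neq0 Gg Oz; have [D hD] := GL2A_inv Gg.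
have /OmegaP[e e0 fz] := Oz; apply/OmegaP.
pose k := kappa e `|z|; have k0 : 0 < k by apply: kappa_gt0 => //; apply: absv_ge0.
pose G := `|Aemb D| * (`|Aemb (g 1 1)| + `|Aemb (g 1 0)|) + 1.
have G0 : 0 < G by rewrite ltr_wpDl // mulr_ge0 ?addr_ge0 ?absv_ge0.
have j0' : 0 < `|jfac g z| by rewrite abs_gt0.
exists ((k * G * `|jfac g z|)^-1); first by rewrite invr_gt0 !mulr_gt0.
move=> y; have [a [b [b0 ->]]] := ratfunP y.
have b0' : Aemb b != 0 by rewrite Aemb_eq0.
pose A := g 0 0 * b - a * g 1 0; pose B := g 0 1 * b - a * g 1 1.
have E : moebius g z - Kemb C (a%:F / b%:F) = (Aemb A * z + Aemb B) / (Aemb b * jfac g z).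
  rewrite fmorph_div /= -/(Defs.Aemb C a) -/(Defs.Aemb C b) /moebius -/(jfac g z).
  have j1 := j0; rewrite /A /B !(AembB, AembM) /jfac in j1 *; field.
  by rewrite b0' j1.
have [hA hB] := Aemb_kappa A B e0 (absv_ge0 z) fz (lexx _).
set l := Aemb A * z + Aemb B in hA hB E.
have bE : b = D * (A * g 1 1 - B * g 1 0).
  by rewrite -[b in LHS]mulr1 -hD /A /B; ring.
have bl : `|Aemb b| <= G * (k * `|l|).
  rewrite bE AembM absvM; have kl0 : 0 <= k * `|l| by rewrite mulr_ge0 ?absv_ge0 // ltW.
  apply: (@le_trans _ _ (`|Aemb D| * ((`|Aemb (g 1 1)| + `|Aemb (g 1 0)|) * (k * `|l|)))).
    apply: ler_wpM2l; first exact: absv_ge0.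
    rewrite AembB !AembM; apply: absBle; rewrite absvM mulrC.
      apply: ler_pM; rewrite ?absv_ge0 // lerDl; exact: absv_ge0.
    apply: ler_pM; rewrite ?absv_ge0 // lerDr; exact: absv_ge0.
  by rewrite mulrA ler_wpM2r // lerDl.
rewrite E absvM absV absvM ler_pdivlMr; last by rewrite mulr_gt0 ?abs_gt0.
rewrite mulrC ler_pdivrMr; last by rewrite !mulr_gt0.
rewrite [X in _ <= X](_ : _ = G * (k * `|l|) * `|jfac g z|); last by ring.
by rewrite ler_wpM2r // ltW.
Qed.

Lemma ez_moebius g z x : GL2A g -> Omega z ->
  ez (moebius g z) x = (jfac g z)^-1 * ez z (jfac g z * x).
Proof.
move=> Gg Oz; have j0 := jfac_neq0 Gg Oz.
rewrite -(exp_scale _ _ (lattice2_lattice Oz)) ?invr_eq0 //.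
by rewrite lattice2_moebius // mulKf.
Qed.

Lemma Delta_moebius g z : GL2A g -> Omega z ->
  Delta (moebius g z) = jfac g z ^+ (q ^ 2 - 1) * Delta z.
Proof.
move=> Gg Oz; have j0 := jfac_neq0 Gg Oz.
have [_ -> _ _] := Delta_lead (moebius_Omega Gg Oz).
have [sz -> _ _] := Delta_lead Oz.
have lL := lattice2_lattice Oz.
rewrite lattice2_moebius // (drinfeld_scale _ lL (fun x => drinfeld_spec x Oz)) ?invr_eq0 //.
rewrite lead_coef_scale ?invr_eq0 // invrK sz /=; set k := (q ^ 2 - 1)%N.
have -> : (q ^ 2 = k.+1)%N by rewrite /k subn1 prednK // expn_gt0 q_gt0.
by rewrite exprS mulrCA mulKf // mulrC.
Qed.

Lemma Eprod_moebius g z m : GL2A g -> Omega z ->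
  Eprod m (moebius g z) = (jfac g z)^-1 ^+ size (mons F (size m).-1) *
    \prod_(b <- mons F (size m).-1) ez z (jfac g z * (Aemb b / Aemb m)).
Proof.
move=> Gg Oz; rewrite /Eprod; under eq_bigr do rewrite ez_moebius //.
by rewrite big_split /= big_const_seq count_predT iter_mulr_1.
Qed.

Lemma Eprod_moebius_neq0 g z m : m != 0 -> GL2A g -> Omega z ->
  \prod_(b <- mons F (size m).-1) ez z (jfac g z * (Aemb b / Aemb m)) != 0.
Proof.
move=> m0 Gg Oz; have j0 := jfac_neq0 Gg Oz; rewrite prodf_seq_neq0; apply/allP => b bm /=.
have := Eprod_neq0 m0 (moebius_Omega Gg Oz) bm; rewrite ez_moebius // mulf_eq0.
by rewrite negb_or => /andP[].
Qed.

(** As m divides c = g 1 0, the point (c z + d) b / m differs from b d / m by an element of L_z. The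
    factor thus acts on the m-torsion through multiplication by d, to which [symbol_perm]
    applies. *)
Lemma Eprod_Gamma0 g z m : GL2A g -> Omega z -> m \is monic -> m %| g 1 0 ->
  \prod_(b <- mons F (size m).-1) ez z (jfac g z * (Aemb b / Aemb m)) =
  sc (symbol m (g 1 1)) * Eprod m z.
Proof.
move=> Gg Oz mm /dvdpP[c cE]; have lL := lattice2_lattice Oz.
have m0 := monic_neq0 mm; have m0' : Aemb m != 0 by rewrite Aemb_eq0.
have cd : coprimep (g 1 1) m.
  have [D hD] := GL2A_inv Gg; apply/Bezout_eq1_coprimepP.
  exists (g 0 0 * D, - (g 0 1 * D * c)) => /=; rewrite -hD cE; ring.
pose psi b := ez z (Aemb b / Aemb m).
rewrite -(symbol_perm (iota := sc) (psi := psi)) //.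
- apply: eq_bigr => b _; rewrite /psi.
  have -> : jfac g z * (Aemb b / Aemb m) =
     Aemb (b * g 1 1) / Aemb m + (Aemb (b * c) * z + Aemb 0).
    by rewrite /jfac cE Aemb0 addr0 !AembM; field.
  by rewrite exp_periodic //; exists (b * c), 0.
- by move=> k b; rewrite /psi -mul_polyC AembM -mulrA exp_Z.
- move=> b; rewrite /psi {2}(divp_eq b m) AembD AembM mulrDl mulfK // addrC.
  rewrite exp_periodic //; exists 0, (b %/ m); by rewrite Aemb0 mul0r add0r.
Qed.

Lemma symbol_level m d : m \is monic -> coprimep d m -> symbol m d ^+ level F = 1.
Proof.
by move=> mm cd; rewrite /level exprM unit_exp ?expr1n // symbol_neq0.
Qed.

Lemma level_gt0 : (0 < level F)%N.
Proof.
rewrite muln_gt0 !subn_gt0 q_gt1 /= -[1%N](exp1n 2) ltn_exp2r //; exact: q_gt1.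
Qed.

Lemma size_mons_pnorm m : ((q - 1) * size (mons F (size m).-1) = pnorm m - 1)%N.
Proof. exact: size_mons. Qed.

Lemma pnorm_gt0 m : (0 < pnorm m)%N.
Proof. by rewrite expn_gt0 q_gt0. Qed.

Section Quotient.
Variables (n : {poly F}) (nm : n \is monic) (r : {poly F} -> int).
Local Notation s := (monic_divisors n).

Lemma divisorP m : m \in s -> m \is monic /\ m %| n.
Proof. by rewrite mem_monic_divisors ?monic_neq0 // => /andP. Qed.

Definition Eall z : C := \prod_(m <- s) Eprod m z ^ r m.

Definition divnorm : int := \sum_(m <- s) r m * (pnorm m)%:Z.

Definition divval : C := \prod_(m <- s) Aemb m ^ r m.

Lemma prod_expz (I : Type) (t : seq I) (x : C) (k : I -> int) : x != 0 ->
  \prod_(i <- t) x ^ k i = x ^ (\sum_(i <- t) k i).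
Proof. by move=> x0; rewrite (big_morph (fun k => x ^ k) (fun i j : int => expfzDr i j x0) (expr0z x)). Qed.

Lemma exprz_nat_comm (x : C) (k : nat) (j : int) : (x ^+ k) ^ j = (x ^ j) ^+ k.
Proof. by rewrite !exprnP !exprz_exp mulrC. Qed.

Lemma Delta_quotientE z : Omega z ->
  Delta_quotient n r z = divval ^- (q ^ 2 - 1) * Delta z ^ divnorm * Eall z ^+ level F.
Proof.
move=> Oz; have [_ _ _ D0] := Delta_lead Oz.
rewrite /Delta_quotient /divval /Eall /divnorm -exprVn -!prodrXl -prodfV.
rewrite -prodrXl -(prod_expz _ _ D0) -!big_split /=; apply: eq_big_seq => m ms.
have [mm _] := divisorP ms; rewrite Delta_mul ?monic_neq0 // !expfzMl.
congr (_ * _ * _); last exact: exprz_nat_comm.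
  by rewrite -exprVn exprz_nat_comm exprz_inv -invr_expz.
by rewrite [_ * _%:Z]mulrC -exprz_exp.
Qed.

Lemma Delta_quotient_neq0 z : Omega z -> Delta_quotient n r z != 0.
Proof.
move=> Oz; rewrite prodf_seq_neq0; apply/allP => m /divisorP[mm _] /=.
have [_ _ _ D0] := Delta_lead (Omega_mul (monic_neq0 mm) Oz).
by rewrite expfz_neq0.
Qed.

Lemma Delta_quotient_Gamma0 g z : Gamma0 n g -> Omega z ->
  Delta_quotient n r (moebius g z) =
  jfac g z ^ ((q ^ 2 - 1)%N%:Z * \sum_(m <- s) r m) * Delta_quotient n r z.
Proof.
move=> [Gg ng] Oz; have j0 := jfac_neq0 Gg Oz.
rewrite mulr_sumr -prod_expz // -big_split /=; apply: eq_big_seq => m ms.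
have [mm mn] := divisorP ms; have m0 := monic_neq0 mm.
rewrite -exprz_exp -expfzMl; congr (_ ^ _).
rewrite (Delta_mul m0 (moebius_Omega Gg Oz)) (Delta_mul m0 Oz) Delta_moebius //.
have mg : m %| g 1 0 := dvdp_trans mn ng.
rewrite Eprod_moebius // Eprod_Gamma0 //.
have cd : coprimep (g 1 1) m.
  move: mg => /dvdpP[c cE]; have [D hD] := GL2A_inv Gg; apply/Bezout_eq1_coprimepP.
  exists (g 0 0 * D, - (g 0 1 * D * c)) => /=; rewrite -hD cE; ring.
have sE : sc (symbol m (g 1 1)) ^+ level F = 1 by rewrite -rmorphXn symbol_level // rmorph1.
rewrite !exprMn sE mul1r -!exprM exprVn.
(* The power |m| of [Delta] carries (q^2 - 1) |m| automorphy factors and the N-th power of [Eprod]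
   takes back (q^2 - 1) (|m| - 1), which leaves weight q^2 - 1. *)
have -> : (size (mons F (size m).-1) * level F = (q ^ 2 - 1) * (pnorm m - 1))%N.
  by rewrite /level mulnA [(size _ * _)%N]mulnC size_mons_pnorm mulnC.
rewrite -{1}(subnK (pnorm_gt0 m)) mulnDr muln1 exprD -exprnP.
have J0 : jfac g z ^+ ((q ^ 2 - 1) * (pnorm m - 1)) != 0 by rewrite expf_neq0.
by field; rewrite J0 expf_neq0 // Aemb_eq0.
Qed.

Variables (ka : C) (K : int).
Definition rootfun z : C := ka * Delta z ^ K * Eall z.

Lemma rootfun_exp z : Omega z -> divnorm = (level F)%:Z * K ->
  ka ^+ level F = divval ^- (q ^ 2 - 1) ->
  rootfun z ^+ level F = Delta_quotient n r z.
Proof.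
move=> Oz dn hk; rewrite Delta_quotientE // dn -hk /rootfun !exprMn.
by rewrite -exprz_exp -exprnP exprz_nat_comm.
Qed.

(** The function [rootfun] composed with g, after the powers of the automorphy factor have
    cancelled; this is what is expanded at the cusp g oo. *)
Definition cuspfun g z : C := ka * Delta z ^ K *
  \prod_(m <- s) (\prod_(b <- mons F (size m).-1) ez z (jfac g z * (Aemb b / Aemb m))) ^ r m.

Lemma rootfun_moebius g z : GL2A g -> Omega z -> divnorm = (level F)%:Z * K ->
  \sum_(m <- s) r m = 0 -> rootfun (moebius g z) = cuspfun g z.
Proof.
move=> Gg Oz dn r0; have j0 := jfac_neq0 Gg Oz.
rewrite /rootfun /cuspfun Delta_moebius // /Eall.
under eq_bigr do rewrite Eprod_moebius // expfzMl.
rewrite big_split /= expfzMl.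
have -> : \prod_(m <- s) ((jfac g z)^-1 ^+ size (mons F (size m).-1)) ^ r m =
   jfac g z ^ (- \sum_(m <- s) (size (mons F (size m).-1))%:Z * r m).
  rewrite -sumrN -prod_expz //; apply: eq_bigr => m _.
  by rewrite -mulNr -exprz_exp -exprnN exprVn.
(* Multiplied by q - 1, each count of monic polynomials becomes |m| - 1. The terms -1 drop out since
   the r_m sum to 0, and [divnorm] = N K remains. *)
have E : \sum_(m <- s) (size (mons F (size m).-1))%:Z * r m = (q ^ 2 - 1)%N%:Z * K.
  have q1 : (q - 1)%N%:Z != 0 by rewrite eqz_nat -lt0n subn_gt0 q_gt1.
  apply: (mulfI q1); rewrite mulr_sumr mulrA -PoszM -/(level F) -dn /divnorm.
  transitivity (\sum_(m <- s) (r m * (pnorm m)%:Z - r m)); last by rewrite sumrB r0 subr0.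
  apply: eq_bigr => m _.
  rewrite mulrA -PoszM size_mons_pnorm -subzn ?pnorm_gt0 // mulrBl mul1r mulrC.
  by [].
rewrite E exprz_nat_comm; set k := (q ^ 2 - 1)%N.
have -> : (jfac g z ^ K) ^+ k = (jfac g z ^ (- (k%:Z * K)))^-1.
  by rewrite invr_expz opprK mulrC -exprz_exp.
set A := jfac g z ^ (- _); set P := \prod_(_ <- _) _.
have A0 : A != 0 by rewrite expfz_neq0.
by field.
Qed.

Lemma rootfun_Gamma0 g z : Gamma0 n g -> Omega z -> divnorm = (level F)%:Z * K ->
  \sum_(m <- s) r m = 0 ->
  rootfun (moebius g z) = sc (\prod_(m <- s) symbol m (g 1 1) ^ r m) * rootfun z.
Proof.
move=> [Gg ng] Oz dn r0; rewrite rootfun_moebius // /cuspfun /rootfun /Eall.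
have -> : \prod_(m <- s) (\prod_(b <- mons F (size m).-1)
    ez z (jfac g z * (Aemb b / Aemb m))) ^ r m =
  sc (\prod_(m <- s) symbol m (g 1 1) ^ r m) * \prod_(m <- s) Eprod m z ^ r m.
  rewrite rmorph_prod -big_split /=; apply: eq_big_seq => m ms.
  have [mm mn] := divisorP ms.
  by rewrite Eprod_Gamma0 ?(dvdp_trans mn) // expfzMl fmorphXz.
by rewrite mulrCA.
Qed.

End Quotient.
End Moebius.

(** * Elements algebraic over the constants *)

Section Teichmueller.
Variables (F : finFieldType) (R : realType) (C : Cinfty F R).
Local Notation q := #|F|.
Local Notation "`| x |" := (absv x) : ring_scope.
Local Notation sc := (sc C).
Local Notation Aemb := (Aemb C).
Implicit Types (x y z : C) (e : R).

Lemma q_pchar : exists p, [/\ prime p, p \in [pchar F], (p %| q)%N & p.-nat q].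
Proof.
have [p pr chF] := finPcharP F; exists p.
have [k qE] : exists k, q = (p ^ k)%N by eexists; apply: (card_pprimeChar chF).
split=> //; rewrite qE ?pnatX ?pnat_id //.
have := q_gt1 F; rewrite qE; case: k {qE} => // k _.
by rewrite expnS dvdn_mulr.
Qed.

Lemma pchar_sc p : p \in [pchar F] -> p \in [pchar C].
Proof. by rewrite -(fmorph_pchar sc). Qed.

Lemma frobD x y j : (x + y) ^+ (q ^ j) = x ^+ (q ^ j) + y ^+ (q ^ j).
Proof.
have [p [pr chF _ pq]] := q_pchar; apply: exprDn_pchar; rewrite pnatX.
by rewrite (eq_pnat _ (pcharf_eq (pchar_sc chF))) pq.
Qed.

Lemma frobB x y j : (x - y) ^+ (q ^ j) = x ^+ (q ^ j) - y ^+ (q ^ j).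
Proof. by apply/eqP; rewrite eq_sym subr_eq -frobD subrK. Qed.

(* The elements of C algebraic over F *)
Definition teich x := exists2 j, (0 < j)%N & x ^+ (q ^ j) = x.

Lemma teich_iter x j i : x ^+ (q ^ j) = x -> x ^+ (q ^ (j * i)) = x.
Proof.
by move=> h; elim: i => [|i IH]; rewrite ?muln0 ?expn0 ?expr1 // mulnS expnD exprM h.
Qed.

(** The difference is fixed by a common power of Frobenius, hence is zero or a root of unity. *)
Lemma teich_dist x y : teich x -> teich y -> x != y -> `|x - y| = 1.
Proof.
move=> [j j0 hx] [k k0 hy] xy; set d := x - y.
have hd : d ^+ (q ^ (j * k)) = d.
  by rewrite frobB (teich_iter _ hx) mulnC (teich_iter _ hy).
have d0 : d != 0 by rewrite subr_eq0.
have q1 : (1 < q ^ (j * k))%N.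
  by rewrite -[1%N](exp1n (j * k)) ltn_exp2r ?q_gt1 // muln_gt0 j0.
have : `|d| ^+ (q ^ (j * k)).-1 = 1.
  rewrite -absX; have -> : d ^+ (q ^ (j * k)).-1 = 1; last exact: abs1.
  by apply: (mulfI d0); rewrite -exprS prednK ?hd ?mulr1 // ltnW.
move=> /eqP; rewrite pexpr_eq1 ?absv_ge0 //; last by rewrite -ltnS prednK // ltnW.
by move/eqP.
Qed.

Lemma teich_sc c : teich (sc c).
Proof. by exists 1%N; rewrite // expn1 -rmorphXn expf_card. Qed.

Lemma teich_abs x : teich x -> x != 0 -> `|x| = 1.
Proof.
move=> tx x0; rewrite -[x]subr0; apply: teich_dist => //.
by rewrite -(rmorph0 sc); apply: teich_sc.
Qed.

Lemma teich_roots j : (0 < j)%N -> exists r : seq C,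
  [/\ uniq r, size r = (q ^ j)%N & forall x, x \in r -> x ^+ (q ^ j) = x].
Proof.
move=> j0; pose P : {poly C} := 'X^(q ^ j) - 'X.
have q1 : (1 < q ^ j)%N by rewrite -[1%N](exp1n j) ltn_exp2r ?q_gt1.
have sP : size P = (q ^ j).+1.
  by rewrite size_polyDl size_polyXn // size_polyN size_polyX ltnS.
have P1 : lead_coef P = 1.
  by rewrite lead_coefDl ?lead_coefXn // size_polyXn size_polyN size_polyX.
have [r Pr] := closed_field_poly_normal P; rewrite P1 scale1r in Pr.
have qC : (q ^ j)%N%:R = 0 :> C.
  have [p [pr chF pq _]] := q_pchar; case: (j) j0 => // i _; rewrite expnS.
  by rewrite !natrM -(divnK pq) natrM (pcharf0 (pchar_sc chF)) mulr0 mul0r.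
have uP : separable_poly P.
  rewrite unlock /P derivB derivXn derivX -mulr_natl -polyC_natr qC mul0r sub0r.
  have -> : (-1 : {poly C}) = (-1) *: 1 by rewrite scaleN1r.
  by rewrite coprimepZr ?oppr_eq0 ?oner_eq0 // coprimep1.
exists r; split.
- by move: uP; rewrite Pr separable_prod_XsubC.
- by apply/eqP; rewrite -eqSS -sP Pr size_prod_XsubC.
- move=> x xr; have : root P x by rewrite Pr root_prod_XsubC.
  by rewrite /root !hornerE subr_eq0 => /eqP.
Qed.

Lemma uniq_ex_notin (r s : seq C) : uniq r -> (size s < size r)%N ->
  exists2 x, x \in r & x \notin s.
Proof.
move=> ur; rewrite ltnNge => h; apply: contrapT => h2; move/negP: h; apply.
apply: uniq_leq_size => // x xr; apply: contraT => xs; case: h2; by exists x.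
Qed.

Lemma teich_generic (s : seq C) : exists2 x, teich x & x \notin s.
Proof.
have [r [ur sr hr]] := teich_roots (ltn0Sn (size s)).
have [|x xr xs] := uniq_ex_notin (s := s) ur.
  by rewrite sr (leq_trans (ltn_expl _ (q_gt1 F))) // leq_exp2l ?q_gt1.
by exists x => //; exists (size s).+1 => //; apply: hr.
Qed.

(** The residue field of K at infinity is F: in a = Q b + r the quotient Q is constant and |r / b| <
    1. *)
Lemma Kemb_residue (k : ratfun F) : `|Kemb C k| <= 1 -> exists c, `|Kemb C k - sc c| < 1.
Proof.
have [a [b [b0 ->]]] := ratfunP k; rewrite fmorph_div /= -/(Defs.Aemb C a) -/(Defs.Aemb C b).
have b0' : Aemb b != 0 by rewrite Aemb_eq0.
rewrite absvM absV ler_pdivrMr ?abs_gt0 // mul1r => ab.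
have sab : (size a <= size b)%N.
  have [->|a0] := eqVneq a 0; first by rewrite size_poly0.
  move: ab; rewrite !abs_Aemb // ler_eXn2l ?qR_gt1 //.
  by rewrite -ltnS !prednK ?size_poly_gt0.
have sQ : (size (a %/ b)%R <= 1)%N.
  by rewrite size_divp // leq_subLR addn1 prednK // size_poly_gt0.
exists (a %/ b)`_0; rewrite {1}(divp_eq a b) AembD AembM mulrDl mulfK // {1}(size1_polyC sQ).
rewrite addrC addrA addNr add0r absvM absV ltr_pdivrMr ?abs_gt0 // mul1r.
rewrite (abs_Aemb _ b0); apply: abs_size_lt; exact: size_modp_pred.
Qed.

(** An element of K at distance less than 1 from x would reduce to a constant c, and then |x - c| <
    1 contradicts [teich_dist]. *)
Lemma teich_far x : teich x -> (forall c, x != sc c) -> far 1 x.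
Proof.
move=> tx xc k; rewrite leNgt; apply/negP => h.
have x0 : x != 0 by have := xc 0; rewrite rmorph0.
have x1 := teich_abs tx x0.
have k1 : `|Kemb C k| <= 1.
  by rewrite -(subKr x (Kemb C k)) absBle ?x1 // ltW.
have [c hc] := Kemb_residue k1.
have := absDlt h hc; rewrite addrA subrK (teich_dist tx (teich_sc c)) // ltxx //.
Qed.

(** A generator of F_(q^2) over F, the base point of Omega used throughout: X^(q^2) - X has q^2
    distinct roots, more than the q constants. *)
Lemma quadratic_ex : exists w : C,
  [/\ w ^+ (q ^ 2) = w, forall c, w != sc c, `|w| = 1 & far 1 w].
Proof.
have [r [ur sr hr]] := teich_roots (ltn0Sn 1).
have [|w wr ws] := uniq_ex_notin (s := [seq sc c | c : F]) ur.
  by rewrite size_map -cardE sr -[X in (X < _)%N]expn1 ltn_exp2l ?q_gt1.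
have tw : teich w by exists 2%N => //; apply: hr.
have wc c : w != sc c.
  by apply: contraNneq ws => ->; apply/mapP; exists c; rewrite ?mem_enum.
have w0 : w != 0 by have := wc 0; rewrite rmorph0.
by exists w; split=> //; [apply: hr | apply: teich_abs | apply: teich_far].
Qed.

Lemma Omega_aff_nonempty m : exists z : C, Omega_aff m z.
Proof.
have [w [_ _ w1 fw]] := quadratic_ex; exists w; apply/Omega_aff_far.
have q1 : 1 <= q%:R ^+ m :> R by rewrite exprn_ege1 // ltW // qR_gt1.
rewrite w1; split=> // k; apply: le_trans (fw k).
by rewrite invf_le1 // (lt_le_trans ltr01).
Qed.

End Teichmueller.

(** * Holomorphic functions on the affinoids of Omega *)

Section Holomorphic.
Variables (F : finFieldType) (R : realType) (C : Cinfty F R).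
Local Notation q := #|F|.
Local Notation "`| x |" := (absv x) : ring_scope.
Local Notation sc := (sc C).
Local Notation Aemb := (Aemb C).
Local Notation T := (Aemb 'X).
Local Notation ez z := (lattice_exp (lattice2 z)).
Variable M : nat.
Local Notation X := (@Omega_aff F R C M).
Implicit Types (x y z : C) (e : R) (f g : C -> C).

Definition ratX f := exists p s : {poly C}, forall z, X z -> s.[z] != 0 /\ f z = p.[z] / s.[z].

Lemma rat_ext f g : (forall z, X z -> f z = g z) -> ratX f -> ratX g.
Proof. by move=> fg [p [s h]]; exists p, s => z Xz; have [h1 <-] := h z Xz; rewrite fg. Qed.

Lemma rat_cst c : ratX (fun=> c).
Proof. by exists c%:P, 1 => z _; rewrite !hornerC oner_eq0 divr1. Qed.

Lemma rat_id : ratX id.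
Proof. by exists 'X, 1 => z _; rewrite hornerX hornerC oner_eq0 divr1. Qed.

Lemma rat_mul f g : ratX f -> ratX g -> ratX (fun z => f z * g z).
Proof.
move=> [p [s h]] [p' [s' h']]; exists (p * p'), (s * s') => z Xz.
have [s0 ->] := h z Xz; have [s0' ->] := h' z Xz.
by rewrite !hornerM mulf_neq0 // mulf_div.
Qed.

Lemma rat_add f g : ratX f -> ratX g -> ratX (fun z => f z + g z).
Proof.
move=> [p [s h]] [p' [s' h']]; exists (p * s' + p' * s), (s * s') => z Xz.
have [s0 ->] := h z Xz; have [s0' ->] := h' z Xz.
by rewrite hornerD !hornerM mulf_neq0 // addf_div.
Qed.

Lemma rat_opp f : ratX f -> ratX (fun z => - f z).
Proof.
move=> h; apply: rat_ext (rat_mul (rat_cst (-1)) h) => z _; by rewrite mulN1r.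
Qed.

Lemma rat_inv f : ratX f -> (forall z, X z -> f z != 0) -> ratX (fun z => (f z)^-1).
Proof.
move=> [p [s h]] f0; exists s, p => z Xz; have [s0 fE] := h z Xz.
by have := f0 z Xz; rewrite fE mulf_eq0 invr_eq0 (negPf s0) orbF invf_div.
Qed.

Lemma rat_prod (I : eqType) (r : seq I) (P : pred I) (f : I -> C -> C) :
  (forall i, i \in r -> P i -> ratX (f i)) -> ratX (fun z => \prod_(i <- r | P i) f i z).
Proof.
elim: r => [|i r IH] h.
  by apply: rat_ext (rat_cst 1) => z _; rewrite big_nil.
have {}IH : ratX (fun z => \prod_(i <- r | P i) f i z).
  by apply: IH => j jr; apply: h; rewrite inE jr orbT.
case Pi : (P i); last by apply: rat_ext IH => z _; rewrite big_cons Pi.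
apply: rat_ext (rat_mul (h i (mem_head _ _) Pi) IH) => z _; by rewrite big_cons Pi.
Qed.

Lemma qM_gt0 : 0 < q%:R ^+ M :> R. Proof. by rewrite exprn_gt0 ?qR_gt0. Qed.

Lemma poly_bounded (p : {poly C}) (r : R) : exists2 B, 0 <= B &
  forall z, `|z| <= r -> `|p.[z]| <= B.
Proof.
elim/poly_ind: p => [|p c [B B0 IH]]; first by exists 0 => // z _; rewrite horner0 abs0.
exists (Num.max (B * Num.max r 0) `|c|).
  by rewrite le_max absv_ge0 orbT.
move=> z zr; rewrite !hornerE; apply: absDle; last by rewrite le_max lexx orbT.
rewrite le_max absvM ler_pM ?absv_ge0 ?IH // le_max zr //.
Qed.

(** A point outside the affinoid is either too large, so that |z - b| = |b|, or closer to K than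
    q^-M while z is not. *)
Lemma dist_pole b z : ~ X b -> X z -> q%:R ^- M <= `|z - b|.
Proof.
move=> Xb /Omega_aff_far[zM fz]; have [bM|bM] := leP `|b| (q%:R ^+ M); last first.
  rewrite absB absB_dom ?(le_lt_trans zM) // (le_trans _ (ltW bM)) //.
  apply: (@le_trans _ _ 1); first by rewrite invf_le1 ?qM_gt0 // exprn_ege1 // ltW // qR_gt1.
  by rewrite exprn_ege1 // ltW // qR_gt1.
have [k hk] : exists k, `|b - Kemb C k| < q%:R ^- M.
  apply: contrapT => h; apply: Xb; apply/Omega_aff_far; split=> // k.
  by rewrite leNgt; apply/negP => h2; apply: h; exists k.
have -> : z - b = (z - Kemb C k) - (b - Kemb C k) by ring.
by rewrite absB_dom // (lt_le_trans hk).
Qed.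

(** Over the algebraically closed field the denominator splits into linear factors, each bounded
    below by [dist_pole]. *)
Lemma rat_bounded f : ratX f -> exists2 B, 0 < B & forall z, X z -> `|f z| <= B.
Proof.
move=> [p [s h]]; have [s0|s0] := eqVneq s 0.
  by exists 1 => // z /h[]; rewrite s0 horner0 eqxx.
have [r sE] := closed_field_poly_normal s.
have [B B0 hB] := poly_bounded p (q%:R ^+ M).
pose d := `|lead_coef s| * (q%:R ^- M) ^+ size r.
have d0 : 0 < d by rewrite mulr_gt0 ?abs_gt0 ?lead_coef_eq0 // exprn_gt0 // invr_gt0 qM_gt0.
exists (B / d + 1); first by rewrite ltr_wpDl // divr_ge0 // ltW.
move=> z Xz; have [sz ->] := h z Xz; apply: (@le_trans _ _ (B / d)); last by rewrite lerDl.
have /Omega_aff_far[zM _] := Xz.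
rewrite absvM absV ler_pM ?invr_ge0 ?absv_ge0 ?hB // lef_pV2 ?posrE ?abs_gt0 //.
rewrite /d [X in X.[z]]sE hornerZ absvM ler_wpM2l ?absv_ge0 // horner_prod abs_prod.
have : forall b, b \in r -> ~ X b.
  move=> b br /h[]; rewrite {1}sE hornerZ horner_prod mulf_eq0 prodf_seq_eq0.
  move=> /norP[_ /hasPn/(_ b br)]; by rewrite /= hornerXsubC subrr eqxx.
elim: (r) => [|b r' IH] hr; first by rewrite big_nil expr0.
have qm0 : 0 <= q%:R ^- M :> R by rewrite invr_ge0 ltW // qM_gt0.
rewrite big_cons exprS hornerXsubC; apply: ler_pM => //; first exact: exprn_ge0.
  by apply: dist_pole => //; apply: hr; rewrite mem_head.
by apply: IH => c cr; apply: hr; rewrite inE cr orbT.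
Qed.

Local Notation hol := (holomorphic_on X).

Lemma holP f : hol f <-> forall e, 0 < e -> exists2 g, ratX g & forall z, X z -> `|f z - g z| < e.
Proof.
split=> h e e0.
  have [p [s hs]] := h e e0; exists (fun z => p.[z] / s.[z]).
    by exists p, s => z /hs[].
  by move=> z /hs[].
have [g [p [s hg]] hf] := h e e0; exists p, s => z Xz.
by have [s0 <-] := hg z Xz; split=> //; apply: hf.
Qed.

Lemma hol_ext f g : (forall z, X z -> f z = g z) -> hol f -> hol g.
Proof.
by move=> fg hf e e0; have [p [s h]] := hf e e0; exists p, s => z Xz; have [? ?] := h z Xz; rewrite -fg.
Qed.

Lemma rat_hol f : ratX f -> hol f.
Proof. by move=> h; apply/holP => e e0; exists f => // z _; rewrite subrr abs0. Qed.

Lemma hol_bounded f : hol f -> exists2 B, 0 < B & forall z, X z -> `|f z| <= B.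
Proof.
move=> /holP /(_ 1 ltr01)[g rg hg]; have [B B0 hB] := rat_bounded rg.
exists (B + 1); first by rewrite addr_gt0.
move=> z Xz; rewrite -(subrK (g z) (f z)) absDle //.
  by rewrite (le_trans (ltW (hg z Xz))) // lerDr ltW.
by rewrite (le_trans (hB z Xz)) // lerDl.
Qed.

Lemma hol_mul f g : hol f -> hol g -> hol (fun z => f z * g z).
Proof.
move=> hf hg; have [B B0 hB] := hol_bounded hf.
move/holP: hg => hg; move/holP: hf => hf; apply/holP => e e0.
have [g1 rg1 hg1] := hg (e / B) (divr_gt0 e0 B0).
have [B1 B10 hB1] := rat_bounded rg1.
have [f1 rf1 hf1] := hf (e / B1) (divr_gt0 e0 B10).
exists (fun z => f1 z * g1 z); first exact: rat_mul.
move=> z Xz; have -> : f z * g z - f1 z * g1 z = f z * (g z - g1 z) + g1 z * (f z - f1 z) by ring.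
apply: absDlt; rewrite absvM.
  rewrite (le_lt_trans (ler_wpM2r _ (hB z Xz))) ?absv_ge0 // mulrC -ltr_pdivlMr //.
  exact: hg1.
rewrite (le_lt_trans (ler_wpM2r _ (hB1 z Xz))) ?absv_ge0 // mulrC -ltr_pdivlMr //.
exact: hf1.
Qed.

Lemma hol_add f g : hol f -> hol g -> hol (fun z => f z + g z).
Proof.
move=> /holP hf /holP hg; apply/holP => e e0.
have [f1 rf1 hf1] := hf e e0; have [g1 rg1 hg1] := hg e e0.
exists (fun z => f1 z + g1 z); first exact: rat_add.
by move=> z Xz; rewrite opprD addrACA absDlt ?hf1 ?hg1.
Qed.

Lemma hol_cst c : hol (fun=> c). Proof. exact: rat_hol (rat_cst c). Qed.

Lemma hol_prod (I : eqType) (r : seq I) (P : pred I) (f : I -> C -> C) :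
  (forall i, i \in r -> P i -> hol (f i)) -> hol (fun z => \prod_(i <- r | P i) f i z).
Proof.
elim: r => [|i r IH] h.
  by apply: hol_ext (hol_cst 1) => z _; rewrite big_nil.
have {}IH : hol (fun z => \prod_(i <- r | P i) f i z).
  by apply: IH => j jr; apply: h; rewrite inE jr orbT.
case Pi : (P i); last by apply: hol_ext IH => z _; rewrite big_cons Pi.
apply: hol_ext (hol_mul (h i (mem_head _ _) Pi) IH) => z _; by rewrite big_cons Pi.
Qed.

(** Holomorphy of the inverse is carried along so that negative integer powers stay in the class. *)
Definition hol_unit f := hol f /\ hol (fun z => (f z)^-1).

Lemma holu_ext f g : (forall z, X z -> f z = g z) -> hol_unit f -> hol_unit g.
Proof.
by move=> fg [h1 h2]; split; [apply: hol_ext h1 | apply: hol_ext h2 => z /fg ->].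
Qed.

Lemma holu_inv f : hol_unit f -> hol_unit (fun z => (f z)^-1).
Proof. by move=> [h1 h2]; split=> //; apply: hol_ext h1 => z _; rewrite invrK. Qed.

Lemma holu_mul f g : hol_unit f -> hol_unit g -> hol_unit (fun z => f z * g z).
Proof.
move=> [h1 h2] [h3 h4]; split; first exact: hol_mul.
by apply: hol_ext (hol_mul h2 h4) => z _; rewrite invfM.
Qed.

Lemma holu_cst c : hol_unit (fun=> c).
Proof. by split; apply: hol_cst. Qed.

Lemma holu_prod (I : eqType) (r : seq I) (P : pred I) (f : I -> C -> C) :
  (forall i, i \in r -> P i -> hol_unit (f i)) ->
  hol_unit (fun z => \prod_(i <- r | P i) f i z).
Proof.
move=> h; split; first by apply: hol_prod => i ir Pi; case: (h i ir Pi).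
apply: (@hol_ext (fun z => \prod_(i <- r | P i) (f i z)^-1)).
  by move=> z _; rewrite prodfV.
by apply: hol_prod => i ir Pi; case: (h i ir Pi).
Qed.

Lemma holu_expn f (k : nat) : hol_unit f -> hol_unit (fun z => f z ^+ k).
Proof.
move=> h; apply: holu_ext (holu_prod (r := iota 0 k) (P := xpredT) (f := fun=> f) _) => //.
by move=> z _; rewrite big_const_seq count_predT size_iota iter_mulr_1.
Qed.

Lemma holu_expz f (k : int) : hol_unit f -> hol_unit (fun z => f z ^ k).
Proof.
case: k => k h; first exact: holu_expn.
by apply: holu_ext (holu_inv (holu_expn k.+1 h)) => z _; rewrite NegzE -exprnN.
Qed.

Definition pairs d := [seq (a, b) | a <- pols F d, b <- pols F d].

Lemma prod_pts z d (G : C -> C) : Omega z ->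
  \prod_(l <- pts z d | l != 0) G l =
  \prod_(p <- pairs d | p != (0, 0)) G (Aemb p.1 * z + Aemb p.2).
Proof.
move=> /OmegaP[e e0 fz].
have -> : pts z d = [seq Aemb p.1 * z + Aemb p.2 | p <- pairs d].
  by rewrite /pts /pairs map_allpairs.
rewrite big_map; apply: eq_bigl => -[a b] /=; congr negb.
apply/eqP/eqP => [h|[-> ->]]; last by rewrite Aemb0 mul0r addr0.
have h2 : Aemb a * z + Aemb b = Aemb 0 * z + Aemb 0 by rewrite Aemb0 mul0r addr0.
by have [-> ->] := Az_inj e0 fz h2.
Qed.

Lemma lin_neq0 z a b : Omega z -> (a, b) != (0, 0) -> Aemb a * z + Aemb b != 0.
Proof.
move=> /OmegaP[e e0 fz]; apply: contraNneq => h.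
have h2 : Aemb a * z + Aemb b = Aemb 0 * z + Aemb 0 by rewrite Aemb0 mul0r addr0.
by have [-> ->] := Az_inj e0 fz h2.
Qed.

Lemma rat_lin a b : ratX (fun z => Aemb a * z + Aemb b).
Proof. by apply: rat_add; [apply: rat_mul; [apply: rat_cst | apply: rat_id] | apply: rat_cst]. Qed.

(** The truncated products over [pts z d] are rational in z without poles on the affinoid, and
    [exp_approx] bounds their relative error uniformly there, because [kappa] is uniform. *)
Lemma holu_exp (x : C -> C) : ratX x -> (forall z, X z -> ~ lattice2 z (x z)) ->
  hol_unit (fun z => ez z (x z)).
Proof.
move=> rx xL; have [Bx Bx0 hBx] := rat_bounded rx.
pose e := (q%:R ^- M : R); pose B := (q%:R ^+ M : R).
have e0 : 0 < e by rewrite invr_gt0 qM_gt0.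
have B0 : 0 <= B by rewrite ltW // qM_gt0.
pose k := kappa e B; have k0 : 0 < k := kappa_gt0 e0 B0.
have Oz z : X z -> Omega z by apply: Omega_aff_Omega.
have E0 z : X z -> ez z (x z) != 0.
  by move=> Xz; apply/eqP => /(exp_eq0 _ (lattice2_lattice (Oz z Xz))); apply: xL.
have app (D : R) d z : k * D < q%:R ^+ d -> Bx <= D -> X z ->
    `|fexp (pts z d) (x z)| = `|ez z (x z)| /\
    `|fexp (pts z d) (x z) - ez z (x z)| <= `|ez z (x z)| * (Bx / D).
  move=> hD BD Xz; have D0 : 0 < D by apply: lt_le_trans BD.
  have /Omega_aff_far[zM fz] := Xz.
  have [h1 h2] := exp_approx (lattice2_lattice (Oz z Xz)) D0 (le_trans (hBx z Xz) BD)
    (pts_exhausts e0 B0 fz zM hD).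
  split=> //; apply: (le_trans h2); rewrite ler_wpM2l ?absv_ge0 // ler_pM2r ?invr_gt0 //.
  exact: hBx.
have ratP d : ratX (fun z => fexp (pts z d) (x z)).
  apply: (@rat_ext (fun z => x z * \prod_(p <- pairs d | p != (0, 0))
     (1 - x z * (Aemb p.1 * z + Aemb p.2)^-1))).
    by move=> z Xz; rewrite /fexp prod_pts //; apply: Oz.
  apply: rat_mul => //; apply: rat_prod => -[a b] _ ab.
  apply: rat_add; first exact: rat_cst.
  apply: rat_opp; apply: rat_mul => //; apply: rat_inv; first exact: rat_lin.
  by move=> z /Oz oz; apply: lin_neq0.
have [d0 hd0] := qX_gt F (k * Bx).
have [B1 B10 hB1] := rat_bounded (ratP d0).
(* Bounds for the limit and its inverse come from the single approximant of degree [d0], whose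
   absolute value already equals that of the limit. *)
have [B2 B20 hB2] : exists2 B2, 0 < B2 & forall z, X z -> `|(ez z (x z))^-1| <= B2.
  have [|B2 B20 hB2] := rat_bounded (rat_inv (ratP d0) _).
    by move=> z Xz; have [h _] := app _ _ z hd0 (lexx _) Xz; rewrite -abs_gt0 h abs_gt0 E0.
  exists B2 => // z Xz; have [h _] := app _ _ z hd0 (lexx _) Xz.
  by rewrite absV -h -absV hB2.
have choose (eps : R) : 0 < eps -> exists D d, [/\ k * D < q%:R ^+ d, Bx <= D,
    B1 * (Bx / D) < eps & B2 * (Bx / D) < eps].
  (* Chosen so that eps D exceeds both B1 Bx and B2 Bx, which serves the function and its inverse at
     once. *)
  move=> eps0; pose D := Bx + (B1 + B2) * Bx / eps; have D0 : 0 < D.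
    by rewrite ltr_wpDr // divr_ge0 ?mulr_ge0 ?addr_ge0 // ltW.
  have [d hd] := qX_gt F (k * D); exists D, d; split=> //.
  - by rewrite lerDl divr_ge0 ?mulr_ge0 ?addr_ge0 // ltW.
  - rewrite mulrA ltr_pdivrMr // /D mulrDr mulrCA divff ?gt_eqF // mulr1 mulrDl.
    by rewrite addrCA ltrDl addr_gt0 ?mulr_gt0.
  - rewrite mulrA ltr_pdivrMr // /D mulrDr mulrCA divff ?gt_eqF // mulr1 mulrDl.
    by rewrite addrA ltrDr addr_gt0 ?mulr_gt0.
split; apply/holP => eps eps0; have [D [d [h1 h2 h3 h4]]] := choose eps eps0.
  exists (fun z => fexp (pts z d) (x z)) => // z Xz.
  have [_ h] := app D d z h1 h2 Xz; rewrite absB (le_lt_trans h) //.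
  have [e1 _] := app Bx d0 z hd0 (lexx _) Xz.
  rewrite (le_lt_trans _ h3) // ler_wpM2r ?divr_ge0 ?(ltW Bx0) //.
    by rewrite (le_trans (ltW Bx0)).
  by rewrite -e1 hB1.
exists (fun z => (fexp (pts z d) (x z))^-1).
  apply: rat_inv => // z Xz; have [h _] := app D d z h1 h2 Xz.
  by rewrite -abs_gt0 h abs_gt0 E0.
move=> z Xz; have [e1 h] := app D d z h1 h2 Xz.
have E := E0 z Xz; have P0 : fexp (pts z d) (x z) != 0 by rewrite -abs_gt0 e1 abs_gt0.
have -> : (ez z (x z))^-1 - (fexp (pts z d) (x z))^-1 =
   (fexp (pts z d) (x z) - ez z (x z)) * ((ez z (x z))^-1 * (fexp (pts z d) (x z))^-1).
  by field; rewrite E P0.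
rewrite !absvM !absV e1; apply: le_lt_trans h4.
have a0 : 0 < `|ez z (x z)| by rewrite abs_gt0.
apply: (le_trans (ler_wpM2r _ h)); first by rewrite mulr_ge0 // invr_ge0 ltW.
rewrite mulrACA divff ?gt_eqF // mul1r mulrC ler_wpM2r //.
  by rewrite divr_ge0 // ltW // (lt_le_trans Bx0).
by rewrite -absV hB2.
Qed.

Lemma holu_Delta : hol_unit (@Delta F R C).
Proof.
apply: (@holu_ext (fun z => T * \prod_(p <- pairs 1 | p != (0, 0))
    (- (ez z ((Aemb p.1 * z + Aemb p.2) / T))^-1))).
  move=> z Xz; have Oz := Omega_aff_Omega Xz.
  have [_ _ -> _] := Delta_lead Oz; congr (_ * _).
  rewrite /torsion size_polyX big_map.
  rewrite [RHS](eq_bigl (fun l => l != 0)); last first.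
    by move=> l; rewrite mulf_eq0 invr_eq0 (negPf (T_neq0 C)) orbF.
  by rewrite prod_pts.
apply: holu_mul; first exact: holu_cst.
apply: holu_prod => -[a b] pp ab /=.
apply: (@holu_ext (fun z => -1 * (ez z ((Aemb a * z + Aemb b) / T))^-1)).
  by move=> z _; rewrite mulN1r.
apply: holu_mul; first exact: holu_cst.
apply: holu_inv; apply: holu_exp.
  by apply: rat_mul; [apply: rat_lin | apply: rat_cst].
move=> z Xz; have Oz := Omega_aff_Omega Xz.
have [_ _ _ h4 _] := torsion_props (negbT (polyX_eq0 F)) Oz.
move=> /h4 h5; have /eqP : (Aemb a * z + Aemb b) / T = 0.
  apply: h5; apply/mapP; exists (Aemb a * z + Aemb b) => //.
  move: pp => /allpairsP[[a' b'] /= [ha hb [-> ->]]].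
  by apply/allpairsP; exists (a', b'); rewrite size_polyX.
by rewrite mulf_eq0 invr_eq0 (negPf (T_neq0 C)) orbF (negPf (lin_neq0 Oz ab)).
Qed.

Lemma holu_Eprod (m : {poly F}) : m != 0 -> hol_unit (@Eprod F R C m).
Proof.
move=> m0; apply: holu_prod => b bm _.
apply: (@holu_exp (fun=> Aemb b / Aemb m)); first exact: rat_cst.
move=> z /Omega_aff_Omega Oz h.
have := Eprod_neq0 m0 Oz bm.
by rewrite (proj2 (exp_eq0 _ (lattice2_lattice Oz)) h) eqxx.
Qed.

Lemma holu_rootfun n r ka K : n \is monic -> hol_unit (@rootfun F R C n r ka K).
Proof.
move=> nm; apply: holu_mul.
  by apply: holu_mul; [apply: holu_cst | apply: holu_expz; apply: holu_Delta].
apply: holu_prod => m ms _; apply: holu_expz; apply: holu_Eprod.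
by have [mm _] := divisorP nm ms; apply: monic_neq0.
Qed.

End Holomorphic.

Lemma bernoulli (R : realType) (h : R) i : 0 <= h -> 1 + i%:R * h <= (1 + h) ^+ i.
Proof.
move=> h0; elim: i => [|i IH]; first by rewrite mul0r addr0 expr0.
rewrite exprS; apply: (@le_trans _ _ ((1 + h) * (1 + i%:R * h))); last first.
  by rewrite ler_wpM2l // addr_ge0.
have -> : (1 + h) * (1 + i%:R * h) = 1 + i.+1%:R * h + i%:R * h * h.
  by rewrite -natr1; ring.
by rewrite lerDl !mulr_ge0.
Qed.

Lemma geometric_lt (R : realType) (x B e : R) : 0 <= x -> x < 1 -> 0 < e -> 0 <= B ->
  exists N, forall i, (N <= i)%N -> B * x ^+ i < e.
Proof.
move=> x0 x1 e0 B0; have [->|xn0] := eqVneq x 0.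
  by exists 1%N => -[|i] // _; rewrite expr0n mulr0.
have xp : 0 < x by rewrite lt_def xn0.
pose h := x^-1 - 1; have h0 : 0 < h by rewrite subr_gt0 invf_gt1.
have hx : 1 + h = x^-1 by rewrite addrC subrK.
have [N hN] := natR_gt (B / e / h); exists N => i Ni.
rewrite -ltr_pdivlMr ?exprn_gt0 // -exprVn -hx mulrC -ltr_pdivrMr //; apply: lt_le_trans (bernoulli i (ltW h0)).
rewrite (lt_le_trans (y := i%:R * h)) ?lerDr // -ltr_pdivrMr //.
by rewrite (lt_le_trans hN) // ler_nat.
Qed.

(** * Power series with bounded Gauss norm *)

Section PowerSeries.
Variables (F : finFieldType) (R : realType) (C : Cinfty F R).
Local Notation "`| x |" := (absv x) : ring_scope.
Implicit Types (x y z t : C) (rho B : R) (G H : C -> C) (a b : nat -> C).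

Lemma series_cvg (u : nat -> C) : cvg_seq u 0 -> exists l, cvg_seq (fun m => \sum_(i < m) u i) l.
Proof.
move=> u0; apply: absv_complete => e e0; have [N hN] := u0 e e0; exists N.
have key i j : (N <= i)%N -> (i <= j)%N -> `|\sum_(k < j) u k - \sum_(k < i) u k| < e.
  move=> Ni ij; rewrite -!(big_mkord xpredT) (big_cat_nat _ (n := i)) //= addrAC subrr add0r.
  rewrite big_nat_cond; apply: abs_sum_lt => // k /andP[/andP[ik _] _].
  by have := hN k (leq_trans Ni ik); rewrite subr0.
move=> i j Ni Nj; have [ij|/ltnW ij] := leqP i j; last exact: key.
by rewrite absB; apply: key.
Qed.

Definition psum a t m : C := \sum_(i < m) a i * t ^+ i.

Definition coef_bound rho B a := forall i, `|a i| * rho ^+ i <= B.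

(* G is the sum on the open disc of radius rho of a series of Gauss norm <= B. *)
Definition ser rho B G := exists2 a, coef_bound rho B a &
  forall t, `|t| < rho -> cvg_seq (psum a t) (G t).

Lemma coef_term rho B a t i : 0 < rho -> coef_bound rho B a ->
  `|a i * t ^+ i| <= B * (`|t| / rho) ^+ i.
Proof.
move=> r0 hb; rewrite absvM absX exprMn exprVn mulrA [B * _]mulrC -mulrA [leLHS]mulrC.
by rewrite ler_wpM2l ?exprn_ge0 ?absv_ge0 // ler_pdivlMr ?exprn_gt0.
Qed.

Lemma coef_bound_ge0 rho B a : 0 < rho -> coef_bound rho B a -> 0 <= B.
Proof. by move=> r0 /(_ 0%N); apply: le_trans; rewrite mulr_ge0 ?absv_ge0 // exprn_ge0 // ltW. Qed.

Lemma tdiv_lt1 rho t : 0 < rho -> `|t| < rho -> 0 <= `|t| / rho < 1.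
Proof. by move=> r0 h; rewrite divr_ge0 ?absv_ge0 ?ltW //= ltr_pdivrMr // mul1r. Qed.

Lemma term_bound rho B a t i : 0 < rho -> coef_bound rho B a -> `|t| < rho ->
  `|a i * t ^+ i| <= B.
Proof.
move=> r0 hb tr; apply: (le_trans (coef_term t i r0 hb)).
have /andP[x0 x1] := tdiv_lt1 r0 tr.
by rewrite ler_piMr ?(coef_bound_ge0 r0 hb) // exprn_ile1 // ltW.
Qed.

Lemma psum_bound rho B a t m : 0 < rho -> coef_bound rho B a -> `|t| < rho ->
  `|psum a t m| <= B.
Proof.
by move=> r0 hb tr; apply: abs_sum; [apply: coef_bound_ge0 hb | move=> i _; apply: term_bound hb tr].
Qed.

Lemma coef_cvg rho B a t : 0 < rho -> coef_bound rho B a -> `|t| < rho ->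
  exists l, cvg_seq (psum a t) l.
Proof.
move=> r0 hb tr; apply: (series_cvg (u := fun i => a i * t ^+ i)) => e e0.
have /andP[x0 x1] := tdiv_lt1 r0 tr.
have [N hN] := geometric_lt x0 x1 e0 (coef_bound_ge0 r0 hb).
by exists N => i /hN h; rewrite subr0 (le_lt_trans (coef_term t i r0 hb)).
Qed.

Lemma ser_of_coef rho B a : 0 < rho -> coef_bound rho B a ->
  ser rho B (fun t => lim_seq (psum a t)).
Proof.
move=> r0 hb; exists a => // t tr; have [l hl] := coef_cvg r0 hb tr.
by rewrite (lim_seqE hl).
Qed.

Lemma ser_abs rho B G t : 0 < rho -> ser rho B G -> `|t| < rho -> `|G t| <= B.
Proof.
move=> r0 [a hb hG] tr; apply: cvg_absle (hG t tr) _.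
by exists 0%N => i _; apply: psum_bound hb tr.
Qed.

Lemma ser_ext rho B G H : (forall t, `|t| < rho -> G t = H t) -> ser rho B G -> ser rho B H.
Proof. by move=> GH [a hb hG]; exists a => // t tr; rewrite -GH //; apply: hG. Qed.

Lemma ser_le rho B B' G : B <= B' -> ser rho B G -> ser rho B' G.
Proof. by move=> BB [a hb hG]; exists a => // i; apply: le_trans BB. Qed.

Lemma ser_restrict rho rho' B G : 0 < rho' -> rho' <= rho -> ser rho B G -> ser rho' B G.
Proof.
move=> r0 rr [a hb hG]; exists a; last by move=> t tr; apply: hG; apply: lt_le_trans rr.
move=> i; apply: le_trans (hb i); rewrite ler_wpM2l ?absv_ge0 // lerXn2r ?nnegrE ?(ltW r0) //.
exact: le_trans (ltW r0) rr.
Qed.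

Lemma ser_mono rho c k : 0 < rho -> ser rho (`|c| * rho ^+ k) (fun t => c * t ^+ k).
Proof.
move=> r0; exists (fun i => c *+ (i == k)).
  move=> i; have [->|_] := eqVneq i k; first by rewrite mulr1n.
  by rewrite mulr0n abs0 mul0r mulr_ge0 ?absv_ge0 // exprn_ge0 // ltW.
move=> t _; apply: (@cvg_eqN _ _ _ k.+1 _ (fun=> c * t ^+ k)); last exact: cvg_cst.
move=> m km; rewrite /psum (bigD1 (Ordinal km)) //= eqxx mulr1n big1 ?addr0 // => i.
by rewrite -val_eqE /= => /negPf ->; rewrite mulr0n mul0r.
Qed.

Lemma ser_cst rho c : 0 < rho -> ser rho `|c| (fun=> c).
Proof.
move=> r0; have := ser_mono c 0 r0; rewrite expr0 mulr1.
by apply: ser_ext => t _; rewrite expr0 mulr1.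
Qed.

Lemma ser_add rho B G H : ser rho B G -> ser rho B H -> 0 < rho -> ser rho B (fun t => G t + H t).
Proof.
move=> [a ha hG] [b hb hH] r0; exists (fun i => a i + b i).
  move=> i; have p : 0 < rho ^+ i by rewrite exprn_gt0.
  rewrite -ler_pdivlMr //; by apply: absDle; rewrite ler_pdivlMr.
move=> t tr; apply: cvg_eq (cvgD (hG t tr) (hH t tr)) => m.
by rewrite /psum -big_split /=; apply: eq_bigr => i _; rewrite mulrDl.
Qed.

(** The Cauchy product, each coefficient of which is bounded by the ultrametric inequality. *)
Lemma ser_mul rho B B' G H : ser rho B G -> ser rho B' H -> 0 < rho ->
  ser rho (B * B') (fun t => G t * H t).
Proof.
move=> [a ha hG] [b hb hH] r0.
have B0 := coef_bound_ge0 r0 ha; have B0' := coef_bound_ge0 r0 hb.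
pose c i := \sum_(j < i.+1) a j * b (i - j)%N.
have bound (u v : nat -> C) i : coef_bound rho B u -> coef_bound rho B' v ->
    `|\sum_(j < i.+1) u j * v (i - j)%N| * rho ^+ i <= B * B'.
  move=> hu hv; have p : 0 < rho ^+ i by rewrite exprn_gt0.
  rewrite -ler_pdivlMr //; apply: abs_sum => [|j _]; first by rewrite divr_ge0 ?mulr_ge0 // ltW.
  rewrite ler_pdivlMr // absvM.
  have -> : rho ^+ i = rho ^+ j * rho ^+ (i - j) by rewrite -exprD subnKC // -ltnS.
  rewrite mulrACA; apply: ler_pM; [| |exact: hu | exact: hv];
    by rewrite mulr_ge0 ?absv_ge0 // exprn_ge0 // ltW.
exists c; first by move=> i; apply: bound.
move=> t tr.
pose pa m := \poly_(i < m) a i; pose pb m := \poly_(i < m) b i.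
have hpa m : coef_bound rho B (fun i => (pa m)`_i).
  move=> i; rewrite coef_poly; case: ifP => _; first exact: ha.
  by rewrite abs0 mul0r.
have hpb m : coef_bound rho B' (fun i => (pb m)`_i).
  move=> i; rewrite coef_poly; case: ifP => _; first exact: hb.
  by rewrite abs0 mul0r.
have hc m : coef_bound rho (B * B') (fun i => (pa m * pb m)`_i).
  by move=> i; rewrite coefM; apply: bound.
have prodE m : psum a t m * psum b t m = \sum_(i < m + m) (pa m * pb m)`_i * t ^+ i.
  rewrite /psum -[X in X * _]horner_poly -[X in _ * X]horner_poly -hornerM -horner_coef_wide //.
  rewrite (leq_trans (size_polyMleq _ _)) // (leq_trans (leq_pred _)) //.
  by rewrite leq_add // size_poly.
have cE m i : (i < m)%N -> c i = (pa m * pb m)`_i.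
  move=> im; rewrite coefM; apply: eq_bigr => j _; rewrite !coef_poly.
  rewrite (leq_ltn_trans _ im) ?(leq_ltn_trans _ im) ?leq_subr //.
  by rewrite -ltnS.
apply/cvg_sub0.
(* The product of the m-th partial sums and the m-th partial sum of the product differ only in terms
   of degree at least m, which tend to 0 geometrically. *)
have d0 : cvg_seq (fun m => psum c t m - psum a t m * psum b t m) 0.
  move=> e e0; have /andP[x0 x1] := tdiv_lt1 r0 tr.
  have [N hN] := geometric_lt x0 x1 e0 (mulr_ge0 B0 B0'); exists N => m Nm.
  rewrite subr0 prodE -[X in _ - X](big_mkord xpredT (fun i => (pa m * pb m)`_i * t ^+ i)).
  rewrite (big_cat_nat _ (n := m)) ?leq_addr //= big_mkord /psum.
  rewrite (eq_bigr (fun i : 'I_m => (pa m * pb m)`_i * t ^+ i)); last first.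
    by move=> i _; rewrite (cE m).
  rewrite opprD addrA subrr add0r absN big_nat_cond; apply: abs_sum_lt => // i.
  move=> /andP[/andP[mi _] _]; apply: (le_lt_trans (coef_term t i r0 (hc m))).
  apply: hN; exact: leq_trans Nm mi.
apply: (@cvg_eq _ _ _ _ (fun m => (psum c t m - psum a t m * psum b t m) +
  (psum a t m * psum b t m - G t * H t))); first by move=> m; ring.
rewrite -[0]addr0; apply: cvgD => //; apply: (proj1 (cvg_sub0 _ _)).
by apply: cvgM; [apply: hG | apply: hH].
Qed.

(** Completeness for the Gauss norm: the coefficients converge one by one, and the tail of the
    increments bounds the norm of the remainder. *)
Lemma ser_lim rho B (beta : nat -> R) (f : nat -> C -> C) : 0 < rho ->
  ser rho B (f 0%N) -> (forall j, beta j <= B) ->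
  (forall e, 0 < e -> exists N, forall j, (N <= j)%N -> beta j < e) ->
  (forall j, ser rho (beta j) (fun t => f j.+1 t - f j t)) ->
  exists2 G, ser rho B G & forall t, `|t| < rho -> cvg_seq (fun j => f j t) (G t).
Proof.
move=> r0 [a0 ha0 hf0] bB beta0 hd.
have H j : exists d, coef_bound rho (beta j) d /\
    forall t, `|t| < rho -> cvg_seq (psum d t) (f j.+1 t - f j t).
  by have [a h1 h2] := hd j; exists a.
have [d hdd] := choice H.
pose c j i := a0 i + \sum_(l < j) d l i.
have rp i : 0 < rho ^+ i by rewrite exprn_gt0.
have H2 i : exists l, cvg_seq (fun j => c j i) l.
  have [|l hl] := series_cvg (u := fun l => d l i).
    move=> e e0; have [N hN] := beta0 (e * rho ^+ i) (mulr_gt0 e0 (rp i)).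
    exists N => l /hN h; rewrite subr0 -(ltr_pM2r (rp i)); apply: le_lt_trans h.
    by have [hb _] := hdd l; apply: hb.
  by exists (a0 i + l); apply: cvgD => //; apply: cvg_cst.
have [g hg] := choice H2.
have cB j : coef_bound rho B (c j).
  move=> i; rewrite -ler_pdivlMr //; apply: absDle.
    by rewrite ler_pdivlMr.
  apply: abs_sum => [|l _].
    by rewrite divr_ge0 ?(coef_bound_ge0 r0 ha0) // ltW.
  by rewrite ler_pdivlMr //; apply: le_trans (bB l); have [hb _] := hdd l; apply: hb.
have gB : coef_bound rho B g.
  move=> i; rewrite -ler_pdivlMr //; apply: cvg_absle (hg i) _.
  by exists 0%N => j _; rewrite ler_pdivlMr //; apply: cB.
exists (fun t => lim_seq (psum g t)); first exact: ser_of_coef.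
move=> t tr; have [l hl] := coef_cvg r0 gB tr; rewrite (lim_seqE hl).
have cf j : cvg_seq (psum (c j) t) (f j t).
  elim: j => [|j IH].
    apply: cvg_eq (hf0 t tr) => m; apply: eq_bigr => i _.
    by rewrite /c big_ord0 addr0.
  rewrite -(subrK (f j t) (f j.+1 t)) addrC; have [_ hj] := hdd j.
  apply: cvg_eq (cvgD IH (hj t tr)) => m; rewrite /psum -big_split /=.
  by apply: eq_bigr => i _; rewrite /c big_ord_recr /= addrA mulrDl.
move=> e e0; have e20 : 0 < e / 2%:R by rewrite divr_gt0.
have [N hN] := beta0 _ e20; exists N => j Nj.
have dB : coef_bound rho (e / 2%:R) (fun i => g i - c j i).
  move=> i; rewrite -ler_pdivlMr //; apply: (cvg_absle (cvgB (hg i) (cvg_cst (c j i)))).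
  exists j => k jk; rewrite /c opprD addrACA subrr add0r.
  rewrite -!(big_mkord xpredT (fun l => d l i)) (big_cat_nat _ (n := j)) //= addrAC subrr add0r.
  rewrite big_nat_cond; apply: abs_sum => [|l0 /andP[/andP[jl _] _]].
    by rewrite divr_ge0 ?ltW // ltW.
  rewrite ler_pdivlMr //; apply: (le_trans _ (ltW (hN l0 (leq_trans Nj jl)))).
  by have [hb _] := hdd l0; apply: hb.
have -> : f j t - l = - (l - f j t) by rewrite opprB.
rewrite absN; apply: (@le_lt_trans _ _ (e / 2%:R)); last first.
  by rewrite ltr_pdivrMr // ltr_pMr // ltr1n.
apply: (cvg_absle (cvgB hl (cf j))); exists 0%N => m _.
have -> : psum g t m - psum (c j) t m = psum (fun i => g i - c j i) t m.
  by rewrite /psum -sumrB; apply: eq_bigr => i _; rewrite mulrBl.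
exact: psum_bound dB tr.
Qed.

Lemma ser_opp rho B G : ser rho B G -> 0 < rho -> ser rho B (fun t => - G t).
Proof.
move=> hG r0; have := ser_mul (ser_cst (-1) r0) hG r0; rewrite absN abs1 mul1r.
by apply: ser_ext => t _; rewrite mulN1r.
Qed.

Lemma ser_exp rho B G k : ser rho B G -> 0 < rho -> ser rho (B ^+ k) (fun t => G t ^+ k).
Proof.
move=> hG r0; elim: k => [|k IH].
  by have := ser_cst 1 r0; rewrite abs1; apply: ser_ext => t _; rewrite expr0.
by rewrite exprS; apply: ser_ext (ser_mul hG IH r0) => t _; rewrite exprS.
Qed.

Lemma ser_prod (I : eqType) (r : seq I) (P : pred I) (f : I -> C -> C) rho : 0 < rho ->
  (forall i, i \in r -> P i -> ser rho 1 (f i)) -> ser rho 1 (fun t => \prod_(i <- r | P i) f i t).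
Proof.
move=> r0; elim: r => [|i r IH] h.
  have := ser_cst 1 r0; rewrite abs1; by apply: ser_ext => t _; rewrite big_nil.
have {}IH : ser rho 1 (fun t => \prod_(i <- r | P i) f i t).
  by apply: IH => j jr; apply: h; rewrite inE jr orbT.
case Pi : (P i); last by apply: ser_ext IH => z _; rewrite big_cons Pi.
have := ser_mul (h i (mem_head _ _) Pi) IH r0; rewrite mulr1.
by apply: ser_ext => z _; rewrite big_cons Pi.
Qed.

Lemma ser_prod1 (I : eqType) (r : seq I) (P : pred I) (f : I -> C -> C) rho B :
  0 < rho -> 0 <= B -> B <= 1 ->
  (forall i, i \in r -> P i -> ser rho B (fun t => f i t - 1)) ->
  ser rho B (fun t => \prod_(i <- r | P i) f i t - 1).
Proof.
move=> r0 B0 B1; elim: r => [|i r IH] h.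
  have := ser_le B0 (B' := B); have := ser_cst 0 r0; rewrite abs0 => h0 /(_ _ _ h0).
  by apply: ser_ext => t _; rewrite big_nil subrr.
have {}IH : ser rho B (fun t => \prod_(i <- r | P i) f i t - 1).
  by apply: IH => j jr; apply: h; rewrite inE jr orbT.
case Pi : (P i); last by apply: ser_ext IH => z _; rewrite big_cons Pi.
have hi := h i (mem_head _ _) Pi.
have hm : ser rho B (fun t => (f i t - 1) * (\prod_(i <- r | P i) f i t - 1)).
  by apply: ser_le (ser_mul hi IH r0); rewrite ler_piMr.
apply: ser_ext (ser_add hm (ser_add hi IH r0) r0) => t _.
by rewrite big_cons Pi; ring.
Qed.

(** The geometric series, convergent in the Gauss norm as B < 1. *)
Lemma ser_inv rho B h : 0 < rho -> 0 <= B -> B < 1 -> ser rho B h ->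
  ser rho 1 (fun t => (1 - h t)^-1).
Proof.
move=> r0 B0 B1 hh; pose f j t := \sum_(i < j) h t ^+ i.
have [||||G hG fG] := @ser_lim rho 1 (fun j => B ^+ j) f r0.
- have := ser_le ler01 (rho := rho) (G := fun=> 0); have := ser_cst 0 r0.
  by rewrite abs0 => h0 /(_ h0); apply: ser_ext => t _; rewrite /f big_ord0.
- by move=> j; rewrite exprn_ile1 // ltW.
- move=> e e0; have [N hN] := geometric_lt B0 B1 e0 ler01; exists N => j /hN.
  by rewrite mul1r.
- move=> j; apply: ser_ext (ser_exp j hh r0) => t _.
  by rewrite /f big_ord_recr /= addrAC subrr add0r.
apply: ser_ext hG => t tr; have ht := ser_abs r0 hh tr.
have n0 : 1 - h t != 0.
  by rewrite -abs_gt0 absB_dom ?abs1 ?ltr01 // (le_lt_trans ht).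
apply: (mulfI n0); rewrite divff //.
apply: cvg_unique (cvgM (cvg_cst (1 - h t)) (fG t tr)) _.
apply: (@cvg_eq _ _ _ _ (fun j => 1 - h t ^+ j)).
  move=> j; rewrite /f; elim: j => [|j IH]; first by rewrite big_ord0 mulr0 expr0 subrr.
  by rewrite big_ord_recr /= mulrDr IH exprS; ring.
rewrite -[X in cvg_seq _ X]subr0; apply: cvgB; first exact: cvg_cst.
move=> e e0; have [N hN] := geometric_lt B0 B1 e0 ler01; exists N => j /hN.
rewrite mul1r subr0 absX; apply: le_lt_trans.
by rewrite lerXn2r ?nnegrE ?absv_ge0.
Qed.

(** The first nonzero coefficient is taken out; on a smaller disc the remaining terms are at most
    half of it. The exponent k is the order of vanishing. *)
Lemma ser_order rho B G : 0 < rho -> ser rho B G ->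
  (forall t, `|t| < rho -> G t = 0) \/
  exists k c rho' h, [/\ c != 0, 0 < rho', rho' <= rho, ser rho' 2%:R^-1 h
    & forall t, `|t| < rho' -> G t = c * t ^+ k * (1 + h t)].
Proof.
move=> r0 [a ha hG]; have [a0|] := pselect (forall i, a i = 0).
  left=> t tr; apply: cvg_unique (hG t tr) _; apply: cvg_eq (cvg_cst 0) => m.
  by apply: big1 => i _; rewrite a0 mul0r.
move=> /existsNP[i0 /eqP ai0]; right.
have ex : exists i, a i != 0 by exists i0.
case: (ex_minnP ex) => k ak kmin.
have ak0 : 0 < `|a k| by rewrite abs_gt0.
have B0 := coef_bound_ge0 r0 ha.
pose D := B / (rho ^+ k * `|a k|).
have p0 : 0 < rho ^+ k * `|a k| by rewrite mulr_gt0 // exprn_gt0.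
have D0 : 0 <= D by rewrite divr_ge0 // ltW.
(* D bounds the ratio of later coefficients to the k-th one at radius [rho], and D s <= 1 / 2. The
   summand 2 keeps s at most 1 when D is small. *)
pose s := (2%:R * D + 2%:R)^-1.
have s1 : 0 < 2%:R * D + 2%:R by rewrite ltr_wpDl // mulr_ge0.
have s0 : 0 < s by rewrite invr_gt0.
have s_le1 : s <= 1.
  rewrite invf_le1 // (le_trans (y := 2%:R)) ?ler1n // lerDr mulr_ge0 //.
pose hc i := if i == 0%N then 0 else a (k + i)%N / a k.
have hb : coef_bound (rho * s) 2%:R^-1 hc.
  move=> [|i]; first by rewrite /hc eqxx abs0 mul0r invr_ge0.
  rewrite /hc /= absvM absV.
  have h1 : `|a (k + i.+1)%N| * rho ^+ i.+1 <= D * `|a k|.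
    rewrite /D invfM mulrA divfK ?gt_eqF // ler_pdivlMr ?exprn_gt0 //.
    by rewrite -mulrA -exprD (addnC i.+1 k).
  rewrite exprMn mulrA.
  apply: (@le_trans _ _ (D * s ^+ i.+1)).
    by rewrite ler_wpM2r ?exprn_ge0 ?(ltW s0) // mulrAC ler_pdivrMr.
  apply: (@le_trans _ _ (D * s)).
    by rewrite ler_wpM2l // exprS ler_piMr ?(ltW s0) // exprn_ile1 // ltW.
  by rewrite ler_pdivrMr // mulrDr mulrA mulVf ?pnatr_eq0 // mul1r lerDl ler01.
have rs0 : 0 < rho * s by rewrite mulr_gt0.
exists k, (a k), (rho * s), (fun t => lim_seq (psum hc t)); split=> //.
- by rewrite ler_piMr // ltW.
- exact: ser_of_coef.
move=> t tr; have tr' : `|t| < rho by apply: lt_le_trans tr _; rewrite ler_piMr // ltW.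
have [l hl] := coef_cvg rs0 hb tr; rewrite (lim_seqE hl).
apply: cvg_unique (cvg_shift k.+1 (hG t tr')) _.
apply: (@cvg_eq _ _ _ _ (fun m => a k * t ^+ k * (1 + psum hc t m.+1))); last first.
  apply: cvgM; first exact: cvg_cst.
  apply: cvgD; first exact: cvg_cst.
  by apply: cvg_eq (cvg_shift 1 hl) => m; rewrite addn1.
move=> m; rewrite /psum -(big_mkord xpredT (fun i => a i * t ^+ i)).
rewrite (big_cat_nat _ (n := k)) ?addnS ?leqW ?leq_addl //= big_nat_cond big1 ?add0r; last first.
  move=> i /andP[/andP[_ ik] _]; have [->|ai] := eqVneq (a i) 0; first by rewrite mul0r.
  by have := kmin i ai; rewrite leqNgt ik.
rewrite -{1}[k]add0n big_addn -addSn addnK big_mkord !big_ord_recl /= /bump /=.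
rewrite add0n mulrDr mulr1 /hc eqxx mul0r add0r mulr_sumr; congr (_ + _).
apply: eq_bigr => i _; rewrite add1n addSn addnC /= addnS.
by rewrite -!addnS exprD; field.
Qed.

End PowerSeries.

Lemma seq_argmin (R : realType) (E : eqType) (f : E -> R) (s : seq E) x0 : x0 \in s ->
  exists2 x, x \in s & forall y, y \in s -> f x <= f y.
Proof.
elim: s x0 => [|a s IH] // x0 _; have [->|] := eqVneq s [::].
  by exists a; rewrite ?inE // => y; rewrite inE => /eqP ->.
case: s IH => // b s IH _; have [x xs hx] := IH b (mem_head _ _).
have [h|h] := leP (f x) (f a).
  exists x; first by rewrite inE xs orbT.
  by move=> y; rewrite inE => /orP[/eqP ->//|/hx].
exists a; first by rewrite mem_head.
by move=> y; rewrite inE => /orP[/eqP ->//|/hx]; apply: le_trans (ltW h).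
Qed.

(** Serves to express the coefficient of X^(q^2) in phi_T through finitely many values of e_z, each
    of which has a cusp expansion. *)
Lemma lagrange_top (K : fieldType) (p : {poly K}) (s : seq K) k : uniq s ->
  size s = k.+1 -> (size p <= k.+1)%N ->
  p`_k = \sum_(x <- s) p.[x] * \prod_(y <- s | y != x) (x - y)^-1.
Proof.
move=> us ss sp; pose l x := \prod_(y <- s | y != x) ('X - y%:P).
pose c x := p.[x] * \prod_(y <- s | y != x) (x - y)^-1.
have sl x : x \in s -> size (l x) = k.+1.
  move=> xs; rewrite /l -big_filter size_prod_XsubC; congr _.+1.
  by rewrite -rem_filter // size_rem // ss.
have lm x : l x \is monic by rewrite /l -big_filter monic_prod_XsubC.
have lx x y : x \in s -> y \in s -> y != x -> (l x).[y] = 0.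
  move=> xs ys yx; rewrite /l horner_prod -big_filter (bigD1_seq y) ?filter_uniq //=.
    by rewrite hornerXsubC subrr mul0r.
  by rewrite mem_filter yx.
have lxx x : x \in s -> (l x).[x] * \prod_(y <- s | y != x) (x - y)^-1 = 1.
  move=> xs; rewrite /l horner_prod -big_split /= big1 // => y yx.
  by rewrite hornerXsubC divff // subr_eq0 eq_sym.
have pE : p = \sum_(x <- s) c x *: l x.
  apply/eqP; rewrite -subr_eq0; apply: contraT => D0.
  suff: (size s < size s)%N by rewrite ltnn.
  apply: (leq_trans (max_poly_roots D0 (rs := s) _ us)).
    apply/allP => y ys; rewrite /root !hornerE horner_sum (bigD1_seq y) //=.
    rewrite big_seq_cond big1; last first.
      by move=> x /andP[xs xy]; rewrite hornerZ lx ?mulr0 // eq_sym.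
    by rewrite addr0 hornerZ /c mulrAC -mulrA lxx // mulr1 subrr.
  rewrite ss (leq_trans (size_polyD _ _)) // geq_max sp size_polyN /=.
  rewrite (leq_trans (size_sum _ _ _)) //; apply/bigmax_leqP_seq => x xs _.
  by rewrite (leq_trans (size_scale_leq _ _)) // sl.
rewrite {1}pE coef_sum; apply: eq_big_seq => x xs; rewrite coefZ.
by have := monicP (lm x); rewrite lead_coefE sl //= => ->; rewrite mulr1.
Qed.

(** * Expansions at the cusp in the parameter t *)

Section Cusp.
Variables (F : finFieldType) (R : realType) (C : Cinfty F R).
Local Notation q := #|F|.
Local Notation "`| x |" := (absv x) : ring_scope.
Local Notation sc := (sc C).
Local Notation Aemb := (Aemb C).
Local Notation T := (Aemb 'X).
Local Notation ez z := (lattice_exp (lattice2 z)).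
Local Notation LA := (@lattice1 F R C 1).
Local Notation eA := (lattice_exp LA).
Variables (n : {poly F}) (nm : n \is monic).
Local Notation Ln := (@lattice1 F R C n).
Local Notation en := (lattice_exp Ln).
Local Notation t := (@cusp_param F R C n).
Implicit Types (x y z : C) (G H : C -> C) (a b : {poly F}).

Let n0 : n != 0. Proof. exact: monic_neq0. Qed.
Let nC0 : Aemb n != 0. Proof. by rewrite Aemb_eq0. Qed.
Let lLn : lattice Ln. Proof. exact: lattice1_lattice. Qed.
Let lA : lattice LA. Proof. exact: lattice1_lattice (oner_neq0 _). Qed.

Lemma far_le (c c' : R) z : c' <= c -> far c z -> far c' z.
Proof. by move=> cc fz k; apply: le_trans (fz k). Qed.

Lemma far_Omega (c : R) z : 0 < c -> far c z -> Omega z.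
Proof. by move=> c0 fz; apply/OmegaP; exists c. Qed.

(** For a shortest vector y of its coset, each factor with |l| <= |y| has absolute value |y - l| /
    |l| >= 1. *)
Lemma exp_ge y : 0 < `|y| -> (forall l, Ln l -> `|y| <= `|y - l|) -> `|y| <= `|en y|.
Proof.
move=> y0 ly; rewrite (exp_abs lLn y0 (lexx _) (disc_exhausts _ lLn)).
apply: ler_peMr; first exact: absv_ge0.
rewrite big_seq_cond; apply: (big_ind (fun x : R => 1 <= x)) => //.
  by move=> a b ha hb; rewrite -[1]mulr1; apply: ler_pM.
move=> l /andP[/(mem_disc _ _ lLn)[Ll lly] l0].
have -> : 1 - y / l = - ((y - l) / l) by field.
rewrite absN absvM absV ler_pdivlMr ?abs_gt0 // mul1r.
exact: le_trans lly (ly l Ll).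
Qed.

(* Translate z by the lattice element closest to it. *)
Lemma exp_far_ge (c : R) z : 0 < c -> far c z -> c <= `|en z|.
Proof.
move=> c0 fz; have [L0 LB _ _] := lLn; pose s := disc Ln `|z|.
have s0 : 0 \in s by apply/mem_disc => //; rewrite abs0 absv_ge0.
have [l0 l0s hmin] := seq_argmin (fun l => `|z - l|) s0.
have [Ll0 _] := proj1 (mem_disc _ _ lLn) l0s.
pose y := z - l0; have yz : en z = en y by rewrite -[z](subrK l0) exp_periodic.
have ly l : Ln l -> `|y| <= `|y - l|.
  move=> Ll; have [lz|lz] := leP `|l0 + l| `|z|.
    rewrite /y -addrA -opprD; apply: hmin; apply/mem_disc => //; split=> //.
    have -> : l0 + l = l0 - (0 - l) by rewrite sub0r opprK.
    exact: LB _ _ Ll0 (LB _ _ L0 Ll).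
  have e1 : `|z - (l0 + l)| = `|l0 + l| by rewrite absB absB_dom.
  rewrite /y -[X in _ <= absv X]addrA -opprD e1.
  by have := hmin 0 s0; rewrite subr0 => h; apply: le_trans h (ltW lz).
have cy : c <= `|y|.
  by rewrite /y; move: Ll0 => [a ->]; apply: fz.
by rewrite yz (le_trans cy) // exp_ge // (lt_le_trans c0).
Qed.

Lemma cusp_far (c : R) z : 0 < c -> far c z -> t z != 0 /\ `|t z| <= c^-1.
Proof.
move=> c0 fz; have h := exp_far_ge c0 fz; have e0 : 0 < `|en z| by apply: lt_le_trans h.
by rewrite /cusp_param invr_eq0 -abs_gt0 e0 absV lef_pV2.
Qed.

Lemma far_ex (c : R) : exists z : C, far c z.
Proof.
have [w [_ _ _ fw]] := quadratic_ex C; have [d hd] := qX_gt F c.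
exists (Aemb 'X^d * w); apply: (far_le (c := `|Aemb 'X^d| * 1)).
  by rewrite mulr1 AembX absX abs_T ltW.
by apply: Omega_far_mul => //; rewrite expf_neq0 ?polyX_eq0.
Qed.

(** Meromorphy at oo with pole order at most k. A Gauss norm is recorded for the series, so that
    sums, products and inverses can be formed. *)
Definition mer G := exists (c rho B : R) (k : nat) H, [/\ 0 < c, 0 < rho, ser rho B H
  & forall z, far c z -> `|t z| < rho /\ G z * t z ^+ k = H (t z)].

(** Since |t z| <= 1 / c once z is at distance c from K, raising c to at least 2 / rho forces |t z|
    < rho. *)
Lemma merI (c0 rho B : R) k H G : 0 < c0 -> 0 < rho -> ser rho B H ->
  (forall z, far c0 z -> `|t z| < rho -> G z * t z ^+ k = H (t z)) -> mer G.
Proof.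
move=> c00 r0 hH h; pose c := Num.max c0 (2%:R / rho).
have cc : c0 <= c by rewrite le_max lexx.
have c_0 : 0 < c by apply: lt_le_trans cc.
exists c, rho, B, k, H; split=> // z fz; have [_ tz] := cusp_far c_0 fz.
have tr : `|t z| < rho.
  apply: (le_lt_trans tz); rewrite invf_plt ?posrE //.
  apply: (@lt_le_trans _ _ (2%:R / rho)); last by rewrite le_max lexx orbT.
  by rewrite ltr_pMl ?invr_gt0 // ltr1n.
by split=> //; apply: h => //; apply: far_le fz.
Qed.

Lemma mer_ext (c0 : R) G H : 0 < c0 -> (forall z, far c0 z -> G z = H z) -> mer G -> mer H.
Proof.
move=> c00 GH [c [rho [B [k [S [c_0 r0 hS h]]]]]].
apply: (@merI (Num.max c0 c) rho B k S) => //; first by rewrite lt_max c00.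
move=> z fz _; rewrite -GH; first by apply: (proj2 (h z _)); apply: far_le fz; rewrite le_max lexx orbT.
by apply: far_le fz; rewrite le_max lexx.
Qed.

Lemma mer_cst x : mer (fun=> x).
Proof.
apply: (@merI 1 1 `|x| 0 (fun=> x)) => //; first exact: ser_cst.
by move=> z _ _; rewrite expr0 mulr1.
Qed.

Lemma mer_mul G H : mer G -> mer H -> mer (fun z => G z * H z).
Proof.
move=> [c [rho [B [k [S [c0 r0 hS h]]]]]] [c' [rho' [B' [k' [S' [c0' r0' hS' h']]]]]].
have r1 : 0 < Num.min rho rho' by rewrite lt_min r0.
apply: (@merI (Num.max c c') (Num.min rho rho') (B * B') (k + k') (fun u => S u * S' u)) => //.
- by rewrite lt_max c0.
- by apply: ser_mul => //; [apply: ser_restrict hS | apply: ser_restrict hS'];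
    rewrite // ge_min lexx ?orbT.
move=> z fz _.
have cc1 : c <= Num.max c c' by rewrite le_max lexx.
have cc2 : c' <= Num.max c c' by rewrite le_max lexx orbT.
have [_ <-] := h z (far_le cc1 fz); have [_ <-] := h' z (far_le cc2 fz).
by rewrite exprD; ring.
Qed.

Lemma ser_addM (rho B B' : R) G H : 0 < rho -> ser rho B G -> ser rho B' H ->
  ser rho (Num.max B B') (fun u => G u + H u).
Proof.
move=> r0 hG hH; apply: ser_add => //; [apply: ser_le hG | apply: ser_le hH];
by rewrite le_max lexx ?orbT.
Qed.

Lemma mer_add G H : mer G -> mer H -> mer (fun z => G z + H z).
Proof.
move=> [c [rho [B [k [S [c0 r0 hS h]]]]]] [c' [rho' [B' [k' [S' [c0' r0' hS' h']]]]]].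
have r1 : 0 < Num.min rho rho' by rewrite lt_min r0.
have hS1 : ser (Num.min rho rho') B S by apply: ser_restrict hS; rewrite // ge_min lexx.
have hS2 : ser (Num.min rho rho') B' S' by apply: ser_restrict hS'; rewrite // ge_min lexx orbT.
have m1 := ser_mul hS1 (ser_mono (1 : C) k' r1) r1.
have m2 := ser_mul hS2 (ser_mono (1 : C) k r1) r1.
apply: (@merI (Num.max c c') (Num.min rho rho') _ (k + k') _ _ _ r1 (ser_addM r1 m1 m2)).
  by rewrite lt_max c0.
move=> z fz _.
have cc1 : c <= Num.max c c' by rewrite le_max lexx.
have cc2 : c' <= Num.max c c' by rewrite le_max lexx orbT.
have [_ <-] := h z (far_le cc1 fz); have [_ <-] := h' z (far_le cc2 fz).
by rewrite exprD; ring.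
Qed.

(** The form c t^j (1 + h) of [ser_order] is inverted by a geometric series; the zero series is
    excluded by the nonvanishing of G. *)
Lemma mer_inv G : (forall z, Omega z -> G z != 0) -> mer G -> mer (fun z => (G z)^-1).
Proof.
move=> G0 [c [rho [B [k [S [c0 r0 hS h]]]]]].
have [S0|[j [a [rho' [u [a0 r0' rr hu SE]]]]]] := ser_order r0 hS.
  have [z fz] := far_ex c; have [tr] := h z fz; rewrite S0 //.
  move=> /eqP; rewrite mulf_eq0 (negPf (G0 z (far_Omega c0 fz))) expf_eq0.
  by have [/negPf -> _] := cusp_far c0 fz; rewrite andbF.
have h2 : 2%:R^-1 < 1 :> R by rewrite invf_lt1 // ltr1n.
have h20 : 0 <= 2%:R^-1 :> R by rewrite invr_ge0.
have i1 := ser_inv r0' h20 h2 (ser_opp hu r0').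
have i2 := ser_mul (ser_mono a^-1 k r0') i1 r0'.
apply: (@merI c rho' _ j _ _ c0 r0' i2) => z fz tr.
have [_ E] := h z fz; rewrite SE // in E.
have [t0 _] := cusp_far c0 fz; have Gz := G0 z (far_Omega c0 fz).
have u0 : 1 + u (t z) != 0.
  rewrite -abs_gt0 absD_dom ?abs1 ?ltr01 // (le_lt_trans (ser_abs r0' hu tr)) //.
have tk : t z ^+ k != 0 by rewrite expf_neq0.
have tj : t z ^+ j != 0 by rewrite expf_neq0.
have GE : G z = a * t z ^+ j * (1 + u (t z)) / t z ^+ k by rewrite -E mulfK.
rewrite GE; field.
by rewrite opprK; do ?[apply/andP; split].
Qed.

Lemma mer_prod (I : eqType) (r : seq I) (P : pred I) (f : I -> C -> C) :
  (forall i, i \in r -> P i -> mer (f i)) -> mer (fun z => \prod_(i <- r | P i) f i z).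
Proof.
elim: r => [|i r IH] h.
  by apply: (mer_ext ltr01 _ (mer_cst 1)) => z _; rewrite big_nil.
have {}IH : mer (fun z => \prod_(i <- r | P i) f i z).
  by apply: IH => j jr; apply: h; rewrite inE jr orbT.
case Pi : (P i); last by apply: (mer_ext ltr01 _ IH) => z _; rewrite big_cons Pi.
by apply: (mer_ext ltr01 _ (mer_mul (h i (mem_head _ _) Pi) IH)) => z _; rewrite big_cons Pi.
Qed.

Lemma mer_sum (I : eqType) (r : seq I) (f : I -> C -> C) :
  (forall i, i \in r -> mer (f i)) -> mer (fun z => \sum_(i <- r) f i z).
Proof.
elim: r => [|i r IH] h.
  by apply: (mer_ext ltr01 _ (mer_cst 0)) => z _; rewrite big_nil.
have {}IH : mer (fun z => \sum_(i <- r) f i z).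
  by apply: IH => j jr; apply: h; rewrite inE jr orbT.
by apply: (mer_ext ltr01 _ (mer_add (h i (mem_head _ _)) IH)) => z _; rewrite big_cons.
Qed.

Lemma mer_expn G (k : nat) : mer G -> mer (fun z => G z ^+ k).
Proof.
move=> h; have := mer_prod (r := iota 0 k) (P := xpredT) (f := fun=> G) (fun _ _ _ => h).
apply: (mer_ext ltr01) => z _.
by rewrite big_const_seq count_predT size_iota iter_mulr_1.
Qed.

Lemma mer_expz G (k : int) : (forall z, Omega z -> G z != 0) -> mer G -> mer (fun z => G z ^ k).
Proof.
move=> G0 h; case: k => k; first exact: mer_expn.
apply: (mer_ext ltr01 _ (mer_inv _ (mer_expn k.+1 h))).
  by move=> z _; rewrite NegzE -exprnN.
by move=> z Oz; rewrite expf_neq0 // G0.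
Qed.

Lemma eA_en y : eA y = (Aemb n)^-1 * en (Aemb n * y).
Proof.
have -> : Ln = scale_set (Aemb n) LA.
  apply/seteqP; split=> x; rewrite /scale_set /= => -[a h].
    by exists a; rewrite h AembM mul1r mulrC mulKf.
  by exists a; rewrite -[x](divfK nC0) h mul1r mulrC AembM.
by rewrite exp_scale // mulKf.
Qed.

Definition nzpols d := [seq b <- pols F d | b != 0].

Definition eps a : seq C := [seq en (Aemb (n * b) / Aemb a) | b <- nzpols (size a).-1].

(** Let P be the polynomial with e_n(a z) = P(e_n(z)). Its nonzero roots are listed in [eps a],
    [Ka a] is its leading coefficient, and [Da a] below is its reciprocal polynomial with constant
    term 1, as fits u = 1 / e_n. *)
Definition Ka a : C := Aemb a * \prod_(e <- eps a) (- e^-1).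

Definition Da a (u : C) : C := \prod_(e <- eps a) (1 - e * u).

Lemma abs_n_ge1 : 1 <= `|Aemb n|. Proof. exact: abs_Aemb_ge1. Qed.

Lemma Ln_ge l : Ln l -> l != 0 -> `|Aemb n| <= `|l|.
Proof.
move=> [a ->]; rewrite Aemb_eq0 mulf_eq0 negb_or => /andP[_ a0].
by rewrite AembM absvM ler_peMr ?absv_ge0 // abs_Aemb_ge1.
Qed.

(** The argument n b / a is shorter than every nonzero element of n A, so e_n preserves its absolute
    value. *)
Lemma eps_bound a e : a != 0 -> e \in eps a -> e != 0 /\ `|e| <= `|Aemb n|.
Proof.
move=> a0 /mapP[b]; rewrite mem_filter mem_pols => /andP[b0 sb] ->.
have aC : Aemb a != 0 by rewrite Aemb_eq0.
have lt : `|Aemb (n * b) / Aemb a| < `|Aemb n|.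
  rewrite absvM absV ltr_pdivrMr ?abs_gt0 // AembM absvM ltr_pM2l ?abs_gt0 //.
  by rewrite (abs_Aemb _ a0); apply: abs_size_lt.
have E : `|en (Aemb (n * b) / Aemb a)| = `|Aemb (n * b) / Aemb a|.
  by apply: exp_abs_small => // l Ll l0; apply: lt_le_trans lt (Ln_ge Ll l0).
rewrite E (ltW lt); split=> //.
by rewrite -abs_gt0 E abs_gt0 mulf_neq0 ?invr_eq0 // Aemb_eq0 mulf_neq0.
Qed.

Lemma size_eps a : size (eps a) = (pnorm a).-1.
Proof.
rewrite size_map /nzpols -rem_filter ?pols_uniq // size_rem ?size_pols //.
by rewrite mem_pols size_poly0.
Qed.

Lemma en_isogeny a z : a != 0 ->
  en (Aemb a * z) = Aemb a * en z * \prod_(e <- eps a) (1 - en z / e).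
Proof.
move=> a0; have aC : Aemb a != 0 by rewrite Aemb_eq0.
have aV : (Aemb a)^-1 != 0 by rewrite invr_eq0.
pose M := [seq Aemb (n * b) / Aemb a | b <- pols F (size a).-1].
have lL' := scale_lattice aV lLn.
have := exp_scale (Aemb a * z) aV lLn; rewrite mulKf // => E.
have -> : en (Aemb a * z) = Aemb a * lattice_exp (scale_set (Aemb a)^-1 Ln) z.
  by rewrite E mulrA divff // mul1r.
rewrite (exp_isogeny (M := M) z lLn lL') ?mulrA.
- congr (_ * _); rewrite /M (big_map (fun b : {poly F} => Aemb (n * b) / Aemb a)).
  rewrite /eps (big_map (fun b : {poly F} => en (Aemb (n * b) / Aemb a))) big_filter.
  apply: eq_bigl => b; by rewrite mulf_eq0 invr_eq0 (negPf aC) orbF Aemb_eq0 mulf_eq0 (negPf n0).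
- rewrite map_inj_uniq ?pols_uniq // => b b' /(mulIf aV)/Aemb_inj; exact: mulfI.
- by apply/mapP; exists 0; rewrite ?mem_pols ?size_poly0 // mulr0 Aemb0 mul0r.
- move=> _ _ /mapP[b hb ->] /mapP[b' hb' ->]; apply/mapP; exists (b - b').
    rewrite mem_pols (leq_trans (size_polyD _ _)) // geq_max size_polyN.
    by rewrite -!mem_pols hb.
  by rewrite mulrBr AembB mulrBl.
- move=> _ /mapP[b hb ->] [c h].
  have {h} : Aemb (n * b) = Aemb (n * (a * c)).
    by rewrite -[LHS](divfK aC) h -AembM; congr (Aemb _); ring.
  move=> /Aemb_inj/(mulfI n0) bE; move: hb; rewrite bE => /multiple_small/(_ a0) ->.
  by rewrite mulr0 mulr0 Aemb0 mul0r.
- move=> l; rewrite /scale_set /= invrK; split.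
    move=> [b h]; exists (Aemb (n * (b %/ a))), (Aemb (n * (b %% a)) / Aemb a); split.
    + by exists (b %/ a).
    + by apply/mapP; exists (b %% a); rewrite ?mem_pols ?size_modp_pred.
    + apply: (mulIf aC); rewrite h mulrDl divfK // -AembM -AembD.
      by congr (Aemb _); rewrite {1}(divp_eq b a); ring.
  move=> [_ [_ [[b ->] /mapP[b' _ ->] ->]]]; exists (a * b + b').
  by rewrite mulrDl divfK // -AembM -AembD; congr (Aemb _); ring.
Qed.

Lemma en_mul a z : a != 0 -> t z != 0 ->
  en (Aemb a * z) * t z ^+ pnorm a = Ka a * Da a (t z).
Proof.
move=> a0 tz; rewrite en_isogeny // /Ka /Da -2!mulrA -[RHS]mulrA; congr (_ * _).
rewrite -big_split /= -(prednK (pnorm_gt0 a)) exprS -size_eps.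
have -> : t z ^+ size (eps a) = \prod_(e <- eps a) t z.
  by rewrite big_const_seq count_predT iter_mulr_1.
have e0 : en z != 0 by move: tz; rewrite /cusp_param invr_eq0.
have tE : en z * t z = 1 by rewrite /cusp_param divff.
rewrite mulrCA (mulrA (en z)) tE mul1r -big_split /= /cusp_param.
apply: eq_big_seq => e /(eps_bound a0)[en0 _]; field.
by rewrite en0 e0.
Qed.

Lemma Ka_inv a : a != 0 -> Ka a != 0 /\ `|(Ka a)^-1| <= `|Aemb n| ^+ pnorm a.
Proof.
move=> a0; have aC : Aemb a != 0 by rewrite Aemb_eq0.
have K0 : Ka a != 0.
  rewrite mulf_neq0 // prodf_seq_neq0; apply/allP => e /(eps_bound a0)[e0 _] /=.
  by rewrite oppr_eq0 invr_eq0.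
split=> //; rewrite /Ka invfM -prodfV absvM abs_prod absV.
have -> : `|Aemb n| ^+ pnorm a = `|Aemb n| * \prod_(e <- eps a) `|Aemb n|.
  by rewrite big_const_seq count_predT iter_mulr_1 size_eps -exprS prednK // pnorm_gt0.
apply: ler_pM; rewrite ?invr_ge0 ?absv_ge0 //.
- by apply: prodr_ge0 => e _; apply: absv_ge0.
- apply: (le_trans _ abs_n_ge1); rewrite invf_le1 ?abs_gt0 //; exact: abs_Aemb_ge1.
rewrite big_seq [leRHS]big_seq; apply: ler_prod => e /(eps_bound a0)[e0 eb].
by rewrite absv_ge0 invrN invrK absN.
Qed.

Definition Ua a (u : C) : C := (Ka a)^-1 * (Da a u)^-1.

Lemma ser_Da (rho : R) a : 0 < rho -> rho * `|Aemb n| <= 2%:R^-1 -> a != 0 ->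
  ser rho 1 (Da a) /\ ser rho 1 (fun u => (Da a u)^-1).
Proof.
move=> r0 rn a0.
have h2 : 2%:R^-1 < 1 :> R by rewrite invf_lt1 // ltr1n.
have h20 : 0 <= 2%:R^-1 :> R by rewrite invr_ge0.
have he e : e \in eps a -> ser rho 2%:R^-1 (fun u => e * u).
  move=> /(eps_bound a0)[_ eb]; have := ser_mono e 1 r0; rewrite expr1 => h.
  apply: (ser_le _ (ser_ext _ h)); last by move=> u _; rewrite expr1.
  by apply: le_trans rn; rewrite mulrC ler_wpM2l // ltW.
split.
  apply: ser_prod => // e ee _.
  have := ser_cst (1 : C) r0; rewrite abs1 => h1.
  apply: ser_add => //; apply: ser_opp => //; apply: ser_le (he e ee); exact: ltW.
apply: ser_ext (ser_prod (r := eps a) (P := xpredT) (f := fun e u => (1 - e * u)^-1) r0 _).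
  by move=> u _; rewrite prodfV.
by move=> e ee _; apply: ser_inv (he e ee).
Qed.

Lemma ser_Ua (rho : R) a : 0 < rho -> rho * `|Aemb n| <= 2%:R^-1 -> a != 0 ->
  ser rho (`|Aemb n| ^+ pnorm a) (Ua a).
Proof.
move=> r0 rn a0; have [_ h] := ser_Da r0 rn a0; have [_ hK] := Ka_inv a0.
have := ser_mul (ser_cst (Ka a)^-1 r0) h r0; rewrite mulr1; exact: ser_le.
Qed.

Lemma en_inv a z : a != 0 -> t z != 0 -> en (Aemb a * z) != 0 ->
  (en (Aemb a * z))^-1 = t z ^+ pnorm a * Ua a (t z).
Proof.
move=> a0 tz e0; have E := en_mul a0 tz; rewrite /Ua -invfM -E invfM.
by rewrite mulrCA divff ?mulr1 // expf_neq0.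
Qed.

Lemma eA_inv a z : a != 0 -> t z != 0 -> en (Aemb (n * a) * z) != 0 ->
  (eA (Aemb a * z))^-1 = Aemb n * (t z ^+ pnorm (n * a) * Ua (n * a) (t z)).
Proof.
move=> a0 tz e0; rewrite eA_en invfM invrK mulrA -AembM en_inv // mulf_neq0 //.
Qed.

Lemma pnormM a b : a != 0 -> b != 0 -> pnorm (a * b) = (pnorm a * pnorm b)%N.
Proof.
move=> a0 b0; rewrite /pnorm size_mul // -expnD; congr (_ ^ _)%N.
move: a0 b0; rewrite -!size_poly_gt0; case: (size a) => // i _; case: (size b) => // j _.
by rewrite addSn addnS.
Qed.

Lemma en_neq0 z : Omega z -> en z != 0.
Proof.
move=> Oz; apply/eqP => /(exp_eq0 _ lLn) [a h].
move/OmegaP: Oz => [e e0 /(_ (n * a)%:F)]; rewrite h /Defs.Aemb subrr abs0.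
by rewrite leNgt e0.
Qed.

(** The lattices A plus the multiples a z with deg a < j increase to L_z, and each is obtained from
    A by [exp_isogeny]. Any bounded part of L_z is reached at a finite stage, so the exponentials
    converge. *)
Lemma ez_lim z x : Omega z ->
  cvg_seq (fun j => eA x * \prod_(a <- nzpols j) (1 - eA x / eA (Aemb a * z))) (ez z x).
Proof.
move=> Oz; have lL := lattice2_lattice Oz; have /OmegaP[e e0 fz] := Oz.
pose M j := [seq Aemb a * z | a <- pols F j].
pose L' j : set C := [set l | exists a b, (size a <= j)%N /\ l = Aemb a * z + Aemb b].
have lL' j : lattice (L' j).
  split.
  - by exists 0, 0; rewrite size_poly0 Aemb0 mul0r addr0.
  - move=> _ _ [a [b [sa ->]]] [a' [b' [sa' ->]]]; exists (a - a'), (b - b'); split.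
      by rewrite (leq_trans (size_polyD _ _)) // geq_max sa size_polyN.
    by rewrite !AembB; ring.
  - move=> c _ [a [b [sa ->]]]; exists (c%:P * a), (c%:P * b); split.
      by rewrite mul_polyC (leq_trans (size_scale_leq _ _)).
    by rewrite !AembM mulrDr mulrA.
  - move=> B; have [_ _ _ fL] := lL; apply: sub_finite_set (fL B).
    by move=> l [[a [b [_ ->]]] lB]; split=> //; exists a, b.
have z0 : z != 0.
  by apply/eqP => z0; have := fz 0; rewrite z0 rmorph0 subrr abs0 leNgt e0.
have E j : lattice_exp (L' j) x = eA x * \prod_(a <- nzpols j) (1 - eA x / eA (Aemb a * z)).
  rewrite (exp_isogeny (M := M j) x lA (lL' j)).
  - rewrite /M big_map /nzpols big_filter; congr (_ * _); apply: eq_bigl => a.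
    by rewrite mulf_eq0 (negPf z0) orbF Aemb_eq0.
  - by rewrite map_inj_uniq ?pols_uniq // => a b /(mulIf z0)/Aemb_inj.
  - by apply/mapP; exists 0; rewrite ?mem_pols ?size_poly0 // Aemb0 mul0r.
  - move=> _ _ /mapP[a ha ->] /mapP[b hb ->]; apply/mapP; exists (a - b).
      rewrite mem_pols (leq_trans (size_polyD _ _)) // geq_max size_polyN.
      by rewrite -!mem_pols ha.
    by rewrite AembB mulrBl.
  - move=> _ /mapP[a ha ->] [b h].
    have h2 : Aemb a * z + Aemb 0 = Aemb 0 * z + Aemb (1 * b).
      by rewrite !Aemb0 mul0r add0r addr0.
    by have [-> _] := Az_inj e0 fz h2; rewrite Aemb0 mul0r.
  - move=> l; split.
      move=> [a [b [sa ->]]]; exists (Aemb b), (Aemb a * z); split.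
      + by exists b; rewrite mul1r.
      + by apply/mapP; exists a; rewrite ?mem_pols.
      + exact: addrC.
    move=> [_ [_ [[b ->] /mapP[a ha ->] ->]]]; exists a, b.
    by rewrite -mem_pols mul1r addrC.
move=> eps eps0; pose Q := `|ez z x|.
pose D := `|x| + 1 + Q * `|x| / eps.
have D0 : 0 < D.
  by rewrite ltr_wpDr ?divr_ge0 ?mulr_ge0 ?absv_ge0 ?(ltW eps0) // ltr_wpDl ?absv_ge0.
have xD : `|x| <= D.
  by rewrite /D -addrA lerDl addr_ge0 // divr_ge0 ?mulr_ge0 ?absv_ge0 ?(ltW eps0).
have [N hN] := qX_gt F (kappa e `|z| * D); exists N => j Nj; rewrite -E.
have k0 := kappa_gt0 e0 (absv_ge0 z).
have ex1 := disc_exhausts D (lL' j).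
have ex2 : exhausts (lattice2 z) D (disc (L' j) D).
  split; first exact: fset_uniq.
    by move=> l /(mem_disc _ _ (lL' j))[[a [b [_ ->]]] _]; exists a, b.
  move=> _ [a [b ->]] lD; apply/mem_disc => //; split=> //; exists a, b; split=> //.
  apply: leq_trans Nj; apply: (size_abs_lt (C := C)); apply: le_lt_trans hN.
  have [h1 _] := Aemb_kappa a b e0 (absv_ge0 z) fz (lexx _).
  by apply: (le_trans h1); rewrite ler_pM2l.
have [a1 d1] := exp_approx (lL' j) D0 xD ex1.
have [a2 d2] := exp_approx lL D0 xD ex2.
have small : Q * (`|x| / D) < eps.
  rewrite mulrA ltr_pdivrMr // /D mulrDr [eps * (_ / _)]mulrCA divff ?gt_eqF // mulr1.
  by rewrite ltrDr mulr_gt0 // ltr_wpDl ?absv_ge0.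
have -> : lattice_exp (L' j) x - ez z x =
   (fexp (disc (L' j) D) x - ez z x) - (fexp (disc (L' j) D) x - lattice_exp (L' j) x) by ring.
apply: (le_lt_trans _ small); apply: absBle => //.
by rewrite -a1 a2 in d1.
Qed.

Definition toppols j := [seq a : {poly F} <- pols F j.+1 | size a == j.+1].

Lemma nzpols_split j (g : {poly F} -> C) :
  \prod_(a <- nzpols j.+1) g a =
  \prod_(a <- nzpols j) g a * \prod_(a <- toppols j) g a.
Proof.
rewrite -big_cat; apply: perm_big; apply: uniq_perm.
- by rewrite filter_uniq // pols_uniq.
- rewrite cat_uniq !filter_uniq ?pols_uniq // andbT /=; apply/hasPn => a.
  rewrite !mem_filter !mem_pols => /andP[/eqP -> _]; by rewrite ltnn andbF.
move=> a; rewrite mem_cat !mem_filter !mem_pols leq_eqVlt ltnS.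
have [sa|sa] := eqVneq (size a) j.+1; last by rewrite /= orbF.
by rewrite /= sa ltnn andbF /= andbT -size_poly_gt0 sa.
Qed.

(* The product e_L(x) = e_A(x) prod_a (1 - e_A(x) / e_A(a z)) converges in Gauss norm. *)
Lemma mer_ez (x : C -> C) (s : nat) (Xf : C -> C) (rho0 B c0 : R) :
  0 < rho0 -> 0 < c0 -> ser rho0 B Xf -> (s < pnorm n)%N ->
  (forall z, far c0 z -> `|t z| < rho0 -> eA (x z) * t z ^+ s = Xf (t z)) ->
  mer (fun z => ez z (x z)).
Proof.
move=> r00 c00 hX sn hx; set nn := `|Aemb n|.
have nn1 : 1 <= nn := abs_n_ge1.
have nn0 : 0 < nn by apply: lt_le_trans nn1.
have B0 : 0 <= B by case: hX => a ha _; apply: coef_bound_ge0 ha.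
pose BX := B + 1; have BX0 : 0 < BX by rewrite ltr_wpDl.
pose D0 := BX * nn ^+ s.+1; have D00 : 0 < D0 by rewrite mulr_gt0 // exprn_gt0.
(* Makes eta = rho |n| satisfy both eta <= 1 / 2 and D0 eta <= 1; the factor of a polynomial of
   degree at least j is then within Gauss norm eta^j of 1. *)
pose rho := Num.min rho0 (nn * (2%:R + D0))^-1.
have p0 : 0 < nn * (2%:R + D0) by rewrite mulr_gt0 // addr_gt0.
have r0 : 0 < rho by rewrite lt_min r00 invr_gt0.
pose eta := rho * nn; have eta0 : 0 < eta by rewrite mulr_gt0.
have eta1 : eta <= (2%:R + D0)^-1.
  rewrite /eta -ler_pdivlMr // -invfM mulrC ge_min lexx orbT //.
have eta2 : eta <= 2%:R^-1.
  by apply: (le_trans eta1); rewrite lef_pV2 ?posrE ?addr_gt0 // lerDl ltW.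
have eta_lt1 : eta < 1 by apply: (le_lt_trans eta2); rewrite invf_lt1 // ltr1n.
have D0eta : D0 * eta <= 1.
  apply: (le_trans (ler_wpM2l (ltW D00) eta1)); rewrite ler_pdivrMr ?addr_gt0 //.
  by rewrite mul1r lerDr.
have hX' : ser rho BX Xf.
  apply: ser_le (ser_restrict r0 _ hX); first by rewrite lerDl.
  by rewrite ge_min lexx.
(* At u = t z this is e_A(x z) / e_A(a z). The pole of order s of the numerator is absorbed by the
   zero of order |n a| of 1 / e_A(a z), as s < |n|. *)
pose h a u := u ^+ (pnorm (n * a) - s) * Xf u * (Aemb n * Ua (n * a) u).
have hser j a : a != 0 -> (j < size a)%N -> ser rho (eta ^+ j) (h a).
  move=> a0 sa; have na0 : n * a != 0 by rewrite mulf_neq0.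
  set k := (pnorm (n * a) - s)%N.
  have kE : (pnorm (n * a) = k + s)%N.
    rewrite subnK // pnormM // (leq_trans (ltnW sn)) // leq_pmulr // pnorm_gt0 //.
  have kj : (j < k)%N.
    rewrite /k pnormM // ltn_subRL; apply: (@leq_trans (s * pnorm a + pnorm a)).
      rewrite -addnS leq_add // ?leq_pmulr ?pnorm_gt0 //.
      apply: (leq_trans _ (ltn_expl (size a).-1 (q_gt1 F))).
      by rewrite prednK // (leq_ltn_trans _ sa).
    by rewrite -mulSnr leq_mul2r sn orbT.
  have s1 := ser_mono (1 : C) k r0; rewrite abs1 mul1r in s1.
  have s2 := ser_mul (ser_mul s1 hX' r0) (ser_mul (ser_cst (Aemb n) r0) (ser_Ua r0 eta2 na0) r0) r0.
  apply: (ser_le _ (ser_ext _ s2)); last by move=> u _; rewrite /h mul1r.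
  rewrite -/nn kE exprD.
  have -> : rho ^+ k * BX * (nn * (nn ^+ k * nn ^+ s)) = D0 * eta ^+ k.
    by rewrite /D0 /eta exprMn exprS; ring.
  (* The constant D0 is paid for by one power of eta, and the remaining exponent k - 1 is still at
     least j. *)
  rewrite -(prednK (leq_ltn_trans (leq0n _) kj)) exprS mulrA.
  apply: (@le_trans _ _ (1 * eta ^+ k.-1)); first by rewrite ler_wpM2r // exprn_ge0 // ltW.
  rewrite mul1r ler_wiXn2l // ?ltW // -ltnS prednK //; exact: leq_ltn_trans (leq0n _) kj.
have h1ser a : a != 0 -> ser rho 1 (fun u => 1 - h a u).
  move=> a0; have s1 := ser_cst (1 : C) r0; rewrite abs1 in s1.
  apply: ser_add => //; apply: ser_opp => //.
  have := hser 0%N a a0; rewrite expr0; apply; by rewrite size_poly_gt0.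
pose f j u := Xf u * \prod_(a <- nzpols j) (1 - h a u).
have fser j : ser rho BX (f j).
  rewrite -[BX]mulr1; apply: ser_mul => //; apply: ser_prod => // a.
  by rewrite mem_filter => /andP[a0 _] _; apply: h1ser.
have [||||G hG fG] := @ser_lim _ _ _ rho BX (fun j => BX * eta ^+ j) f r0.
- exact: fser.
- by move=> j; apply: ler_piMr; [exact: ltW | apply: exprn_ile1; exact: ltW].
- move=> e e0; have [N hN] := geometric_lt (ltW eta0) eta_lt1 e0 (ltW BX0).
  by exists N.
- move=> j; apply: (@ser_ext _ _ _ _ _ (fun u => f j u *
    (\prod_(a <- toppols j) (1 - h a u) - 1))).
    by move=> u _; rewrite /f nzpols_split mulrBr mulr1 mulrA.
  apply: ser_mul => //; apply: ser_prod1 => //.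
  + by rewrite exprn_ge0 // ltW.
  + by rewrite exprn_ile1 // ltW.
  move=> a; rewrite mem_filter => /andP[/eqP sa _] _.
  have a0 : a != 0 by rewrite -size_poly_gt0 sa.
  apply: ser_ext (ser_opp (hser j a a0 _) r0) => [u _|]; last by rewrite sa.
  by rewrite addrAC subrr add0r.
apply: (@merI c0 rho BX s G) => // z fz tr.
have Oz := far_Omega c00 fz; have [tz _] := cusp_far c00 fz.
have tr0 : `|t z| < rho0 by apply: lt_le_trans tr _; rewrite ge_min lexx.
apply: (@cvg_unique _ _ _ (fun j => f j (t z))); last exact: fG.
apply: cvg_eq (cvgM (ez_lim (x z) Oz) (cvg_cst (t z ^+ s))) => j.
rewrite /f -hx // mulrAC; congr (_ * _ * _).
apply: eq_big_seq => a; rewrite mem_filter => /andP[a0 _]; congr (1 - _).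
have na0 : n * a != 0 by rewrite mulf_neq0.
rewrite /h -hx // eA_inv //; last by apply: en_neq0; apply: Omega_mul.
have sp : (s <= pnorm (n * a))%N.
  by rewrite pnormM // (leq_trans (ltnW sn)) // leq_pmulr // pnorm_gt0.
rewrite -{2}(subnK sp) exprD; ring.
Qed.

Lemma mer_ez_cst x : mer (fun z => ez z x).
Proof.
apply: (@mer_ez (fun=> x) 0 (fun=> eA x) 1 `|eA x| 1) => //.
- exact: ser_cst.
- exact: pnorm_gt0.
by move=> z _ _; rewrite expr0 mulr1.
Qed.

(** With n = w m one has e_A(u z / m) = n^-1 e_n(u w z), a polynomial in 1 / t of degree |u w| <
    |n|; this meets the pole bound of [mer_ez]. *)
Lemma mer_ez_lin (m u v : {poly F}) : m %| n -> (size u < size m)%N ->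
  mer (fun z => ez z ((Aemb u * z + Aemb v) / Aemb m)).
Proof.
move=> /dvdpP[w nE] su.
have m0 : m != 0 by apply: contraNneq n0; rewrite nE => ->; rewrite mulr0.
have w0 : w != 0 by apply: contraNneq n0; rewrite nE => ->; rewrite mul0r.
have mC : Aemb m != 0 by rewrite Aemb_eq0.
have [u0|u0] := eqVneq u 0.
  apply: (mer_ext ltr01 _ (mer_ez_cst (Aemb v / Aemb m))) => z _.
  by rewrite u0 Aemb0 mul0r add0r.
have uw0 : u * w != 0 by rewrite mulf_neq0.
pose nn := `|Aemb n|; have nn0 : 0 < nn by rewrite abs_gt0.
pose rho := (nn * 2%:R)^-1; have r0 : 0 < rho by rewrite invr_gt0 mulr_gt0.
have rn : rho * nn <= 2%:R^-1 by rewrite /rho invfM mulrAC mulVf ?gt_eqF // mul1r.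
have [sD _] := ser_Da r0 rn uw0.
have s1 := ser_mono (eA (Aemb v / Aemb m)) (pnorm (u * w)) r0.
have s2 := ser_mul (ser_cst ((Aemb n)^-1 * Ka (u * w)) r0) sD r0.
apply: (@mer_ez _ (pnorm (u * w)) _ rho _ 1 r0 ltr01 (ser_addM r0 s1 s2)).
  rewrite nE !pnormM // mulnC ltn_mul2l pnorm_gt0 /= ltn_exp2l ?q_gt1 //.
  by rewrite -ltnS !prednK // ?size_poly_gt0.
move=> z fz _; have [tz _] := cusp_far ltr01 fz.
rewrite mulrDl exp_D // addrC mulrDl; congr (_ + _).
have nz : Aemb n * (Aemb u * z / Aemb m) = Aemb (u * w) * z by rewrite nE !AembM; field.
by rewrite eA_en nz -mulrA -[RHS]mulrA -en_mul.
Qed.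

(** Interpolating phi_T, of degree q^2, takes q^2 + 1 nodes. The q^3 constants b / T^3 are distinct
    modulo L_z for every z in Omega, so these nodes do not depend on z. *)
Definition nodes : seq C := take (q ^ 2).+1 (torsion1 C 'X^3).

(** Lagrange interpolation with phi_T(e_z(x)) = e_z(T x) at the nodes writes [Delta] as a rational
    expression in values of e_z at constants. *)
Lemma mer_Delta : mer (@Delta F R C).
Proof.
have X3 : 'X^3 != 0 :> {poly F} by rewrite expf_neq0 // polyX_eq0.
pose M : seq C := torsion1 C 'X^3.
apply: (mer_ext ltr01 (G := fun z => \sum_(x <- nodes) (ez z (T * x) *
    \prod_(y <- nodes | y != x) (ez z (x - y))^-1))).
  move=> z fz; have Oz := far_Omega ltr01 fz; have lL := lattice2_lattice Oz.
  have [h1 h2 h3 h4 _] := torsion1_props X3 Oz.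
  have [sz _ _ _] := Delta_lead Oz.
  have nM x : x \in nodes -> x \in M by apply: mem_take.
  have ezi : {in nodes &, injective (ez z)}.
    move=> x y /nM xM /nM yM /eqP; rewrite -subr_eq0 -exp_B // => /eqP/(exp_eq0 _ lL).
    by move=> /h4 -/(_ (h3 _ _ xM yM))/eqP; rewrite subr_eq0 => /eqP.
  have sn : size nodes = (q ^ 2).+1.
    rewrite size_takel // size_map size_pols size_polyXn /= -[X in (X < _)%N]muln1.
    by rewrite (expnSr _ 2) ltn_mul2l expn_gt0 q_gt0 q_gt1.
  rewrite /Delta (@lagrange_top _ _ [seq ez z x | x <- nodes] (q ^ 2)%N).
  - rewrite big_map; apply: eq_big_seq => x xs; rewrite drinfeld_spec //; congr (_ * _).
    rewrite big_map big_seq_cond [RHS]big_seq_cond; apply: eq_big => [y|y /andP[ys yx]].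
      by case ys : (y \in nodes); rewrite //= (inj_in_eq ezi).
    by rewrite exp_B.
  - by rewrite map_inj_in_uniq // take_uniq.
  - by rewrite size_map.
  - by rewrite sz.
apply: mer_sum => x xs; apply: mer_mul; first exact: mer_ez_cst.
apply: mer_prod => y ys yx; apply: mer_inv; last exact: mer_ez_cst.
move=> z Oz; have lL := lattice2_lattice Oz.
have [h1 h2 h3 h4 _] := torsion1_props X3 Oz.
apply/eqP => /(exp_eq0 _ lL) /h4; rewrite h3 ?(mem_take xs) ?(mem_take ys) //.
by move=> /(_ isT)/eqP; rewrite subr_eq0 eq_sym (negPf yx).
Qed.

(** The argument (c z + d) b / m, with lower row (c, d) of g, may be changed by L_z. Reducing both
    coefficients modulo m brings it within reach of [mer_ez_lin]. *)
Lemma mer_cuspfun r (ka : C) (K : int) g : GL2A g -> mer (cuspfun n r ka K g).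
Proof.
move=> Gg; apply: mer_mul.
  apply: mer_mul; first exact: mer_cst.
  apply: mer_expz; last exact: mer_Delta.
  by move=> z Oz; have [_ _ _ ->] := Delta_lead Oz.
apply: mer_prod => m ms _; have [mm mn] := divisorP nm ms; have m0 := monic_neq0 mm.
apply: mer_expz.
  by move=> z Oz; apply: Eprod_moebius_neq0.
apply: mer_prod => b _ _.
pose u := (b * g 1 0) %% m; pose v := (b * g 1 1) %% m.
have mC : Aemb m != 0 by rewrite Aemb_eq0.
apply: (mer_ext ltr01 _ (mer_ez_lin (m := m) (u := u) v mn _)); last by rewrite ltn_modp.
move=> z fz; have Oz := far_Omega ltr01 fz; have lL := lattice2_lattice Oz.
rewrite -[LHS](exp_periodic _ lL (l := Aemb ((b * g 1 0) %/ m) * z + Aemb ((b * g 1 1) %/ m))).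
  congr (ez z _); rewrite /jfac.
  have -> : (Aemb (g 1 0) * z + Aemb (g 1 1)) * (Aemb b / Aemb m) =
     (Aemb (b * g 1 0) * z + Aemb (b * g 1 1)) / Aemb m by rewrite !AembM; field.
  have E1 : Aemb (b * g 1 0) = Aemb ((b * g 1 0) %/ m) * Aemb m + Aemb u.
    by rewrite -AembM -AembD -divp_eq.
  have E2 : Aemb (b * g 1 1) = Aemb ((b * g 1 1) %/ m) * Aemb m + Aemb v.
    by rewrite -AembM -AembD -divp_eq.
  by rewrite E1 E2; field.
by exists ((b * g 1 0) %/ m), ((b * g 1 1) %/ m).
Qed.

Lemma mer_at_cusp (f : C -> option C) g G : mer G ->
  (forall z, Omega z -> f (moebius g z) = Some (G z)) -> meromorphic_at_cusp n g f.
Proof.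
move=> [c [rho [B [k [H [c0 r0 [a ha hH] h]]]]]] hf; exists c, k, a; split=> // z fz.
have {}fz : far c z by apply/far_Kinf.
exists (G z); split; first by apply: hf; apply: far_Omega fz.
by have [tr ->] := h z fz; apply: hH.
Qed.

End Cusp.

(** * Absence of zero divisors along paths of the tree *)

Section Connectedness.
Variables (F : finFieldType) (R : realType) (C : Cinfty F R).
Local Notation q := #|F|.
Local Notation "`| x |" := (absv x) : ring_scope.
Local Notation sc := (sc C).
Local Notation Aemb := (Aemb C).
Local Notation T := (Aemb 'X).
Implicit Types (x y z u w : C) (e g : R) (p s A : {poly C}).

Lemma abs_Kemb (k : ratfun F) : k != 0 -> exists j : int, `|Kemb C k| = q%:R ^ j.
Proof.
move=> k0; have [a [b [b0 kE]]] := ratfunP k; have a0 : a != 0.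
  by apply: contraNneq k0; rewrite kE => ->; rewrite rmorph0 mul0r.
exists ((size a).-1%:Z - (size b).-1%:Z); rewrite kE fmorph_div /= -/(Defs.Aemb C a).
rewrite -/(Defs.Aemb C b) absvM absV !abs_Aemb // expfzDr ?gt_eqF ?qR_gt0 //.
by rewrite -invr_expz.
Qed.

Lemma abs_Kemb_gap (k : ratfun F) : 1 < `|Kemb C k| -> `|Kemb C k| < q%:R -> False.
Proof.
have [->|k0] := eqVneq k 0; first by rewrite rmorph0 abs0 ltr10.
have [j ->] := abs_Kemb k0; have q1 := qR_gt1 F R; move=> h1 h2.
have h1' : q%:R ^ (0 : int) < q%:R ^ j :> R by rewrite expr0z.
have h2' : q%:R ^ j < q%:R ^ (1 : int) :> R by rewrite expr1z.
by move: h1' h2'; rewrite !ltr_eXz2l //; lia.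
Qed.

Lemma finite_list (P : C -> Prop) k :
  (forall s : seq C, uniq s -> (forall x, x \in s -> P x) -> (size s <= k)%N) ->
  exists s : seq C, forall x, P x -> x \in s.
Proof.
elim: k P => [|k IH] P h.
  exists [::] => x Px; have := h [:: x] isT; rewrite ltnn; apply.
  by move=> y; rewrite inE => /eqP ->.
have [[x Px]|nP] := pselect (exists x, P x); last by exists [::] => x Px; case: nP; exists x.
have [|s hs] := IH (fun y => P y /\ y != x).
  move=> s us hs; have := h (x :: s); rewrite /= us andbT ltnS; apply.
    by apply/negP => /hs[_]; rewrite eqxx.
  by move=> y; rewrite inE => /orP[/eqP ->//|/hs[]].
exists (x :: s) => y Py; rewrite inE; have [//|yx] := eqVneq y x.
by rewrite hs.
Qed.

Lemma teich_le1 x : teich x -> `|x| <= 1.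
Proof.
by move=> tx; have [->|x0] := eqVneq x 0; rewrite ?abs0 // (teich_abs tx x0).
Qed.

(** Newton interpolation: the nodes have mutual distances 1, so the divided differences are no
    larger than the values. *)
Lemma interpolation (D : {poly C}) (B : R) (s : seq C) : 0 < B -> uniq s ->
  (forall x, x \in s -> teich x /\ `|D.[x]| < B) -> (size D <= size s)%N ->
  forall i, `|D`_i| < B.
Proof.
move=> B0; elim: s D => [|x s IH] D us hs sD i.
  move: sD; rewrite leqn0 size_poly_eq0 => /eqP ->; by rewrite coef0 abs0.
have /andP[xs us'] := us.
have [tx Dx] := hs x (mem_head _ _).
have : root (D - D.[x]%:P) x by rewrite /root !hornerE subrr.
move=> /factor_theorem[D1 D1E].
have DE : D = D1 * ('X - x%:P) + D.[x]%:P by rewrite -D1E subrK.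
have hD1 : forall i, `|D1`_i| < B.
  apply: IH => //.
    move=> y ys; have [ty Dy] : teich y /\ `|D.[y]| < B by apply: hs; rewrite inE ys orbT.
    have yx : y != x by apply: contraNneq xs => <-.
    have : (D - D.[x]%:P).[y] = D1.[y] * (y - x) by rewrite D1E hornerM hornerXsubC.
    rewrite !hornerE => E; split=> //.
    have := congr1 (@absv _ _ _) E; rewrite absvM (teich_dist ty tx yx) mulr1 => <-.
    exact: absBlt.
  have [->|D10] := eqVneq D1 0; first by rewrite size_poly0.
  rewrite -ltnS; apply: leq_trans sD; rewrite [X in (_ < size (polyseq X))%N]DE.
  have sM : size (D1 * ('X - x%:P)) = (size D1).+1.
    by rewrite size_Mmonic ?monicXsubC // size_XsubC addn2.
  by rewrite size_polyDl sM // (leq_ltn_trans (size_polyC_leq1 _)) // ltnS size_poly_gt0.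
rewrite DE coefD; apply: absDlt; last by rewrite coefC; case: ifP; rewrite ?abs0.
rewrite mulrBr coefB coefMX coefMC; apply: absBlt.
  by case: ifP => _; rewrite ?abs0.
rewrite absvM (le_lt_trans _ (hD1 i)) // ler_piMr ?absv_ge0 // teich_le1 //.
Qed.

Lemma teich_list k (bad : seq C) : exists s : seq C, [/\ uniq s, size s = k
  & forall x, x \in s -> teich x /\ x \notin bad].
Proof.
elim: k => [|k [s [us ss hs]]]; first by exists [::].
have [x tx xn] := teich_generic (s ++ bad); exists (x :: s).
move: xn; rewrite mem_cat negb_or => /andP[xs xb]; split; rewrite /= ?xs ?ss //.
by move=> y; rewrite inE => /orP[/eqP ->|/hs].
Qed.

Lemma generic_coef (D : {poly C}) (B : R) (bad : seq C) : 0 < B ->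
  (forall x, teich x -> x \notin bad -> `|D.[x]| < B) -> forall i, `|D`_i| < B.
Proof.
move=> B0 h; have [s [us ss hs]] := teich_list (size D) bad.
apply: (interpolation B0 us); last by rewrite ss.
by move=> x /hs[tx xb]; split=> //; apply: h.
Qed.

(* g is the Gauss norm of A and i the last index where it is attained. *)
Definition top A (i : nat) g :=
  [/\ `|A`_i| = g, forall k, `|A`_k| <= g & forall k, (i < k)%N -> `|A`_k| < g].

Lemma top_ex A : A != 0 -> exists i g, 0 < g /\ top A i g.
Proof.
move=> A0; have sA : (0 < size A)%N by rewrite size_poly_gt0.
have m0 : 0%N \in iota 0 (size A) by rewrite mem_iota.
have [k kI hk] := seq_argmin (fun k => - `|A`_k|) m0.
pose g := `|A`_k|.
have hg j : `|A`_j| <= g.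
  have [jA|jA] := ltnP j (size A); last by rewrite nth_default ?abs0 ?absv_ge0.
  by rewrite -lerN2; apply: hk; rewrite mem_iota.
have g0 : 0 < g.
  apply: lt_le_trans (hg (size A).-1); rewrite abs_gt0 -lead_coefE lead_coef_eq0 //.
have ex : exists j, `|A`_j| == g by exists k.
have bd j : `|A`_j| == g -> (j <= size A)%N.
  move=> /eqP h; rewrite leqNgt; apply/negP => jA; move: g0; rewrite -h.
  by rewrite nth_default ?abs0 ?ltxx // ltnW.
case: (ex_maxnP ex bd) => i /eqP ig imax; exists i, g; split=> //; split=> // j ij.
rewrite lt_neqAle hg andbT; apply/negP => /imax; by rewrite leqNgt ij.
Qed.

Lemma top_horner A i g x : top A i g -> `|x| <= 1 -> `|A.[x]| <= g.
Proof.
move=> [hi hg _] x1; rewrite horner_coef; apply: abs_sum; first by rewrite -hi absv_ge0.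
move=> j _; rewrite absvM absX (le_trans _ (hg j)) // ler_piMr ?absv_ge0 //.
by rewrite exprn_ile1 ?absv_ge0.
Qed.

(** If [size A] elements algebraic over F gave values smaller than g, [interpolation] would make
    every coefficient smaller than g. So the exceptions are finite in number. *)
Lemma top_generic A i g : 0 < g -> top A i g ->
  exists bad : seq C, forall x, teich x -> x \notin bad -> `|A.[x]| = g.
Proof.
move=> g0 tA; have [hi hg _] := tA.
have [|bad hb] := @finite_list (fun x => teich x /\ `|A.[x]| < g) (size A).
  move=> s us hs; rewrite leqNgt; apply/negP => sA.
  by have := interpolation g0 us hs (ltnW sA) i; rewrite hi ltxx.
exists bad => x tx xb; apply/eqP; rewrite eq_le (top_horner tA) ?teich_le1 //=.
by rewrite leNgt; apply: contra xb => h; apply: hb.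
Qed.

(** A root in the closed unit disc raises the last index by one and keeps the Gauss norm. In
    [top_mul_big] a root outside keeps the index and scales the norm: the index counts the roots in
    the disc. *)
Lemma top_mul_small A i g y : top A i g -> `|y| <= 1 -> top (A * ('X - y%:P)) i.+1 g.
Proof.
move=> [hi hg hk] y1; have g0 : 0 <= g by rewrite -hi absv_ge0.
have cE j : (A * ('X - y%:P))`_j = (if j == 0%N then 0 else A`_j.-1) - A`_j * y.
  by rewrite mulrBr coefB coefMX coefMC.
have ylt j : (i < j)%N -> `|A`_j * y| < g.
  by move=> ij; rewrite absvM (le_lt_trans _ (hk j ij)) // ler_piMr ?absv_ge0.
split.
- by rewrite cE /= absB_dom hi // ylt.
- move=> j; rewrite cE; apply: absBle; first by case: ifP => _; rewrite ?abs0.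
  by rewrite absvM (le_trans _ (hg j)) // ler_piMr ?absv_ge0.
- move=> [|j] // ij; rewrite cE /=; apply: absBlt; first exact: hk.
  by apply: ylt; apply: ltnW.
Qed.

Lemma top_mul_big A i g y : 0 < g -> top A i g -> 1 < `|y| -> top (A * ('X - y%:P)) i (g * `|y|).
Proof.
move=> g0 [hi hg hk] y1; have y0 : 0 < `|y| by apply: lt_trans y1.
have cE j : (A * ('X - y%:P))`_j = (if j == 0%N then 0 else A`_j.-1) - A`_j * y.
  by rewrite mulrBr coefB coefMX coefMC.
have hlt j : `|if j == 0%N then 0 else A`_j.-1| < g * `|y|.
  case: ifP => _; first by rewrite abs0 mulr_gt0.
  by apply: (le_lt_trans (hg _)); rewrite ltr_pMr.
split.
- by rewrite cE absB absB_dom ?absvM ?hi.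
- move=> j; rewrite cE; apply: absBle; first exact: ltW.
  by rewrite absvM ler_wpM2r ?hg // ltW.
- move=> j ij; rewrite cE; apply: absBlt => //.
  by rewrite absvM ltr_pM2r // hk.
Qed.

(* The points over an edge of the tree *)
Definition edge : set C := [set w | [/\ 1 <= `|w|, `|w| <= q%:R & far `|w| w]].

(** The values of K are integral powers of q, so every y with 1 < |y| < q lies on the edge. A point
    with |y| = 1 off the edge is congruent to an element of K, from which u keeps distance 1. *)
Lemma not_edge y : ~ edge y -> (`|y| <= 1 \/ q%:R <= `|y|) /\
  (`|y| <= 1 -> forall u, far 1 u -> `|u| = 1 -> `|u - y| = 1).
Proof.
move=> ny; split.
  have [y1|y1] := leP `|y| 1; first by left.
  have [yq|yq] := leP q%:R `|y|; first by right.
  case: ny; split; rewrite ?ltW // => k; rewrite leNgt; apply/negP => h.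
  have E := abs_near h; by case: (@abs_Kemb_gap k); rewrite E.
move=> y1 u fu u1; have [yl|yg] := ltP `|y| 1; first by rewrite absB_dom u1.
have yE : `|y| = 1 by apply/eqP; rewrite eq_le y1.
have [k hk] : exists k, `|y - Kemb C k| < 1.
  apply: contrapT => h; apply: ny; split; rewrite ?yE //; first exact: ltW (qR_gt1 F R).
  by move=> k; rewrite leNgt; apply/negP => h2; apply: h; exists k.
have -> : u - y = (u - Kemb C k) - (y - Kemb C k) by ring.
have h1 : 1 <= `|u - Kemb C k| := fu k.
rewrite absB_dom; last exact: lt_le_trans hk h1.
apply/eqP; rewrite eq_le h1 andbT; apply: absBle; first by rewrite u1.
by rewrite -(subKr y (Kemb C k)) absBle ?yE // ltW.
Qed.

(** Elements algebraic over F have mutual distance 1, so at most one lies in the open unit disc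
    around y. *)
Lemma generic_dist y : `|y| <= 1 ->
  exists bad : seq C, forall x, teich x -> x \notin bad -> `|x - y| = 1.
Proof.
move=> y1; have [[x0 [tx0 h0]]|h] := pselect (exists x0, teich x0 /\ `|x0 - y| < 1).
  exists [:: x0] => x tx; rewrite inE => xx.
  have -> : x - y = (x - x0) + (x0 - y) by ring.
  by rewrite absD_dom (teich_dist tx tx0 xx).
exists [::] => x tx _; apply/eqP; rewrite eq_le (absBle (teich_le1 tx) y1) /=.
by rewrite leNgt; apply/negP => h2; apply: h; exists x.
Qed.

(** Here c is the Gauss norm of s and k the number of its roots with |y| <= 1; the others have |y|
    >= q. Along the edge the generic value grows by q^k, and the k roots also force the last maximal
    index of any multiple p s to be at least k. *)
Lemma denominators s : s != 0 -> (forall y, edge y -> s.[y] != 0) ->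
  exists (bad : seq C) (k : nat) (c : R), [/\ 0 < c,
    forall x, teich x -> x \notin bad -> `|s.[x]| = c /\ `|s.[T * x]| = c * q%:R ^+ k,
    forall u, far 1 u -> `|u| = 1 -> `|s.[u]| = c
  & forall p, p != 0 -> exists i g, [/\ 0 < g, (k <= i)%N & top (p * s) i g]].
Proof.
move=> s0 hs; have [r sE] := closed_field_poly_normal s.
have hr y : y \in r -> ~ edge y.
  move=> yr /hs; rewrite sE hornerZ horner_prod mulf_eq0 prodf_seq_eq0.
  by move=> /norP[_ /hasPn/(_ y yr)]; rewrite /= hornerXsubC subrr eqxx.
have b0 : lead_coef s != 0 by rewrite lead_coef_eq0.
rewrite sE; move: (lead_coef s) b0 => b b0; clear sE s0 hs.
elim: r hr => [|y r IH] hr.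
  exists [::], 0%N, `|b|; rewrite abs_gt0; split=> //.
  - by move=> x _ _; rewrite big_nil !hornerE ?expr0 ?mulr1.
  - by move=> u _ _; rewrite big_nil !hornerE.
  - move=> p p0; rewrite big_nil -scalerAr mulr1.
    have [|i [g [g0 tp]]] := @top_ex (b *: p); first by rewrite scaler_eq0 negb_or b0.
    by exists i, g.
have [|bad [k [c [c0 h1 h2 h3]]]] := IH.
  by move=> x xr; apply: hr; rewrite inE xr orbT.
have [ny1 ny2] := not_edge (hr y (mem_head _ _)).
set S := b *: \prod_(z <- r) ('X - z%:P) in h1 h2 h3.
have SE : b *: \prod_(z <- y :: r) ('X - z%:P) = S * ('X - y%:P).
  by rewrite big_cons mulrC scalerAl.
have q0 := qR_gt0 F R; have q1 := qR_gt1 F R.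
rewrite SE.
have [y1|y1] := leP `|y| 1.
  have [bd hb] := generic_dist y1.
  exists (0 :: bd ++ bad), k.+1, c; split=> //.
  - move=> x tx; rewrite inE mem_cat !negb_or => /and3P[x0 xb1 xb2].
    have [E1 E2] := h1 x tx xb2.
    rewrite !hornerM !hornerXsubC !absvM E1 E2 hb // mulr1; split=> //.
    rewrite absB_dom ?absvM ?abs_T ?(teich_abs tx x0) ?mulr1; last exact: le_lt_trans q1.
    by rewrite exprSr mulrA.
  - move=> u fu u1; rewrite hornerM hornerXsubC absvM h2 // ny2 // mulr1 //.
  - move=> p p0; have [i [g [g0 ki tp]]] := h3 p p0; exists i.+1, g; split=> //.
    by rewrite mulrA; apply: top_mul_small.
have yq : q%:R <= `|y| by case: ny1 => //; rewrite leNgt y1.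
have T0 := T_neq0 C.
have [bd hb] : exists bd : seq C, forall x, teich x -> x \notin bd -> `|T * x - y| = `|y|.
  have [yl|yg] := leP `|y| q%:R; last first.
    exists [::] => x tx _; rewrite absB absB_dom // absvM abs_T (le_lt_trans _ yg) //.
    by apply: ler_piMr; [exact: ltW | exact: teich_le1].
  have yE : `|y| = q%:R by apply/eqP; rewrite eq_le yl.
  have [|bd hb] := @generic_dist (y / T).
    by rewrite absvM absV abs_T yE divff // gt_eqF.
  exists bd => x tx xb; have -> : T * x - y = T * (x - y / T) by field.
  by rewrite absvM abs_T hb // mulr1.
exists (bd ++ bad), k, (c * `|y|); split.
- by rewrite mulr_gt0 // (lt_trans ltr01).
- move=> x tx; rewrite mem_cat negb_or => /andP[xb1 xb2].
  have [E1 E2] := h1 x tx xb2.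
  rewrite !hornerM !hornerXsubC !absvM E1 E2 hb //.
  rewrite (absB x) absB_dom ?(le_lt_trans (teich_le1 tx)) //; split=> //.
  by rewrite mulrAC.
- move=> u fu u1; rewrite hornerM hornerXsubC absvM h2 // absB absB_dom ?u1 //.
- move=> p p0; have [i [g [g0 ki tp]]] := h3 p p0; exists i, (g * `|y|); split=> //.
    by rewrite mulr_gt0 // (lt_trans ltr01).
  by rewrite mulrA; apply: top_mul_big.
Qed.

Definition holW (P : C -> C) := forall e, 0 < e -> exists p s : {poly C},
  forall w, edge w -> s.[w] != 0 /\ `|P w - p.[w] / s.[w]| < e.

(** Nonvanishing at a vertex of the tree, in a form shared by finitely many functions at once: their
    finite sets of exceptions leave a common good point. *)
Definition generic_nz (P : C -> C) := exists (d : R) (bad : seq C), 0 < d /\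
  forall x, teich x -> x \notin bad -> d <= `|P x|.

Definition Fvals : seq C := [seq sc c | c : F].

Lemma teich_edge x : teich x -> x \notin Fvals -> [/\ edge x, edge (T * x), `|x| = 1 & far 1 x].
Proof.
move=> tx xF; have xc c : x != sc c.
  by apply: contraNneq xF => ->; apply/mapP; exists c; rewrite ?mem_enum.
have x0 : x != 0 by have := xc 0; rewrite rmorph0.
have fx := teich_far tx xc; have x1 := teich_abs tx x0.
have q1 := ltW (qR_gt1 F R).
split=> //; first by split; rewrite x1.
have E : `|T * x| = q%:R by rewrite absvM abs_T x1 mulr1.
split; rewrite E //.
have := Omega_far_mul fx (m := 'X); rewrite polyX_eq0 abs_T mulr1; exact.
Qed.

Lemma edge_neq0 s : (forall y, edge y -> s.[y] != 0) -> s != 0.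
Proof.
move=> h; have [x tx xF] := teich_generic Fvals; have [ex _ _ _] := teich_edge tx xF.
by have := h x ex; apply: contraNneq => ->; rewrite horner0.
Qed.

(** For an approximant p / s the denominator has the same absolute value at u as at generic points,
    while |p| at u is at most the Gauss norm, which is its generic value. *)
Lemma generic_start (P : C -> C) u : holW P -> far 1 u -> `|u| = 1 -> P u != 0 -> generic_nz P.
Proof.
move=> hP fu u1 Pu; pose d := `|P u|; have d0 : 0 < d by rewrite abs_gt0.
have eu : edge u by split; rewrite u1 // ltW // qR_gt1.
have [p [s hps]] := hP d d0.
have hs y : edge y -> s.[y] != 0 by move=> /hps[].
have [bad [k [c [c0 h1 h2 _]]]] := denominators (edge_neq0 hs) hs.
have [su pu] := hps u eu; have Ru := abs_near pu.
have p0 : p != 0.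
  by apply: contraTneq d0 => p0; rewrite /d -Ru p0 horner0 mul0r abs0 ltxx.
have [i [g [g0 tp]]] := top_ex p0; have [bad2 hb2] := top_generic g0 tp.
exists d, (Fvals ++ bad ++ bad2); split=> // x tx.
rewrite !mem_cat !negb_or => /and3P[xF xb xb2].
have [ex _ _ _] := teich_edge tx xF; have [_ px] := hps x ex; have [sx _] := h1 x tx xb.
have Rx : d <= `|p.[x] / s.[x]|.
  rewrite /d -Ru !absvM !absV (h2 u fu u1) sx (hb2 x tx xb2) ler_pM2r ?invr_gt0 //.
  by apply: top_horner tp _; rewrite u1.
by rewrite absB in px; rewrite (abs_near2 px Rx).
Qed.

(* Going up one edge: the slope of the Gauss norm on the edge is bounded below
   by minus the number of poles inside the disc, uniformly in the approximation. *)
Lemma generic_up (P : C -> C) : holW P -> generic_nz P -> generic_nz (fun w => P (T * w)).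
Proof.
move=> hP [d [bad [d0 hd]]]; have q0 := qR_gt0 F R; have q1 := qR_gt1 F R.
have [p0 [s0 h0]] := hP d d0.
have hs0 y : edge y -> s0.[y] != 0 by move=> /h0[].
have [bad0 [k0 [c0 [c00 a1 a2 a3]]]] := denominators (edge_neq0 hs0) hs0.
(* The first approximant has k0 poles in the unit disc, so its generic value drops by at most q^k0
   along the edge; the second approximant must be accurate to that level. *)
pose d' := d / q%:R ^+ k0; have d'0 : 0 < d' by rewrite divr_gt0 // exprn_gt0.
have d'd : d' <= d.
  by rewrite ler_pdivrMr ?exprn_gt0 // ler_peMr ?(ltW d0) // exprn_ege1 // ltW.
have [p1 [s1 h1]] := hP d' d'0.
have hs1 y : edge y -> s1.[y] != 0 by move=> /h1[].
have [bad1 [k1 [c1 [c10 b1 b2 b3]]]] := denominators (edge_neq0 hs1) hs1.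
have R0 x : teich x -> x \notin Fvals -> x \notin bad -> d <= `|p0.[x] / s0.[x]|.
  move=> tx xF xb; have [ex _ _ _] := teich_edge tx xF; have [_ h] := h0 x ex.
  by rewrite (abs_near2 h (hd x tx xb)) hd.
have p00 : p0 != 0.
  have [x tx] := teich_generic (Fvals ++ bad); rewrite mem_cat negb_or => /andP[xF xb].
  apply: contraTneq (R0 x tx xF xb) => ->; by rewrite horner0 mul0r abs0 -ltNge.
(* Applied to the second denominator s1, so that the last maximal index of p0 s1 is at least k1. *)
have [i [g [g0 ki tA]]] := b3 p0 p00; have [bad2 hb2] := top_generic g0 tA.
pose bd := Fvals ++ bad ++ bad0 ++ bad1 ++ bad2.
have gA x : teich x -> x \notin bd -> [/\ `|(p0 * s1).[x]| = g, `|s0.[x]| = c0, `|s1.[x]| = c1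
    & [/\ `|s0.[T * x]| = c0 * q%:R ^+ k0, `|s1.[T * x]| = c1 * q%:R ^+ k1,
         d <= `|p0.[x] / s0.[x]| & edge x] ].
  move=> tx; rewrite !mem_cat !negb_or => /and5P[x1 x2 x3 x4 x5].
  have [e1 e2] := a1 x tx x3; have [e3 e4] := b1 x tx x4; have [ex _ _ _] := teich_edge tx x1.
  by split=> //; [apply: hb2 | split=> //; apply: R0].
(* Both approximants are within d of [P] at generic points of the lower vertex, so after clearing
   denominators they differ by less than the Gauss norm g. Hence p1 s0 also has an i-th coefficient
   of absolute value g. *)
have dAB j : `|(p0 * s1 - p1 * s0)`_j| < g.
  apply: (generic_coef (bad := bd) g0) => x tx xb.
  have [e1 e2 e3 [_ _ e6 ex]] := gA x tx xb.
  have [sx0 hx0] := h0 x ex; have [sx1 hx1] := h1 x ex.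
  have hh : `|p0.[x] / s0.[x] - p1.[x] / s1.[x]| < d.
    have -> : p0.[x] / s0.[x] - p1.[x] / s1.[x] =
      (P x - p1.[x] / s1.[x]) - (P x - p0.[x] / s0.[x]) by ring.
    by apply: absBlt => //; apply: lt_le_trans d'd.
  have -> : (p0 * s1 - p1 * s0).[x] =
     (p0.[x] / s0.[x] - p1.[x] / s1.[x]) * (s0.[x] * s1.[x]).
    by rewrite hornerD hornerN !hornerM; field; rewrite sx0 sx1.
  have -> : g = `|p0.[x] / s0.[x]| * (c0 * c1).
    by rewrite -e1 -e2 -e3 -!absvM hornerM; congr (absv _); field.
  rewrite [X in X < _]absvM absvM e2 e3 ltr_pM2r ?mulr_gt0 //; exact: lt_le_trans e6.
have [hAi hAg hAk] := tA.
have Bi : `|(p1 * s0)`_i| = g.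
  have := dAB i; rewrite coefB -{1}hAi => h; rewrite (abs_near h) //.
pose B1 := (p1 * s0) \Po (T *: 'X).
have B1E j : B1`_j = (p1 * s0)`_j * T ^+ j.
  rewrite /B1 comp_polyE coef_sum; under eq_bigr do rewrite exprZn scalerA coefZ coefXn.
  have [jl|jl] := ltnP j (size (p1 * s0)).
    rewrite (bigD1 (Ordinal jl)) //= eqxx mulr1 big1 ?addr0 // => l.
    by rewrite -val_eqE /= eq_sym => /negPf ->; rewrite mulr0.
  rewrite big1 ?nth_default ?mul0r // => l _.
  have -> : (j == l) = false.
    by apply/negP => /eqP jE; have := ltn_ord l; rewrite -jE ltnNge jl.
  by rewrite mulr0.
have B10 : B1 != 0.
  apply/eqP => B0; have := B1E i; rewrite B0 coef0 => /esym/eqP.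
  rewrite mulf_eq0 expf_eq0 (negPf (T_neq0 C)) andbF orbF -abs_eq0 Bi.
  by rewrite gt_eqF.
have [i' [g' [g'0 tB]]] := top_ex B10; have [bad3 hb3] := top_generic g'0 tB.
(* At radius q the i-th term alone contributes g q^i with i >= k1. This pays for the growth q^k1 of
   s1, and only the factor q^k0 of s0 is lost. *)
have gg : g * q%:R ^+ k1 <= g'.
  have [_ hBg _] := tB; apply: (le_trans _ (hBg i)); rewrite B1E absvM Bi absX abs_T.
  by rewrite ler_pM2l // ler_weXn2l // ltW.
exists d', (bd ++ bad3); split=> // x tx; rewrite mem_cat negb_or => /andP[xb xb3].
have [e1 e2 e3 [e4 e5 e6 ex]] := gA x tx xb.
have xF : x \notin Fvals by move: xb; rewrite mem_cat negb_or => /andP[].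
have [_ eTx _ _] := teich_edge tx xF; have [sT hT] := h1 (T * x) eTx.
have B1x : `|(p1 * s0).[T * x]| = g'.
  by rewrite -(hb3 x tx xb3) /B1 horner_comp hornerZ hornerX.
have sT0 := hs0 _ eTx.
have gE : g = `|p0.[x] / s0.[x]| * (c0 * c1).
  rewrite -e1 -e2 -e3 -!absvM hornerM; congr (absv _); field; exact: hs0.
have Rx : d' <= `|p1.[T * x] / s1.[T * x]|.
  have -> : p1.[T * x] / s1.[T * x] = (p1 * s0).[T * x] / (s0.[T * x] * s1.[T * x]).
    by rewrite hornerM; field; rewrite sT0 sT.
  rewrite absvM absV absvM B1x e4 e5 ler_pdivlMr; last by rewrite !mulr_gt0 // exprn_gt0.
  apply: le_trans gg; rewrite /d'.
  have qk0 : q%:R ^+ k0 != 0 :> R by rewrite gt_eqF // exprn_gt0.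
  have -> : d / q%:R ^+ k0 * (c0 * q%:R ^+ k0 * (c1 * q%:R ^+ k1)) = d * (c0 * c1) * q%:R ^+ k1.
    by field.
  by rewrite ler_pM2r ?exprn_gt0 // gE ler_pM2r // mulr_gt0.
by rewrite absB in hT; rewrite (abs_near2 hT Rx).
Qed.

Section Affine.
Variables (M : nat) (P : C -> C) (hP : holomorphic_on (@Omega_aff F R C M) P).
Variable k : ratfun F.
Local Notation x := (Kemb C k).
Hypothesis xM : `|x| <= q%:R ^+ M.

(** The map w -> k + l w carries the standard edge onto another edge of the tree; the two bounds on
    |l| keep that edge inside the affinoid. *)
Lemma hol_affine (l : ratfun F) : q%:R ^- M <= `|Kemb C l| -> `|Kemb C l| * q%:R <= q%:R ^+ M ->
  holW (fun w => P (x + Kemb C l * w)).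
Proof.
set y := Kemb C l => y1 y2 e e0; have [p [s h]] := hP e0.
have y0 : y != 0.
  by rewrite -abs_gt0 (lt_le_trans _ y1) // invr_gt0 exprn_gt0 // qR_gt0.
exists (p \Po (y *: 'X + x%:P)), (s \Po (y *: 'X + x%:P)) => w [w1 w2 w3].
rewrite !horner_comp !hornerE (addrC (y * w)).
apply: h; apply/Omega_aff_far; split.
  apply: absDle => //; rewrite absvM; apply: le_trans y2.
  by rewrite ler_wpM2l ?absv_ge0.
move=> j; have -> : x + y * w - Kemb C j = y * (w - Kemb C ((j - k) / l)).
  by rewrite fmorph_div rmorphB /= -/y; field.
rewrite absvM -[leLHS]mulr1; apply: ler_pM => //.
  by rewrite invr_ge0 exprn_ge0 // ltW // qR_gt0.
exact: le_trans w1 (w3 _).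
Qed.

Lemma generic_climb (l : ratfun F) j : q%:R ^- M <= `|Kemb C l| ->
  `|Kemb C l| * q%:R ^+ j <= q%:R ^+ M ->
  generic_nz (fun w => P (x + Kemb C l * w)) ->
  generic_nz (fun w => P (x + Kemb C ('X^j%:F * l) * w)).
Proof.
move=> l1; elim: j => [|j IH] lj h; first by rewrite expr0 rmorph1 mul1r.
have q0 := qR_gt0 F R; have q1 := qR_gt1 F R.
have abs_j : `|Kemb C ('X^j%:F * l)| = q%:R ^+ j * `|Kemb C l|.
  by rewrite rmorphM absvM /= -/(Defs.Aemb C _) AembX absX abs_T.
have lj' : `|Kemb C l| * q%:R ^+ j <= q%:R ^+ M.
  apply: le_trans lj; rewrite ler_wpM2l ?absv_ge0 // ler_weXn2l // ltW //.
have := generic_up (hol_affine _ _) (IH lj' h).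
rewrite abs_j => up.
have [d [bad [d0 hd]]] : generic_nz (fun w => P (x + Kemb C ('X^j%:F * l) * (T * w))).
  apply: up.
    apply: (le_trans l1); rewrite ler_peMl ?absv_ge0 // exprn_ege1 // ltW //.
  by rewrite mulrAC -exprSr mulrC.
exists d, bad; split=> // w tw wb; have := hd w tw wb.
congr (_ <= absv (P (_ + _))).
by rewrite mulrA [_ * T]mulrC /Defs.Aemb -rmorphM mulrA -tofracM -exprS.
Qed.

End Affine.

(** From the vertices of w0 and of k + l w1 one climbs to a common vertex. If neither value were
    zero, both functions would be generically nonzero there, hence nonzero at one point. *)
Lemma hol_no_zero_divisors (w0 w1 : C) (k l : ratfun F) :
  far 1 w0 -> `|w0| = 1 -> far 1 w1 -> `|w1| = 1 -> l != 0 ->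
  exists M, [/\ Omega_aff M w0, Omega_aff M (Kemb C k + Kemb C l * w1)
  & forall P Q, holomorphic_on (@Omega_aff F R C M) P -> holomorphic_on (@Omega_aff F R C M) Q ->
    (forall z, Omega_aff M z -> P z * Q z = 0) ->
    P w0 = 0 \/ Q (Kemb C k + Kemb C l * w1) = 0].
Proof.
move=> f0 a0 f1 a1 l0; have q0 := qR_gt0 F R; have q1 := qR_gt1 F R.
set x := Kemb C k; set y := Kemb C l.
have y0 : y != 0 by rewrite fmorph_eq0.
have ya0 : 0 < `|y| by rewrite abs_gt0.
have [e ye] := abs_Kemb l0; rewrite -/y in ye.
(* After j steps the second path has radius |l| q^j, which exceeds both |k| and 1. As |l| is a power
   of q this radius is q^J with J natural, and J steps from the first vertex reach the same one. *)
have [j hj] := qX_gt F (`|x| / `|y| + 1 / `|y|).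
have [J JE] : exists J : nat, q%:R ^+ J = `|y| * q%:R ^+ j :> R.
  have h1 : 1 < `|y| * q%:R ^+ j.
    rewrite mulrC -ltr_pdivrMr //; apply: le_lt_trans hj; rewrite lerDr.
    by rewrite divr_ge0 ?absv_ge0.
  move: h1; rewrite ye [q%:R ^+ j]exprnP -expfzDr ?gt_eqF //.
  rewrite -(expr0z q%:R) ltr_eXz2l // => h1.
  exists `|(e + j)%R|%N; rewrite exprnP gez0_abs //; exact: ltW.
have xJ : `|x| < q%:R ^+ J.
  rewrite JE mulrC -ltr_pdivrMr //; apply: le_lt_trans hj; rewrite lerDl.
  by rewrite divr_ge0 ?absv_ge0.
have [M1 hM1] := qX_gt F `|y|^-1.
(* The affinoid must contain both paths with one edge to spare above radius q^J, and reach down to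
   radius |l|. *)
pose M := (J + M1).+1.
have qge1 i : 1 <= q%:R ^+ i :> R by rewrite exprn_ege1 // ltW.
have qJM : q%:R ^+ J.+1 <= q%:R ^+ M :> R by rewrite ler_weXn2l ?ltW // ltnS leq_addr.
have qJM' : q%:R ^+ J <= q%:R ^+ M :> R by apply: le_trans qJM; rewrite ler_weXn2l ?ltW.
have qM0 : 0 < q%:R ^+ M :> R by rewrite exprn_gt0.
have qM1 : q%:R ^- M <= 1 :> R by rewrite invf_le1.
have qMy : q%:R ^- M <= `|y|.
  by rewrite invf_ple ?posrE // (le_trans (ltW hM1)) // ler_weXn2l ?ltW // leqW // leq_addl.
have yM : `|y| <= q%:R ^+ M.
  by apply: le_trans qJM'; rewrite JE ler_peMr // ltW.
have xM : `|x| <= q%:R ^+ M by apply: le_trans (ltW xJ) qJM'.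
have far_aff (r : R) (k' l' : ratfun F) u : l' != 0 -> far r u ->
    far (`|Kemb C l'| * r) (Kemb C k' + Kemb C l' * u).
  move=> l'0 fu i; have l'C : Kemb C l' != 0 by rewrite fmorph_eq0.
  have -> : Kemb C k' + Kemb C l' * u - Kemb C i = Kemb C l' * (u - Kemb C ((i - k') / l')).
    by rewrite fmorph_div rmorphB /=; field.
  by rewrite absvM ler_wpM2l ?absv_ge0.
exists M; split.
- by apply/Omega_aff_far; rewrite a0; split=> //; apply: far_le f0.
- apply/Omega_aff_far; split.
    by apply: absDle => //; rewrite absvM a1 mulr1.
  by apply: far_le (far_aff _ k l w1 l0 f1); rewrite mulr1.
move=> P Q hP hQ PQ; apply: contrapT => /not_orP[/eqP P0 /eqP Q0].
have X0 : `|Kemb C 0| <= q%:R ^+ M by rewrite rmorph0 abs0 ltW.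
have qM : q%:R <= q%:R ^+ M :> R by rewrite -[leLHS]expr1 ler_weXn2l // ltW.
have absj (i : nat) (m : ratfun F) : `|Kemb C ('X^i%:F * m)| = q%:R ^+ i * `|Kemb C m|.
  by rewrite rmorphM absvM /= -/(Defs.Aemb C _) AembX absX abs_T.
have gP : generic_nz (fun w => P (Kemb C 0 + Kemb C ('X^J%:F * 1) * w)).
  apply: (generic_climb hP X0); rewrite ?rmorph1 ?abs1 ?mul1r //.
  apply: (generic_start (u := w0)) => //; last by rewrite rmorph0 mul1r add0r.
  by have := hol_affine hP X0 (l := 1); rewrite rmorph1 abs1 mul1r; apply.
have gQ : generic_nz (fun w => Q (x + Kemb C ('X^j%:F * l) * w)).
  apply: (generic_climb hQ xM qMy); first by rewrite -/y -JE.
  apply: (generic_start (u := w1)) => //; apply: (hol_affine hQ xM qMy).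
  by apply: le_trans qJM; rewrite exprSr ler_wpM2r ?(ltW q0) // JE ler_peMr // ltW.
have Xj0 i : 'X^i%:F != 0 :> ratfun F by rewrite tofrac_eq0 expf_neq0 // polyX_eq0.
have lj0 : 'X^j%:F * l != 0 by rewrite mulf_neq0.
have ljE : `|Kemb C ('X^j%:F * l)| = q%:R ^+ J by rewrite absj -/y JE mulrC.
have ljC : Kemb C ('X^j%:F * l) != 0 by rewrite fmorph_eq0.
(* As |k| < q^J, the centres 0 and k give the same vertex at radius q^J. A single point where P is
   nonzero restarts the genericity in the coordinate centred at k. *)
have gP2 : generic_nz (fun w => P (x + Kemb C ('X^j%:F * l) * w)).
  have [d [bad [d0 hd]]] := gP; have [th tth] := teich_generic (Fvals ++ bad).
  rewrite mem_cat negb_or => /andP[thF thb]; have [_ _ th1 fth] := teich_edge tth thF.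
  have Pth := hd th tth thb.
  pose u := Kemb C (- k / ('X^j%:F * l)) + Kemb C ('X^J%:F / ('X^j%:F * l)) * th.
  have uE : x + Kemb C ('X^j%:F * l) * u = Kemb C 0 + Kemb C ('X^J%:F * 1) * th.
    rewrite /u !fmorph_div rmorphN rmorph0 mulr1 -/x.
    by move: (Kemb C ('X^j%:F * l)) ljC => Y Y0; field.
  have l'1 : `|Kemb C ('X^J%:F / ('X^j%:F * l))| = 1.
    rewrite fmorph_div absvM absV ljE; have := absj J 1.
    by rewrite mulr1 rmorph1 abs1 mulr1 => ->; rewrite divff // gt_eqF // exprn_gt0.
  apply: (generic_start (u := u)).
  - by apply: (hol_affine hP xM); rewrite ljE ?(le_trans qM1) // -exprSr.
  - have nz : 'X^J%:F / ('X^j%:F * l) != 0 := mulf_neq0 (Xj0 J) (invr_neq0 lj0).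
    have h := far_aff 1 (- k / ('X^j%:F * l)) _ th nz fth.
    by rewrite l'1 mulr1 in h; apply: h.
  - rewrite /u addrC absD_dom; first by rewrite absvM l'1 th1 mulr1.
    rewrite [ltRHS]absvM l'1 th1 mulr1 fmorph_div rmorphN absvM absN absV ljE.
    by rewrite ltr_pdivrMr ?exprn_gt0 // mul1r.
  - by rewrite uE -abs_gt0 (lt_le_trans d0).
have [d1 [bad1 [d10 hd1]]] := gP2; have [d2 [bad2 [d20 hd2]]] := gQ.
have [th tth] := teich_generic (Fvals ++ bad1 ++ bad2).
rewrite !mem_cat !negb_or => /and3P[thF thb1 thb2]; have [_ _ th1 fth] := teich_edge tth thF.
pose z := x + Kemb C ('X^j%:F * l) * th.
have Xz : Omega_aff M z.
  apply/Omega_aff_far; split; first by apply: absDle => //; rewrite absvM ljE th1 mulr1.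
  by apply: far_le (far_aff _ k _ th lj0 fth); rewrite ljE mulr1 (le_trans qM1).
have := PQ z Xz; move/eqP; rewrite mulf_eq0 -!abs_eq0.
by rewrite !gt_eqF // ?(lt_le_trans d10 (hd1 th tth thb1)) // (lt_le_trans d20 (hd2 th tth thb2)).
Qed.

End Connectedness.

(** * Congruences modulo N *)

Section Arithmetic.
Variable F : finFieldType.
Local Notation q := #|F|.

Lemma levelZ : (level F)%:Z = (q%:Z - 1) * (q%:Z ^+ 2 - 1).
Proof.
by have q1 := q_gt1 F; rewrite /level PoszM -!subzn ?expn_gt0 ?(ltnW q1).
Qed.

(** Allows the factor |n|, a power of q, to be cancelled from the order formula at the cusp. *)
Lemma level_coprime k : coprime (level F) (q ^ k).
Proof.
have q1 := q_gt1 F; apply: coprimeXr; rewrite /level coprimeMl; apply/andP; split.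
  by rewrite coprime_sym -{1}(subnK (ltnW q1)) addn1 coprimeSn.
rewrite -(@coprime_pexpr 2) // -{2}(@subnK 1 (q ^ 2)) ?expn_gt0 ?(ltnW q1) //.
by rewrite addn1 coprimenS.
Qed.

Lemma pow_pred (Q : int) k : exists c, Q ^+ k = 1 + (Q - 1) * c.
Proof.
elim: k => [|k [c E]]; first by exists 0; rewrite expr0; ring.
by exists (Q * c + 1); rewrite exprS E; ring.
Qed.

Lemma pow_square (Q : int) d :
  exists c, Q ^+ (2 * d) = 1 + (Q ^+ 2 - 1) * d%:Z + (Q - 1) * (Q ^+ 2 - 1) * c.
Proof.
elim: d => [|d [c E]]; first by exists 0; rewrite muln0 expr0; ring.
exists (Q ^+ 2 * c + (Q + 1) * d%:Z); rewrite mulnS exprD E.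
have -> : d.+1%:Z = d%:Z + 1 by lia.
ring.
Qed.

(** By [pow_square] the difference of the powers is -q^k (q^2 - 1) d modulo N, and q^k = 1 modulo q
    - 1. In use k is the degree of n / m and d that of m. *)
Lemma dual_norm_term k d :
  ((level F)%:Z %| q%:Z ^+ k - q%:Z ^+ (k + d) * q%:Z ^+ d + (q%:Z ^+ 2 - 1) * d%:Z)%Z.
Proof.
have [c1 E1] := pow_pred q%:Z k; have [c2 E2] := pow_square q%:Z d.
apply/dvdzP; exists (- d%:Z * c1 - q%:Z ^+ k * c2); rewrite levelZ.
have -> : q%:Z ^+ (k + d) * q%:Z ^+ d = q%:Z ^+ k * q%:Z ^+ (2 * d).
  by rewrite -!exprD mul2n -addnn addnA.
have -> : q%:Z ^+ k - q%:Z ^+ k * q%:Z ^+ (2 * d) + (q%:Z ^+ 2 - 1) * d%:Z =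
  (q%:Z ^+ 2 - 1) * d%:Z * (1 - q%:Z ^+ k)
    - q%:Z ^+ k * ((q%:Z - 1) * (q%:Z ^+ 2 - 1) * c2) by rewrite E2; ring.
rewrite [X in (1 - X)]E1; ring.
Qed.

(* [q ^ (2 d) = 1 + (q ^ 2 - 1) d] modulo the level, so that multiplying (1) by [|n|]
   gives (2) up to [(q ^ 2 - 1) \sum_m r m deg m]. *)
Lemma dual_norm n (r : {poly F} -> int) : n \is monic ->
  ((level F)%:Z %| \sum_(m <- monic_divisors n) r m * (pnorm m)%:Z)%Z ->
  ((q - 1)%N%:Z %| \sum_(m <- monic_divisors n) r m * (size m).-1%:Z)%Z ->
  ((level F)%:Z %| \sum_(m <- monic_divisors n) r m * (pnorm (n %/ m))%:Z)%Z.
Proof.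
move=> nm h1 /dvdzP[l h2]; pose D := (size n).-1; have n0 := monic_neq0 nm.
have h : ((level F)%:Z %| \sum_(m <- monic_divisors n) r m *
   ((pnorm (n %/ m))%:Z - q%:Z ^+ D * (pnorm m)%:Z + (q%:Z ^+ 2 - 1) * (size m).-1%:Z))%Z.
  rewrite big_seq; apply: rpred_sum => m /(divisorP nm)[mm mn].
  apply: dvdz_mull; have m0 := monic_neq0 mm.
  have := dual_norm_term ((size n).-1 - (size m).-1) (size m).-1.
  have sn : ((size m).-1 <= (size n).-1)%N by rewrite -!subn1 leq_sub2r // dvdp_leq.
  rewrite subnK // /pnorm size_divp // -!natz !natrX !natz.
  have -> // : (size n - (size m).-1).-1 = ((size n).-1 - (size m).-1)%N.
  by rewrite -!subn1 subnAC.
set S := \sum_(m <- _) _; move: h.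
rewrite (eq_bigr (fun m => r m * (pnorm (n %/ m))%:Z - q%:Z ^+ D * (r m * (pnorm m)%:Z)
  + (q%:Z ^+ 2 - 1) * (r m * (size m).-1%:Z))); last by move=> m _; ring.
rewrite big_split sumrB -!mulr_sumr h2 /= -/S => h.
have E : (q%:Z ^+ 2 - 1) * (l * (q - 1)%N%:Z) = l * (level F)%:Z.
  rewrite levelZ -subzn ?(ltnW (q_gt1 F)) //; ring.
move: h; rewrite E (rpredDr _ (dvdz_mull _ (dvdzz _))) rpredBr //.
exact: dvdz_mull.
Qed.

End Arithmetic.

(** * From the conditions to the root *)

Section Sufficiency.
Variables (F : finFieldType) (R : realType) (C : Cinfty F R).
Local Notation q := #|F|.
Local Notation "`| x |" := (absv x) : ring_scope.
Local Notation sc := (sc C).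
Local Notation Aemb := (Aemb C).
Local Notation T := (Aemb 'X).
Variables (n : {poly F}) (nm : n \is monic) (r : {poly F} -> int).
Local Notation s := (monic_divisors n).

Lemma divvalE : divval C n r = Kemb C (\prod_(m <- s) m%:F ^ r m).
Proof.
rewrite /divval (@rmorph_prod _ _ (Kemb C)); apply: eq_bigr => m _.
by rewrite (@fmorphXz _ _ (Kemb C)).
Qed.

Lemma abs_divval : `|divval C n r| = q%:R ^ (\sum_(m <- s) r m * (size m).-1%:Z).
Proof.
rewrite /divval abs_prod; set t := s; have : {subset t <= s} by [].
elim: t => [|m t IH] h; first by rewrite !big_nil expr0z.
rewrite !big_cons IH; last by move=> x xt; apply: h; rewrite inE xt orbT.
rewrite expfzDr ?gt_eqF ?qR_gt0 // absXz abs_Aemb.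
  by rewrite exprnP exprz_exp [(_ : int) * r m]mulrC.
by have [mm _] := divisorP nm (h m (mem_head _ _)); apply: monic_neq0.
Qed.

(** Absolute values on both sides of (4) are compared; those of K are integral powers of q. *)
Lemma power_degree : is_power (q - 1) (\prod_(m <- s) m%:F ^ r m) ->
  ((q - 1)%N%:Z %| \sum_(m <- s) r m * (size m).-1%:Z)%Z.
Proof.
move=> [y [y0 E]]; have [j yj] := abs_Kemb C y0.
have h : q%:R ^ (\sum_(m <- s) r m * (size m).-1%:Z) = q%:R ^ (j * (q - 1)%N%:Z) :> R.
  by rewrite -abs_divval divvalE E rmorphXn absX yj -exprz_exp.
apply/dvdzP; exists j; apply: ieexprIz h; first exact: qR_gt0.
by rewrite gt_eqF ?qR_gt1.
Qed.

Lemma dvdz_divnorm : ((level F)%:Z %| divnorm n r)%Z ->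
  exists K, divnorm n r = (level F)%:Z * K.
Proof. by move=> /dvdzP[K ->]; exists K; rewrite mulrC. Qed.

Lemma coprime_Gamma0 g : Gamma0 n g -> coprimep (g 1 1) n.
Proof.
move=> [gu /dvdpP[c gc]]; have [D E] := GL2A_inv gu.
apply/Bezout_eq1_coprimepP; exists (g 0 0 * D, - g 0 1 * c * D) => /=.
rewrite -E gc; ring.
Qed.

Lemma conditions_root : ((level F)%:Z %| divnorm n r)%Z -> \sum_(m <- s) r m = 0 ->
  is_power (q - 1) (\prod_(m <- s) m%:F ^ r m) ->
  has_modular_root n (level F) (@Delta_quotient F R C n r).
Proof.
move=> /dvdz_divnorm[K hK] r0 h4; have [y [y0 yE]] := h4.
(* Since y^(q - 1) is the product in (4), the N-th power of 1 / y is that product to the power -(q^2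
   - 1), the constant left by the formula for the quotient. *)
pose ka := (Kemb C y)^-1.
have kaE : ka ^+ level F = divval C n r ^- (q ^ 2 - 1).
  by rewrite divvalE yE rmorphXn -exprM exprVn.
exists (fun z => Some (rootfun n r ka K z)); split; last first.
  by move=> z Oz /=; rewrite (rootfun_exp nm Oz hK kaE).
split.
- move=> M; exists (rootfun n r ka K), (fun _ => 1); split.
  + by have [] := holu_rootfun M r ka K nm.
  + exact: hol_cst.
  + by have [z Xz] := Omega_aff_nonempty C M; exists z; rewrite ?oner_neq0.
  + by move=> z _; rewrite oner_neq0 (negPf (oner_neq0 C)) divr1; split=> //; right.
- move=> g gG z Oz; rewrite (rootfun_Gamma0 nm ka gG Oz hK r0).
  have /(char_power sc r nm) -> := h4; last exact: coprime_Gamma0.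
  by rewrite rmorph1 mul1r.
- move=> g gu; apply: (mer_at_cusp (mer_cuspfun nm r ka K gu)) => z Oz.
  by rewrite (rootfun_moebius ka gu Oz hK r0).
Qed.

End Sufficiency.

(** * Absolute values along the axis of Omega *)

Section Growth.
Variables (F : finFieldType) (R : realType) (C : Cinfty F R).
Local Notation q := #|F|.
Local Notation "`| x |" := (absv x) : ring_scope.
Local Notation sc := (sc C).
Local Notation Aemb := (Aemb C).
Local Notation T := (Aemb 'X).
Local Notation ez z := (lattice_exp (lattice2 z)).
Local Notation LA := (@lattice1 F R C 1).
Local Notation eA := (lattice_exp LA).
Implicit Types (x y z : C).

(** The condition [far |z| z] puts z on the axis: no element of K is closer to z than 0. *)
Lemma vert_ge z a b : far `|z| z -> a != 0 -> `|Aemb a| * `|z| <= `|Aemb a * z + Aemb b|.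
Proof.
by move=> fz a0; have := Omega_far_mul fz a0 (- b%:F); rewrite rmorphN opprK.
Qed.

Lemma vert_mul z a : far `|z| z -> a != 0 -> far `|Aemb a * z| (Aemb a * z).
Proof. by move=> fz a0; rewrite absvM; apply: Omega_far_mul. Qed.

Lemma vert_ex (B : R) : exists y, far `|y| y /\ B < `|y|.
Proof.
have [w [_ _ w1 fw]] := quadratic_ex C; have [d hd] := qX_gt F B.
exists (Aemb ('X ^+ d) * w); split.
  by apply: vert_mul; rewrite ?w1 // expf_neq0 // polyX_eq0.
by rewrite absvM w1 mulr1 AembX absX abs_T.
Qed.

Lemma lattice1_ge l : LA l -> l != 0 -> 1 <= `|l|.
Proof.
move=> [a ->]; rewrite mul1r Aemb_eq0 => a0; exact: abs_Aemb_ge1.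
Qed.

Lemma lattice2_ge z l : far `|z| z -> 1 <= `|z| -> lattice2 z l -> l != 0 -> 1 <= `|l|.
Proof.
move=> fz z1 [a [b ->]]; have [->|a0] := eqVneq a 0.
  by rewrite Aemb0 mul0r add0r Aemb_eq0 => b0; apply: abs_Aemb_ge1.
move=> _; apply: le_trans (vert_ge b fz a0).
by rewrite -[X in X <= _]mulr1 ler_pM // abs_Aemb_ge1.
Qed.

(** Lattice points a z + b with a != 0 have absolute value at least |z| > |x|, so only those of A
    affect |e_z(x)|. *)
Lemma exp_restrict z x : far `|z| z -> x != 0 -> `|x| < `|z| -> `|ez z x| = `|eA x|.
Proof.
move=> fz x0 xz; have z0 : 0 < `|z| by apply: le_lt_trans xz; apply: absv_ge0.
have Oz := far_Omega z0 fz; have lA := lattice1_lattice C (oner_neq0 {poly F}).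
have x0' : 0 < `|x| by rewrite abs_gt0.
have [us s1 s2] := disc_exhausts `|x| lA.
rewrite (exp_abs (lattice2_lattice Oz) x0' (lexx _) (s := disc LA `|x|)).
  by rewrite (exp_abs lA x0' (lexx _) (disc_exhausts _ lA)).
split=> // [l /s1[a ->]|l [a [b lE]] lx]; first by exists 0, a; rewrite Aemb0 mul0r add0r mul1r.
apply: s2 => //; have [a0|a0] := eqVneq a 0.
  by exists b; rewrite lE a0 Aemb0 mul0r add0r mul1r.
have := le_trans (vert_ge b fz a0) _; move=> /(_ `|x|); rewrite -lE => /(_ lx) h.
have := le_lt_trans h xz; rewrite gtr_pMl // ltNge abs_Aemb_ge1 //.
Qed.

(** At z = T y this T-torsion point is c y + d / T, of absolute value |y| < |z|, and e_A(c y)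
    dominates e_A(d / T). *)
Lemma exp_vert_torsion y (c d : F) : far `|y| y -> 1 < `|y| -> c != 0 ->
  `|ez (T * y) ((sc c * (T * y) + sc d) / T)| = `|eA y|.
Proof.
move=> fy y1 c0; have y0 := lt_trans ltr01 y1; have q1 := qR_gt1 F R.
have fz := vert_mul fy (negbT (polyX_eq0 F)).
have lA := lattice1_lattice C (oner_neq0 {poly F}).
have -> : (sc c * (T * y) + sc d) / T = sc c * y + sc d * T^-1.
  by rewrite mulrDl [T * y]mulrC -!mulrA divff ?T_neq0 // mulr1.
have hd : `|sc d| <= 1 by have [->|d0] := eqVneq d 0; rewrite ?rmorph0 ?abs0 // abs_sc.
have V1 : `|T^-1| < 1 by rewrite absV abs_T invf_lt1 ?qR_gt0.
have xE : `|sc c * y + sc d * T^-1| = `|y|.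
  have cy : `|sc c * y| = `|y| by rewrite absvM (abs_sc C c0) mul1r.
  rewrite absD_dom cy //; apply: lt_trans y1.
  by rewrite absvM (le_lt_trans _ V1) // ler_piMl ?absv_ge0.
rewrite exp_restrict //; first last.
- by rewrite xE absvM abs_T ltr_pMl.
- by rewrite -abs_gt0 xE.
have cy : `|sc c * eA y| = `|eA y| by rewrite absvM (abs_sc C c0) mul1r.
rewrite exp_D // !exp_Z // absD_dom cy //.
have eT : `|eA T^-1| = `|T^-1|.
  by apply: exp_abs_small => // l Ll l0; apply: lt_le_trans V1 _; apply: lattice1_ge.
apply: lt_le_trans (exp_far_ge (monic1 F) y0 fy); apply: lt_trans y1.
by rewrite absvM eT (le_lt_trans _ V1) // ler_piMl ?absv_ge0.
Qed.

Lemma exp_vert_const z x : far `|z| z -> 1 <= `|z| -> `|x| < 1 -> `|ez z x| = `|x|.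
Proof.
move=> fz z1 x1; have Oz := far_Omega (lt_le_trans ltr01 z1) fz.
apply: exp_abs_small; first exact: lattice2_lattice.
by move=> l Ll l0; apply: lt_le_trans x1 _; apply: lattice2_ge Ll l0.
Qed.

Lemma prod_const_in (I : eqType) (s : seq I) (P : pred I) (x : R) (G : I -> R) :
  (forall i, i \in s -> P i -> G i = x) -> \prod_(i <- s | P i) G i = x ^+ count P s.
Proof.
move=> h; rewrite big_seq_cond (eq_bigr (fun=> x)) => [|i /andP[]]; last exact: h.
by rewrite -big_seq_cond big_const_seq iter_mulr_1.
Qed.

Lemma count_pols1 : count (fun a => a != 0) (pols F 1) = (q - 1)%N.
Proof.
have := count_predC (pred1 0) (pols F 1); rewrite size_pols expn1 => <-.
by rewrite count_uniq_mem ?pols_uniq // mem_pols size_poly0 add1n subn1.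
Qed.

(** Of the nonzero T-torsion points, the q (q - 1) with a component along z contribute 1 / |e_A(y)|
    each, and the others contribute constants. *)
Lemma Delta_torsion_growth : exists2 c : R, 0 < c & forall y, far `|y| y -> 1 < `|y| ->
  `|Delta (T * y)| * `|eA y| ^+ (q * (q - 1)) = c.
Proof.
have q0 := qR_gt0 F R; have q1 := qR_gt1 F R.
exists (q%:R * \prod_(b <- pols F 1) (if b != 0 then q%:R else 1)).
  by rewrite mulr_gt0 // prodr_gt0 // => b _; case: ifP.
move=> y fy y1; have y0 := lt_trans ltr01 y1.
have fz := vert_mul fy (negbT (polyX_eq0 F)).
have z1 : 1 <= `|T * y| by rewrite absvM abs_T ltW // mulr_egt1 ?(ltW q1) // ltW.
have Oz := far_Omega (lt_le_trans ltr01 z1) fz.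
have e0 : `|eA y| != 0.
  by rewrite gt_eqF //; apply: lt_le_trans y0 (exp_far_ge (monic1 F) y0 fy).
have [_ _ -> _] := Delta_lead Oz.
rewrite /torsion size_polyX big_map absvM abs_T -mulrA; congr (_ * _).
rewrite (eq_bigl (fun l => l != 0)); last first.
  by move=> l; rewrite mulf_eq0 invr_eq0 (negPf (T_neq0 C)) orbF.
rewrite (prod_pts 1 (fun l => - (ez (T * y) (l / T))^-1) Oz) abs_prod big_mkcond /=.
rewrite /pairs big_allpairs (bigD1_seq 0) /= ?pols_uniq ?mem_pols ?size_poly0 //.
rewrite -mulrA; set A := (X in X * _ = _); set B := (X in _ * X = _).
have -> : B = 1.
  rewrite /B (prod_const_in (x := `|eA y|^-1 ^+ q)); last first.
    move=> a; rewrite mem_pols => /size1_polyC -> a0.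
    rewrite (prod_const_in (x := `|eA y|^-1)); last first.
      move=> b; rewrite mem_pols => /size1_polyC -> _.
      rewrite xpair_eqE (negPf a0) /= absN absV exp_vert_torsion //.
      by move: a0; rewrite polyC_eq0.
    by rewrite count_predT size_pols expn1.
  by rewrite count_pols1 -exprM -exprMn mulVf // expr1n.
rewrite mulr1 /A; apply: eq_big_seq => b; rewrite mem_pols => /size1_polyC ->.
rewrite xpair_eqE eqxx /=; case: eqP => //= /eqP b0.
rewrite Aemb0 mul0r add0r absN absV.
have bE : `|Aemb (b`_0)%:P / T| = q%:R^-1.
  by rewrite absvM absV abs_T (abs_sc C) ?mul1r // -polyC_eq0.
by rewrite exp_vert_const ?bE ?invrK // invf_lt1.
Qed.

Variables (n : {poly F}) (nm : n \is monic).
Local Notation Ln := (@lattice1 F R C n).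
Local Notation en := (lattice_exp Ln).
Local Notation t := (@cusp_param F R C n).

Lemma abs_Da (m a : {poly F}) (u : C) : m \is monic -> a != 0 -> `|Aemb m| * `|u| < 1 ->
  `|Da m a u| = 1.
Proof.
move=> mm a0 hu; rewrite /Da abs_prod big1_seq // => e /andP[_ /(eps_bound mm a0)[_ he]].
have h : `|e * u| < 1 by rewrite absvM (le_lt_trans _ hu) // ler_wpM2r ?absv_ge0.
by rewrite absB_dom abs1.
Qed.

Lemma abs_cusp z : far `|z| z -> 0 < `|z| -> 0 < `|t z| /\ `|t z| <= `|z|^-1.
Proof. by move=> fz z0; have [t0 ht] := cusp_far nm z0 fz; rewrite abs_gt0. Qed.

(** The leading term dominates in the polynomial that expresses e_A(T y) through e_A(y). *)
Lemma exp_vert_power y : far `|y| y -> 1 < `|y| ->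
  `|eA (T * y)| = `|Ka C 1 'X| * `|eA y| ^+ q.
Proof.
move=> fy y1; have y0 := lt_trans ltr01 y1.
have [t0 ht] := cusp_far (monic1 F) y0 fy; have X0 := negbT (polyX_eq0 F).
have := congr1 (@absv _ _ _) (en_mul (monic1 F) X0 t0).
rewrite !absvM absX abs_Da ?monic1 //; last first.
  by rewrite Aemb1 abs1 mul1r (le_lt_trans ht) // invf_lt1.
rewrite mulr1 /pnorm size_polyX expn1 /cusp_param absV => <-.
have e0 : `|eA y| != 0 by rewrite abs_eq0; move: t0; rewrite /cusp_param invr_eq0.
by rewrite -mulrA -exprMn mulVf // expr1n mulr1.
Qed.

(** Up to constants |e_A(y)|^q is |e_A(T y)|, and this is |t(T y)|^(-|n|) because e_A is a
    polynomial of degree |n| in 1 / t. *)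
Lemma Delta_growth : exists2 c : R, 0 < c & forall y, far `|y| y -> `|Aemb n| < `|y| ->
  `|Delta (T * y)| = c * `|t (T * y)| ^+ ((q - 1) * pnorm n).
Proof.
have [c c0 hc] := Delta_torsion_growth; have n0 := monic_neq0 nm.
have [K1 _] := Ka_inv C (monic1 F) (negbT (polyX_eq0 F)).
have [K2 _] := Ka_inv C nm n0; have n1 := abs_Aemb_ge1 C n0.
pose k1 := `|Ka C 1 'X|; pose k2 := `|Ka C n n| / `|Aemb n|.
have k10 : 0 < k1 by rewrite abs_gt0.
have k20 : 0 < k2 by rewrite divr_gt0 ?abs_gt0 ?Aemb_eq0.
exists (c * (k1 / k2) ^+ (q - 1)); first by rewrite mulr_gt0 // exprn_gt0 // divr_gt0.
move=> y fy yn; have y1 := le_lt_trans n1 yn; have y0 := lt_trans ltr01 y1.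
have fz := vert_mul fy (negbT (polyX_eq0 F)).
have zE : `|T * y| = q%:R * `|y| by rewrite absvM abs_T.
have zy : `|y| < `|T * y| by rewrite zE ltr_pMl // qR_gt1.
have [t0 ht] := abs_cusp fz (lt_trans y0 zy).
have tn : `|Aemb n| * `|t (T * y)| < 1.
  have z0 := lt_trans y0 zy.
  rewrite (@le_lt_trans _ _ (`|Aemb n| * `|T * y|^-1)) ?ler_wpM2l ?absv_ge0 //.
  by rewrite ltr_pdivrMr // mul1r (lt_trans yn).
have E1 := exp_vert_power fy y1.
have E2 : `|eA (T * y)| * `|t (T * y)| ^+ pnorm n = k2.
  have h := congr1 (@absv _ _ _) (en_mul nm n0 (z := T * y) _).
  rewrite (eA_en nm) absvM absV -mulrA -absX -absvM h -?abs_gt0 // absvM abs_Da //.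
  by rewrite mulr1 mulrC.
have e0 : 0 < `|eA y| by apply: lt_le_trans y0 (exp_far_ge (monic1 F) y0 fy).
have E3 : (k1 / k2) * `|t (T * y)| ^+ pnorm n = `|eA y| ^- q.
  apply: (mulfI (lt0r_neq0 k20)); rewrite mulrA mulrCA divff ?gt_eqF // mulr1 -E2 E1.
  by rewrite mulrAC mulfK // gt_eqF ?exprn_gt0.
rewrite mulnC exprM -mulrA -exprMn E3 exprVn -exprM -(hc y fy y1).
by rewrite mulfK // gt_eqF // exprn_gt0.
Qed.

(** Each b / m has absolute value less than 1, hence is shorter than all nonzero lattice points, and
    e_z preserves its absolute value. *)
Lemma Eall_growth r : exists c : R, forall z, far `|z| z -> 1 <= `|z| -> `|Eall n r z| = c.
Proof.
exists (\prod_(m <- monic_divisors n) (\prod_(b <- mons F (size m).-1) `|Aemb b / Aemb m|) ^ r m).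
move=> z fz z1; rewrite /Eall abs_prod; apply: eq_big_seq => m /(divisorP nm)[mm _].
have m0 := monic_neq0 mm; rewrite absXz /Eprod abs_prod; congr (_ ^ _).
apply: eq_big_seq => b; rewrite mem_mons => /andP[bm sb]; apply: exp_vert_const => //.
rewrite absvM absV ltr_pdivrMr ?abs_gt0 ?Aemb_eq0 // mul1r [X in _ < X]abs_Aemb //.
exact: abs_size_lt.
Qed.

Lemma Delta_quotient_growth r : exists2 c : R, 0 < c & forall y, far `|y| y ->
  `|Aemb n| < `|y| ->
  `|Delta_quotient n r (T * y)| = c * `|t (T * y)| ^ (((q - 1) * pnorm n)%N%:Z * divnorm n r).
Proof.
have [c c0 hc] := Delta_growth; have [c' hc'] := Eall_growth r.
have n1 := abs_Aemb_ge1 C (monic_neq0 nm).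
have fT y : far `|y| y -> `|Aemb n| < `|y| -> far `|T * y| (T * y) /\ 1 <= `|T * y|.
  move=> fy yn; split; first exact: (vert_mul fy (negbT (polyX_eq0 F))).
  by rewrite absvM abs_T mulr_ege1 // ltW ?qR_gt1 // (le_lt_trans n1).
pose d := `|divval C n r| ^- (q ^ 2 - 1).
have h y : far `|y| y -> `|Aemb n| < `|y| -> `|Delta_quotient n r (T * y)| =
    d * c ^ divnorm n r * c' ^+ level F * `|t (T * y)| ^ (((q - 1) * pnorm n)%N%:Z * divnorm n r).
  move=> fy yn; have [fz z1] := fT y fy yn; have Oz := far_Omega (lt_le_trans ltr01 z1) fz.
  rewrite (Delta_quotientE nm) // !absvM absV !absX absXz hc // hc' // expfzMl.
  have -> : `|t (T * y)| ^+ ((q - 1) * pnorm n) ^ divnorm n r =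
    `|t (T * y)| ^ (((q - 1) * pnorm n)%N%:Z * divnorm n r) by rewrite -exprz_exp.
  by rewrite -/d mulrA mulrAC.
exists (d * c ^ divnorm n r * c' ^+ level F) => //.
have [y [fy yn]] := vert_ex `|Aemb n|; have [fz z1] := fT y fy yn.
have Oz := far_Omega (lt_le_trans ltr01 z1) fz.
have [t0 _] := abs_cusp fz (lt_le_trans ltr01 z1).
have := h y fy yn; have : 0 < `|Delta_quotient n r (T * y)| by rewrite abs_gt0 Delta_quotient_neq0.
by move=> h1 h2; move: h1; rewrite h2 pmulr_lgt0 // exprz_gt0.
Qed.

End Growth.

Lemma expz_const_degree (R : realType) (x y : R) (k : int) :
  0 < x -> x < y -> x ^ k = y ^ k -> k = 0.
Proof.
move=> x0 xy h; have y0 := lt_trans x0 xy.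
have h1 : (y / x) ^ k = 1 by rewrite expfzMl -h exprz_inv -invr_expz mulfV // expfz_neq0 ?gt_eqF.
have : (y / x) ^ k = (y / x) ^ (0 : int) by rewrite h1 expr0z.
apply: ieexprIz; first by rewrite divr_gt0.
by rewrite gt_eqF // ltr_pdivlMr // mul1r.
Qed.

(** For the residue e < q - 1 of k, all q - 1 nonzero constants are roots of X^e - 1, so e = 0. *)
Lemma exponent_dvd (F : finFieldType) (k : int) :
  (forall c : F, c != 0 -> c ^ k = 1) -> ((#|F| - 1)%N%:Z %| k)%Z.
Proof.
move=> h; have q1 := q_gt1 F; have Q0 : (#|F| - 1)%N%:Z != 0 by rewrite eqz_nat; lia.
rewrite dvdzE; set Q := (#|F| - 1)%N.
pose e := `|(k %% Q)%Z|%N; have eE : (k %% Q)%Z = e%:Z by rewrite gez0_abs // modz_ge0.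
have eQ : (e < Q)%N by rewrite -ltz_nat -eE ltz_pmod // ltz_nat; lia.
have h1 c : c != 0 -> c ^+ e = 1 :> F.
  move=> c0; have := h c c0; rewrite (divz_eq k Q) eE [_ * Q%:Z]mulrC expfzDr // -exprz_exp.
  by rewrite -exprnP unit_exp // exp1rz mul1r.
have [e0|e0] := posnP e.
  by rewrite -dvdzE; apply/dvdz_mod0P; rewrite eE e0.
have p0 : 'X^e - 1%:P != 0 :> {poly F}.
  by rewrite -size_poly_eq0 size_XnsubC.
have sE : size [seq c <- enum F | c != 0] = Q.
  have := count_predC (pred1 0) (enum F); rewrite -cardE size_filter /Q => <-.
  by rewrite count_uniq_mem ?enum_uniq // mem_enum add1n subn1.
have := max_poly_roots (rs := [seq c <- enum F | c != 0]) p0 _ _.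
rewrite size_XnsubC // sE ltnS leqNgt eQ => h2; suff : false by []; apply: h2.
  apply/allP => c; rewrite mem_filter => /andP[c0 _].
  by rewrite /root !hornerE h1 // subrr.
by rewrite filter_uniq // enum_uniq.
Qed.

(** * From a root to the conditions *)

Section Necessity.
Variables (F : finFieldType) (R : realType) (C : Cinfty F R).
Local Notation q := #|F|.
Local Notation "`| x |" := (absv x) : ring_scope.
Local Notation sc := (sc C).
Local Notation Aemb := (Aemb C).
Local Notation T := (Aemb 'X).
Variables (n : {poly F}) (nm : n \is monic) (r : {poly F} -> int).
Local Notation s := (monic_divisors n).
Local Notation t := (@cusp_param F R C n).

Definition mx2 (a b c d : {poly F}) : 'M[{poly F}]_2 :=
  \matrix_(i, j) if i == 0 then (if j == 0 then a else b) else (if j == 0 then c else d).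

Lemma mx2E a b c d : [/\ mx2 a b c d 0 0 = a, mx2 a b c d 0 1 = b,
  mx2 a b c d 1 0 = c & mx2 a b c d 1 1 = d].
Proof. by rewrite !mxE. Qed.

Lemma mx2_GL2A a b c d : a * d - b * c \is a GRing.unit -> GL2A (mx2 a b c d).
Proof.
by have [e1 e2 e3 e4] := mx2E a b c d; rewrite /GL2A unitmxE det2 e1 e2 e3 e4.
Qed.

Lemma mx2_Gamma0 a b c d : a * d - b * c \is a GRing.unit -> n %| c ->
  Gamma0 n (mx2 a b c d).
Proof.
move=> u nc; split; first exact: mx2_GL2A.
by have [_ _ -> _] := mx2E a b c d.
Qed.

Lemma moebius_mx2 a b c d (z : C) :
  moebius (mx2 a b c d) z = (Aemb a * z + Aemb b) / (Aemb c * z + Aemb d).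
Proof. by have [e1 e2 e3 e4] := mx2E a b c d; rewrite /moebius e1 e2 e3 e4. Qed.

Lemma moebius1 (z : C) : moebius 1 z = z.
Proof. by rewrite /moebius !mxE /= Aemb1 Aemb0 mul1r mul0r add0r addr0 divr1. Qed.

Variable f : C -> option C.
Hypothesis mf : modular_function n f.
Hypothesis hf : forall z, Omega z ->
  omap (fun w => w ^+ level F) (f z) = Some (Delta_quotient n r z).

Let fv (z : C) : C := odflt 0 (f z).

Lemma root_value z : Omega z ->
  [/\ f z = Some (fv z), fv z ^+ level F = Delta_quotient n r z & fv z != 0].
Proof.
move=> Oz; have := hf Oz; rewrite /fv; case: (f z) => // w [E]; split=> //=.
have := Delta_quotient_neq0 nm r Oz; rewrite -E.
by apply: contraNneq => ->; rewrite expr0n (gtn_eqF (level_gt0 F)).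
Qed.

Lemma root_Gamma0 g z : Gamma0 n g -> Omega z -> fv (moebius g z) = fv z.
Proof. by move=> gG Oz; have [_ h _] := mf; rewrite /fv h. Qed.

(** The matrix with rows (1, 0) and (n, 1) has |n z + 1| > 1 at z = T w, so invariance of the
    quotient there forces the exponent of the automorphy factor to vanish. *)
Lemma necessity_weight : \sum_(m <- s) r m = 0.
Proof.
have [w [_ _ w1 fw]] := quadratic_ex C; have X0 := negbT (polyX_eq0 F).
have fz := vert_mul (z := w) (a := 'X) _ X0; rewrite w1 in fz; have {fz} fz := fz fw.
have zE : `|T * w| = q%:R by rewrite absvM abs_T w1 mulr1.
have q1 := qR_gt1 F R; have Oz : Omega (T * w) by apply: (far_Omega _ fz); rewrite zE qR_gt0.
have gG : Gamma0 n (mx2 1 0 n 1) by apply: mx2_Gamma0; rewrite ?mul1r ?mul0r ?subr0 ?unitr1 ?dvdpp.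
have [_ E1 f0] := root_value Oz.
have [gu _] := gG; have [_ E2 _] := root_value (moebius_Omega gu Oz).
have E := Delta_quotient_Gamma0 nm r gG Oz.
have [_ _ e3 e4] := mx2E 1 0 n 1.
have jE : jfac (mx2 1 0 n 1) (T * w) = Aemb n * (T * w) + 1 by rewrite /jfac e3 e4 Aemb1.
have j1 : 1 < `|jfac (mx2 1 0 n 1) (T * w)|.
  rewrite jE -Aemb1; apply: lt_le_trans (vert_ge 1 fz (monic_neq0 nm)).
  have n1 := abs_Aemb_ge1 C (monic_neq0 nm).
  by rewrite zE; apply: lt_le_trans q1 _; rewrite ler_peMl // ltW ?qR_gt0.
set k := (X in jfac _ _ ^ X) in E.
have hk : jfac (mx2 1 0 n 1) (T * w) ^ k = 1.
  have D0 : Delta_quotient n r (T * w) != 0 by rewrite -E1 expf_neq0.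
  by apply: (mulIf D0); rewrite mul1r -E -E2 root_Gamma0 // E1.
have k0 : k = 0.
  apply: (expz_const_degree (x := 1) ltr01 j1).
  by rewrite exp1rz -absXz hk abs1.
move/eqP: k0; rewrite /k mulf_eq0 => /orP[|/eqP //].
by rewrite eqz_nat subn_eq0 leqNgt -[X in (X < _)%N](exp1n 2) ltn_exp2r // q_gt1.
Qed.

(** The order of the root at oo is j - k; the unit factor 1 + h is kept close to 1 so that absolute
    values can be read off. *)
Lemma cusp_order : exists (j k : nat) (c : C) (h : C -> C) (B : R),
  [/\ c != 0, 0 < B, forall x : C, `|x| <= B^-1 -> `|h x| <= 2^-1
    & forall z, far B z -> fv z * t z ^+ k = c * t z ^+ j * (1 + h (t z))].
Proof.
have [_ _ hc] := mf; have [c [k [a [c0 ha]]]] := hc 1 (unitmx1 _ _).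
have ha' z : far c z -> cvg_seq (psum a (t z)) (fv z * t z ^+ k).
  move=> fz; have [w [fw cw]] := ha z (proj1 (far_Kinf c z) fz).
  rewrite moebius1 in fw; have -> : fv z = w by rewrite /fv fw.
  exact: cw.
have [z0 fz0] := far_ex C c; have [t0 _] := cusp_far nm c0 fz0.
pose rho := `|t z0|; have rho0 : 0 < rho by rewrite abs_gt0.
(* The definition gives only pointwise convergence. Convergence at the single point z0 bounds the
   partial sums, hence their differences, the terms. *)
have [B hB] : exists B, coef_bound rho B a.
  have cv := ha' z0 fz0; have [N hN] := cvg_bounded cv.
  have [B1 hB1] := bounded_seq [seq psum a (t z0) i | i <- iota 0 N].
  pose B := Num.max B1 (`|fv z0 * t z0 ^+ k| + 1).
  have hp i : `|psum a (t z0) i| <= B.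
    rewrite le_max; have [Ni|iN] := leqP N i; first by rewrite hN // orbT.
    by rewrite hB1 //; apply/mapP; exists i => //; rewrite mem_iota.
  exists B => i; have -> : `|a i| * rho ^+ i = `|psum a (t z0) i.+1 - psum a (t z0) i|.
    by rewrite /psum big_ord_recr /= addrAC subrr add0r absvM absX.
  exact: absBle.
have sG := ser_of_coef rho0 hB.
have GE z : far c z -> `|t z| < rho -> lim_seq (psum a (t z)) = fv z * t z ^+ k.
  by move=> fz _; apply: lim_seqE; apply: ha'.
have far_t e B' z : 0 < e -> far B' z -> c <= B' -> e^-1 < B' -> `|t z| < e /\ far c z.
  move=> e0 fz cB eB; split; last exact: far_le cB fz.
  have B0 := lt_le_trans c0 cB; have [_ h] := cusp_far nm B0 fz.
  by rewrite (le_lt_trans h) // invf_plt ?posrE.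
case: (ser_order rho0 sG) => [Gz|[j [c1 [rho' [h [c10 r'0 r'r sh hG]]]]]].
  (* A vanishing series is impossible, as the root is nonzero at points arbitrarily near the
     cusp. *)
  have [z fz] := far_ex C (c + rho^-1 + 1).
  have [||tz fcz] := far_t rho _ z rho0 fz.
  - by rewrite -addrA lerDl addr_ge0 // invr_ge0 ltW.
  - by rewrite addrAC ltrDr addr_gt0.
  have [t1 _] := cusp_far nm c0 fcz; have Oz := far_Omega c0 fcz; have [_ _ f0] := root_value Oz.
  have := Gz (t z) tz; rewrite GE // => /eqP; rewrite mulf_eq0 (negPf f0) /=.
  by rewrite expf_eq0 (negPf t1) andbF.
pose B' := c + rho'^-1 + 1.
have V0 : 0 < rho'^-1 by rewrite invr_gt0.
have cB : c <= B' by rewrite /B' -addrA lerDl addr_ge0 // ltW.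
have rB : rho'^-1 < B' by rewrite /B' addrAC ltrDr addr_gt0.
have B0 : 0 < B' := lt_le_trans c0 cB.
exists j, k, c1, h, B'; split=> //.
  move=> x xB; apply: (ser_abs r'0 sh); apply: (le_lt_trans xB).
  by rewrite invf_plt ?posrE.
move=> z fz; have [tz fcz] := far_t _ _ z r'0 fz cB rB.
by rewrite -hG // GE // (lt_le_trans tz).
Qed.

Lemma necessity_norm : ((level F)%:Z %| divnorm n r)%Z.
Proof.
have [j [k [c [h [B [c0 B0 hh hc]]]]]] := cusp_order.
have abs1h x : `|x| <= B^-1 -> `|1 + h x| = 1.
  move=> /hh hx; rewrite absD_dom abs1 // (le_lt_trans hx) // invf_lt1 //; lra.
(* Scaling z by a constant e fixes f and multiplies t by 1 / e; comparing the two leading terms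
   gives e^(j - k) = 1. *)
have dvd1 : ((q - 1)%N%:Z %| j%:Z - k%:Z)%Z.
  apply: exponent_dvd => e e0; have [z fz] := far_ex C B.
  have [t0 ht] := cusp_far nm B0 fz; have Oz := far_Omega B0 fz.
  have se0 : sc e != 0 by rewrite fmorph_eq0.
  have fz' : far B (sc e * z).
    have := Omega_far_mul fz (m := e%:P); rewrite polyC_eq0 => /(_ e0).
    by rewrite (abs_sc C e0) mul1r.
  have fE : fv (sc e * z) = fv z.
    rewrite -(@root_Gamma0 (mx2 e%:P 0 0 1) z) //.
      by rewrite moebius_mx2 Aemb0 Aemb1 mul0r add0r addr0 divr1.
    apply: mx2_Gamma0; rewrite ?dvdp0 // mulr1 mul0r subr0.
    by rewrite poly_unitE size_polyC e0 coefC /= unitfE.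
  have lN := lattice1_lattice C (monic_neq0 nm).
  have tE : t (sc e * z) = (sc e)^-1 * t z by rewrite /cusp_param exp_Z // invfM.
  have ht' : `|t (sc e * z)| <= B^-1 by rewrite tE absvM absV (abs_sc C e0) invr1 mul1r.
  have E1 := hc z fz; have E2 := hc _ fz'; rewrite fE in E2.
  set u := 1 + h (t z) in E1; set v := 1 + h (t (sc e * z)) in E2.
  have u1 : `|u| = 1 by apply: abs1h.
  have u0 : u != 0 by rewrite -abs_gt0 u1.
  have E3 : sc e ^+ j * u = sc e ^+ k * v.
    have tj0 : c * t z ^+ j != 0 by rewrite mulf_neq0 // expf_neq0.
    apply: (mulfI tj0).
    have -> : c * t z ^+ j * (sc e ^+ j * u) = sc e ^+ j * (fv z * t z ^+ k) by rewrite E1; ring.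
    have -> : fv z * t z ^+ k = sc e ^+ k * (fv z * t (sc e * z) ^+ k).
      by rewrite tE exprMn [(sc e)^-1 ^+ k]exprVn [RHS]mulrCA [sc e ^+ k * _]mulrA mulfV ?expf_neq0 // mul1r.
    rewrite E2 tE exprMn [(sc e)^-1 ^+ j]exprVn.
    have -> : sc e ^+ j * (sc e ^+ k * (c * (sc e ^- j * t z ^+ j) * v)) =
      (sc e ^+ j / sc e ^+ j) * (c * t z ^+ j * (sc e ^+ k * v)) by ring.
    by rewrite mulfV ?expf_neq0 // mul1r.
  (* The element e^(j - k) - 1 of F would have absolute value 1 if nonzero, but it equals (v - u) /
     u, of absolute value at most 1 / 2. *)
  apply/eqP; rewrite -subr_eq0; apply/negP => /negP d0.
  have := abs_sc C d0; rewrite rmorphB rmorph1 fmorphXz expfzDr // -exprnN -exprnP.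
  have -> : sc e ^+ j * sc e ^- k - 1 = (v - u) / u.
    by rewrite mulrBl mulfV //; congr (_ - _); apply: (mulIf u0); rewrite divfK //
       mulrAC E3 mulrAC mulfV ?expf_neq0 // mul1r.
  rewrite absvM absV u1 invr1 mulr1 => d1.
  have : `|v - u| <= 2^-1.
    have -> : v - u = h (t (sc e * z)) - h (t z) by rewrite /u /v; ring.
    by apply: absBle; apply: hh.
  rewrite d1; lra.
have [c' c'0 hD] := Delta_quotient_growth C nm r.
(* [Nz] is the exponent of |t| predicted for f^N by the expansion at oo and [b] the one found for
   the quotient. Two points of the axis with different |t| force them to agree. *)
pose b := ((q - 1) * pnorm n)%N%:Z * divnorm n r; pose Nz := (level F)%:Z * (j%:Z - k%:Z).
have E y : far `|y| y -> `|Aemb n| < `|y| -> B <= `|y| ->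
    `|c| ^+ level F * `|t (T * y)| ^ (Nz - b) = c' /\ 0 < `|t (T * y)| <= `|T * y|^-1.
  move=> fy yn yB; have fz := vert_mul fy (negbT (polyX_eq0 F)).
  have y0 : 0 < `|y| by apply: le_lt_trans yn; apply: absv_ge0.
  have zB : B <= `|T * y|.
    by rewrite absvM abs_T (le_trans yB) // ler_peMl ?absv_ge0 // ltW ?qR_gt1.
  have fzB := far_le zB fz; have Oz := far_Omega B0 fzB.
  have [t0 ht] := abs_cusp nm fz (lt_le_trans B0 zB); split; last by rewrite t0 ht.
  have [_ ht'] := cusp_far nm B0 fzB.
  have := congr1 (@absv _ _ _) (hc _ fzB); rewrite !absvM !absX (abs1h _ ht') mulr1 => E1.
  have [_ E2 _] := root_value Oz; have := congr1 (@absv _ _ _) E2; rewrite hD // absX => E3.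
  set x := `|t (T * y)| in t0 E1 E3 *; have x0 : x != 0 by rewrite gt_eqF.
  have E4 : `|fv (T * y)| = `|c| * x ^ (j%:Z - k%:Z).
    apply: (mulIf (expf_neq0 k x0)); rewrite E1 -mulrA; congr (_ * _).
    by rewrite expfzDr // -exprnN -!exprnP divfK // expf_neq0.
  have xN : (x ^ (j%:Z - k%:Z)) ^+ level F = x ^ Nz by rewrite exprnP exprz_exp mulrC.
  apply: (mulIf (expfz_neq0 b x0)); rewrite -E3 E4 exprMn xN -mulrA -expfzDr //.
  by rewrite subrK.
have [y1 [f1 h1]] := vert_ex C (`|Aemb n| + B).
have n0 : 0 <= `|Aemb n| by apply: absv_ge0.
have [||E1 /andP[t1 _]] := E y1 f1.
- by rewrite (lt_trans _ h1) // ltrDl.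
- by rewrite ltW // (le_lt_trans _ h1) // lerDr.
have [y2 [f2 h2]] := vert_ex C (`|Aemb n| + B + `|t (T * y1)|^-1).
have V0 : 0 < `|t (T * y1)|^-1 by rewrite invr_gt0.
have [||E2 /andP[t2 ht2]] := E y2 f2.
- by rewrite (lt_trans _ h2) // -addrA ltrDl addr_gt0.
- by rewrite ltW // (le_lt_trans _ h2) // addrAC lerDr addr_ge0 // ltW.
have t21 : `|t (T * y2)| < `|t (T * y1)|.
  apply: le_lt_trans ht2 _; rewrite invf_plt ?posrE //; last first.
    by rewrite absvM abs_T mulr_gt0 ?qR_gt0 // (lt_trans _ h2) // addr_gt0 // ltr_wpDl.
  have h3 : `|t (T * y1)|^-1 < `|y2| by rewrite (lt_trans _ h2) // ltrDr ltr_wpDl.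
  by rewrite absvM abs_T (lt_le_trans h3) // ler_peMl ?absv_ge0 // ltW ?qR_gt1.
have Nb : Nz - b = 0.
  apply: (expz_const_degree t2 t21).
  have cN0 : `|c| ^+ level F != 0 by rewrite expf_neq0 // abs_eq0.
  by apply: (mulfI cN0); rewrite E1 E2.
have /dvdzP[l jk] := dvd1.
have : (level F)%:Z * l = (pnorm n)%:Z * divnorm n r.
  have Q0 : (q - 1)%N%:Z != 0 by rewrite eqz_nat subn_eq0 -ltnNge q_gt1.
  apply: (mulfI Q0); move/eqP: Nb; rewrite subr_eq0 /Nz /b jk PoszM => /eqP NE.
  have -> : (q - 1)%N%:Z * ((level F)%:Z * l) = (level F)%:Z * (l * (q - 1)%N%:Z) by ring.
  by rewrite NE -mulrA.
move=> NE; have : ((level F)%:Z %| (pnorm n)%:Z * divnorm n r)%Z by rewrite -NE dvdz_mulr.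
by rewrite Gauss_dvdzr // coprimezE /= level_coprime.
Qed.

Lemma frob_fixed (x : C) : x ^+ q = x -> exists c, x = sc c.
Proof.
move=> xq; have := congr1 (map_poly sc) (finField_genPoly F).
rewrite rmorphB /= map_polyXn map_polyX rmorph_prod => /(congr1 (fun p => p.[x])).
rewrite hornerD hornerN hornerXn hornerX xq subrr horner_prod => /esym/eqP/prodf_eq0[c _].
by rewrite /= rmorphB /= map_polyX map_polyC hornerXsubC subr_eq0 => /eqP ->; exists c.
Qed.

(* Multiplying by the conjugate [c * w ^+ q + d] of the denominator shows that a Moebius
   transformation maps w into K + K w. *)
Lemma moebius_quadratic (w : C) a b c d : w ^+ (q ^ 2) = w -> far 1 w -> c != 0 ->
  a * d - b * c = 1 -> exists k l : ratfun F, l != 0 /\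
  (Aemb a * w + Aemb b) / (Aemb c * w + Aemb d) = Kemb C k + Kemb C l * w.
Proof.
move=> wq fw c0 det1.
have [w' w'd w'q] : exists2 w', w' = w ^+ q & w' ^+ q = w.
  by exists (w ^+ q); rewrite // -exprM.
have [t0 tE] : exists t0, w + w' = sc t0.
  by apply: frob_fixed; rewrite -[q in LHS]expn1 frobD !expn1 w'q -w'd addrC.
have [n0 nE] : exists n0, w * w' = sc n0.
  by apply: frob_fixed; rewrite exprMn w'q -w'd mulrC.
have c0' : Aemb c != 0 by rewrite Aemb_eq0.
have notK k : w != Kemb C k.
  by apply/eqP => E; have := fw k; rewrite E subrr abs0 ler10.
have notK' k : w' != Kemb C k.
  by apply/eqP => E; have := notK (k ^+ q); rewrite rmorphXn -E w'q eqxx.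
have lin x : (forall k, x != Kemb C k) -> Aemb c * x + Aemb d != 0.
  move=> nx; apply/eqP => E; have := nx (- d%:F / c%:F).
  rewrite fmorph_div rmorphN; change (x != - Aemb d / Aemb c -> False).
  by rewrite -(inj_eq (mulfI c0')) mulrCA divff // mulr1 -addr_eq0 E eqxx.
have h1 := lin w notK; have h2 := lin w' notK'.
(* Norm of c w + d from the quadratic extension, with trace t0 and norm n0 of w. In (a w + b) (c w'
   + d) the coefficient of w is the determinant 1, and [k] is the rest. *)
pose Nm := c ^+ 2 * n0%:P + c * d * t0%:P + d ^+ 2.
pose k := a * c * n0%:P + b * c * t0%:P + b * d.
have w'E : w' = sc t0 - w by rewrite -tE addrC addKr.
have NE : Aemb Nm = (Aemb c * w + Aemb d) * (Aemb c * w' + Aemb d).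
  rewrite /Nm !AembD !AembM -/(sc n0) -/(sc t0) -nE -tE; ring.
have kE : Aemb k + w = (Aemb a * w + Aemb b) * (Aemb c * w' + Aemb d).
  have -> : (Aemb a * w + Aemb b) * (Aemb c * w' + Aemb d) =
    Aemb a * Aemb c * (w * w') + Aemb b * Aemb c * (w + w') + Aemb b * Aemb d
    + (Aemb a * Aemb d - Aemb b * Aemb c) * w by ring.
  rewrite nE tE -!AembM -AembB det1 Aemb1 mul1r /k !AembD !AembM //.
have N0 : Nm != 0 by rewrite -(Aemb_eq0 C) NE mulf_neq0.
exists (k%:F / Nm%:F), (Nm%:F)^-1; split; first by rewrite invr_eq0 tofrac_eq0.
rewrite fmorph_div fmorphV.
change ((Aemb a * w + Aemb b) / (Aemb c * w + Aemb d) = Aemb k / Aemb Nm + (Aemb Nm)^-1 * w).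
rewrite [(Aemb Nm)^-1 * w]mulrC -mulrDl kE NE invfM mulrA.
by rewrite [RHS]mulrAC mulfK.
Qed.

Lemma necessity_power : is_power (q - 1) (\prod_(m <- s) m%:F ^ r m).
Proof.
have /dvdz_divnorm[K hK] := necessity_norm; have r0 := necessity_weight.
have [ka kaE] : exists ka, ka ^+ level F = divval C n r ^- (q ^ 2 - 1).
  have /closed_rootP[ka] : size ('X^(level F) - (divval C n r ^- (q ^ 2 - 1))%:P) != 1.
    by rewrite size_XnsubC ?level_gt0 // eqSS -lt0n level_gt0.
  by rewrite /root !hornerE subr_eq0 => /eqP; exists ka.
pose F0 := rootfun n r ka K.
have F0E z : Omega z -> F0 z ^+ level F = Delta_quotient n r z.
  by move=> Oz; apply: rootfun_exp.
have F00 z : Omega z -> F0 z != 0.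
  move=> Oz; have := Delta_quotient_neq0 nm r Oz; rewrite -F0E //.
  by apply: contraNneq => ->; rewrite expr0n (gtn_eqF (level_gt0 F)).
pose ze z := fv z / F0 z.
have zeE z : Omega z -> fv z = ze z * F0 z by move=> Oz; rewrite /ze divfK // F00.
(* The N-th roots of unity, a finite list of possible values for the ratio of the given root to the
   explicit one. *)
have [rs hrs] := closed_field_poly_normal ('X^(level F) - 1 : {poly C}).
have zers z : Omega z -> ze z \in rs.
  move=> Oz; have [_ E _] := root_value Oz.
  have : root ('X^(level F) - 1) (ze z).
    by rewrite /root !hornerE exprMn exprVn E F0E // divff ?subrr // Delta_quotient_neq0.
  have l0 : lead_coef ('X^(level F) - 1 : {poly C}) != 0.
    by rewrite lead_coef_eq0 -size_poly_eq0 size_XnsubC ?level_gt0.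
  by rewrite hrs rootZ // root_prod_XsubC.
apply/(char_power sc r nm) => d cd.
have [[u v] /= uv] := Bezout_eq1_coprimepP _ _ cd.
have [w [wq _ w1 fw]] := quadratic_ex C; have Ow := far_Omega ltr01 fw.
have det1 : u * d - (- v) * n = 1 by rewrite mulNr opprK.
(* Every d prime to n occurs as the lower right entry of such a matrix, so its character value can
   be tested. *)
have gG : Gamma0 n (mx2 u (- v) n d) by apply: mx2_Gamma0; rewrite ?dvdpp // det1 unitr1.
have [k [l [l0 gE]]] := moebius_quadratic wq fw (monic_neq0 nm) det1.
rewrite -moebius_mx2 in gE; set z1 := moebius _ w in gE.
have [gu _] := gG; have Oz1 : Omega z1 := moebius_Omega gu Ow.
have [M [X0 X1 hM]] := hol_no_zero_divisors k fw w1 fw w1 l0.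
rewrite -gE in X1 hM; have [hmer _ _] := mf; have [g [h [hg hh _ gh]]] := hmer M.
have ghE z : Omega_aff M z -> h z != 0 /\ g z = fv z * h z.
  move=> Xz; have Oz := Omega_aff_Omega Xz; have [fE _ _] := root_value Oz.
  have [_] := gh z Xz; rewrite fE; case: eqP => // /eqP h0 [->]; by rewrite divfK.
have fac z rho : Omega_aff M z -> g z - rho * (h z * F0 z) = h z * ((ze z - rho) * F0 z).
  move=> Xz; have [h0 ->] := ghE z Xz; rewrite (zeE z (Omega_aff_Omega Xz)).
  by move: (ze z) (F0 z) (h z) => x1 x2 x3; ring.
have hol_fac rho : holomorphic_on (Omega_aff M) (fun z => g z - rho * (h z * F0 z)).
  apply: (@hol_ext _ _ _ _ (fun z => g z + (- rho) * (h z * F0 z))) => [z _|].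
    by rewrite mulNr.
  apply: hol_add => //; apply: hol_mul; first exact: hol_cst.
  by apply: hol_mul => //; have [] := holu_rootfun M r ka K nm.
(* [Q] vanishes where the ratio takes its value at w and [P] where it takes any other; the
   denominator [h] is cleared to keep both holomorphic. Their product is zero and P w is not, so Q
   vanishes at z1. *)
pose Q z := g z - ze w * (h z * F0 z).
pose P z := \prod_(rho <- rs | rho != ze w) (g z - rho * (h z * F0 z)).
have [|||Pw|Qz] := hM P Q.
- by apply: hol_prod => rho _ _; apply: hol_fac.
- exact: hol_fac.
- move=> z Xz; have [E|E] := eqVneq (ze z) (ze w).
    by rewrite /Q fac // E subrr mul0r !mulr0.
  suff -> : P z = 0 by rewrite mul0r.
  apply/eqP; rewrite /P prodf_seq_eq0; apply/hasP; exists (ze z).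
    exact: zers (Omega_aff_Omega Xz).
  by rewrite E fac // subrr mul0r mulr0 eqxx.
- exfalso; move/eqP: Pw; rewrite /P prodf_seq_eq0 => /hasP[rho _ /andP[rw]].
  have [h0 _] := ghE w X0; rewrite fac // mulf_eq0 (negPf h0) /= mulf_eq0 (negPf (F00 w Ow)) orbF /=.
  by rewrite subr_eq0 eq_sym (negPf rw).
have [h0 _] := ghE z1 X1.
have zz : ze z1 = ze w.
  move/eqP: Qz; rewrite /Q fac // mulf_eq0 (negPf h0) /= mulf_eq0 (negPf (F00 z1 Oz1)) orbF /=.
  by rewrite subr_eq0 => /eqP.
have fz : fv z1 = fv w by apply: root_Gamma0.
have FE := rootfun_Gamma0 nm ka gG Ow hK r0; have [_ _ _ e4] := mx2E u (- v) n d.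
rewrite -/z1 -/(F0 z1) -/(F0 w) e4 in FE; set x := (X in sc X) in FE *.
have [_ _ fw0] := root_value Ow; have z0 : ze w != 0 by rewrite mulf_neq0 ?invr_eq0 ?F00.
have F1 : F0 z1 = F0 w by apply: (mulfI z0); rewrite -{1}zz -!zeE.
suff : sc x = sc 1 by move/fmorph_inj.
by apply: (mulIf (F00 w Ow)); rewrite -FE F1 rmorph1 mul1r.
Qed.

End Necessity.

Theorem theorem1p3 (F : finFieldType) (R : realType) (C : Cinfty F R)
    (n : {poly F}) (hn : n \is monic) (r : {poly F} -> int) :
  let q := #|F| in
  let N := ((q - 1) * (q ^ 2 - 1))%N in
  has_modular_root n N (@Delta_quotient F R C n r)
  <->
  [/\ (\sum_(a <- monic_divisors n) r a * (pnorm a)%:Z = 0 %[mod N%:Z])%Z,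
      (\sum_(a <- monic_divisors n) r a * (pnorm (n %/ a))%:Z
         = 0 %[mod N%:Z])%Z,
      \sum_(a <- monic_divisors n) r a = 0
    & is_power (q - 1) (\prod_(a <- monic_divisors n) a%:F ^ r a)].
Proof.
move=> q N.
have modE (x : int) : (x = 0 %[mod N%:Z])%Z <-> ((level F)%:Z %| x)%Z.
  by rewrite -[X in (_ %| X)%Z]subr0 -eqz_mod_dvd; split=> /eqP.
split=> [[f [mf hf]]|[/modE h1 _ h3 h4]].
  have h1 := necessity_norm hn mf hf; have h4 := necessity_power hn mf hf.
  split; [exact/modE| |exact: (necessity_weight hn mf hf)|exact: h4].
  by apply/modE; apply: dual_norm => //; apply: (power_degree C hn h4).
exact: conditions_root.
Qed.
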